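(* For $f\in L^2(0,T;L^2(\Omega))$ and $u_0\in L^2(\Omega)$ there exists at least one solution $u_h$, $u_h(t)\in V_h$, of the semi-discrete non-conforming (Crouzeix–Raviart) scheme $$(\partial_t u_h(t),\chi)+A_{CR}(u_h(t),\chi)+\eta\big((K*\nabla_h u_h)(t),\nabla_h\chi\big)=(f(t),\chi),\qquad (u_h(0),\chi)=(u_h^0,\chi),\qquad \forall \chi\in V_h,\ t\in(0,T).$$ Moreover, for $u_h^0\in L^{d\delta}(\Omega)$, the weak solution of this system is unique.
   Context: $\Omega\subset\mathbb R^d$ ($d=2,3$) is an open bounded simply connected convex domain with Lipschitz boundary, $T>0$, $(\cdot,\cdot)$ is the $L^2(\Omega)$ inner product. Parameters: $\alpha>0$, $\delta\ge1$, $\beta>0$, $\gamma\in(0,1)$, $\nu>0$, $\eta\ge0$ (the paper writes powers such as $u^\delta$ of real-valued functions without specifying a convention for non-integer $\delta$). $K$ is a weakly singular positive kernel: $K\in L^1(0,T)$ and, for any $T>0$, $\int_0^T\int_0^tK(t-\tau)v(\tau)v(t)\,d\tau\,dt\ge0$ for all $v\in L^2(0,T)$; $(K*g)(t)=\int_0^tK(t-\tau)g(\tau)\,d\tau$. $u_0$ and $f$ are the initial datum and forcing of the generalized Burgers–Huxley equation with memory $\partial_tu-\nu\Delta u+\alpha u^\delta\sum_{i=1}^d\partial_{x_i}u-\beta u(1-u^\delta)(u^\delta-\gamma)-\eta\int_0^tK(t-\tau)\Delta u(\tau)\,d\tau=f$ in $\Omega\times(0,T)$, $u=0$ on $\partial\Omega\times(0,T)$,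 $u(\cdot,0)=u_0$. $\mathcal T_h$ is a shape-regular mesh of $\Omega$ with set of edges (faces) $\mathcal E$, $V_h=\{v\in L^2(\Omega): v|_K\in\mathbb P_1\ \forall K\in\mathcal T_h,\ \int_E[|v|]=0\ \forall E\in\mathcal E\}$ is the Crouzeix–Raviart space, where $\mathbb P_1$ denotes polynomials of degree at most one and $[|v|]$ is the jump (the trace on boundary edges); $\nabla_h$ is the elementwise gradient; $u_h^0\in V_h$ is the approximation of $u_0$. Let $(\cdot,\cdot)_{\mathcal T_h}=\sum_{K\in\mathcal T_h}\int_K\cdot\,\cdot$ and $$A_{CR}(u,\chi)=\nu a_{CR}(u,\chi)+\alpha b_{CR}(u;u,\chi)-\beta(c(u),\chi),\quad a_{CR}(u,v)=(\nabla_hu,\nabla_hv),\quad c(u)=u(1-u^\delta)(u^\delta-\gamma),$$ $$b_{CR}(u;u,w)=\frac1{\delta+2}\Big(u^\delta\sum_{i=1}^d\frac{\partial u}{\partial x_i},w\Big)_{\mathcal T_h}-\frac1{\delta+2}\Big(u^\delta\sum_{i=1}^d\frac{\partial w}{\partial x_i},u\Big)_{\mathcal T_h}.$$ *)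

(* Defs.v *)
From HB Require Import structures.
From mathcomp Require Import all_boot all_order all_algebra.
From mathcomp Require Import all_classical all_reals all_analysis.

Set Implicit Arguments.
Unset Strict Implicit.
Unset Printing Implicit Defensive.

Import Order.TTheory GRing.Theory Num.Theory.
Import numFieldNormedType.Exports.

Local Open Scope classical_set_scope.
Local Open Scope ring_scope.

Definition rV_display : measure_display -> measure_display.
Proof. exact. Qed.

Section measurable_rV.
Variables (R : realType) (n : nat).

Definition rV_coord (i : 'I_n) (x : 'rV[R]_n) : measurableTypeR R := x ord0 i.

Let rV_set0 : g_sigma_preimage rV_coord set0.
Proof. exact: sigma_algebra0. Qed.

Let rV_setC A : g_sigma_preimage rV_coord A -> g_sigma_preimage rV_coord (~` A).
Proof. exact: sigma_algebraC. Qed.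

Let rV_bigcup (F : (set 'rV[R]_n)^nat) :
  (forall i, g_sigma_preimage rV_coord (F i)) ->
  g_sigma_preimage rV_coord (\bigcup_i (F i)).
Proof. exact: sigma_algebra_bigcup. Qed.

HB.instance Definition _ := @isMeasurable.Build
  (rV_display default_measure_display) 'rV[R]_n
  (g_sigma_preimage rV_coord) rV_set0 rV_setC rV_bigcup.

Lemma measurable_rV_coord (i : 'I_n) : measurable_fun setT (rV_coord i).
Proof.
move=> _ Y mY; rewrite setTI; apply: sub_sigma_algebra => /=.
rewrite -bigcup_seq/=; exists i => /=; first by rewrite mem_index_enum.
by exists Y => //; rewrite setTI.
Qed.

Lemma measurable_fun_rVP d (T : measurableType d) (f : T -> 'rV[R]_n) :
  measurable_fun setT f <->
  forall i, measurable_fun setT (rV_coord i \o f).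
Proof.
split=> [mf i|mf].
  exact: (measurableT_comp (measurable_rV_coord i) mf).
move=> _ A mA; rewrite setTI; move: A mA.
apply: smallest_sub.
  split; first by rewrite /= preimage_set0; exact: measurable0.
  - move=> A /= mA; rewrite setTD preimage_setC; exact: measurableC.
  - move=> F /= mF; rewrite preimage_bigcup; exact: bigcup_measurable.
move=> A; rewrite -bigcup_seq => -[i _ [B mB <-]] /=.
rewrite setTI -comp_preimage -[X in measurable X]setTI.
exact: mf.
Qed.

End measurable_rV.

Section lebesgue_step.
Local Open Scope ereal_scope.
Variables (R : realType) (n : nat).
Variable m : {sigma_finite_measure set 'rV[R]_n -> \bar R}.

Definition rV_cons (z : measurableTypeR R * 'rV[R]_n) : 'rV[R]_n.+1 :=
  \row_i (if unlift ord0 i is Some j then z.2 ord0 j else z.1).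

Definition rV_uncons (x : 'rV[R]_n.+1) : measurableTypeR R * 'rV[R]_n :=
  (x ord0 ord0, \row_j x ord0 (lift ord0 j)).

Lemma rV_consK : cancel rV_cons rV_uncons.
Proof.
move=> [a y]; rewrite /rV_uncons /rV_cons mxE unlift_none; congr pair.
by apply/rowP => j; rewrite !mxE liftK.
Qed.

Lemma rV_unconsK : cancel rV_uncons rV_cons.
Proof.
move=> x; apply/rowP => i; rewrite !mxE /=.
by case: unliftP => [j|] -> //; rewrite mxE.
Qed.

Lemma measurable_rV_cons : measurable_fun setT rV_cons.
Proof.
apply/measurable_fun_rVP => i.
case: (unliftP ord0 i) => [j|] ->.
  rewrite (_ : _ \o _ = rV_coord j \o snd).
    exact: (measurableT_comp (measurable_rV_coord j) measurable_snd).
  by apply/funext => z; rewrite /rV_coord /= mxE liftK.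
rewrite (_ : _ \o _ = fst); first exact: measurable_fst.
by apply/funext => z; rewrite /rV_coord /= mxE unlift_none.
Qed.

Lemma measurable_rV_uncons : measurable_fun setT rV_uncons.
Proof.
apply: measurable_fun_pair => /=; first exact: (measurable_rV_coord ord0).
apply/measurable_fun_rVP => j.
rewrite (_ : _ \o _ = rV_coord (lift ord0 j)); first exact: measurable_rV_coord.
by apply/funext => x; rewrite /rV_coord /= mxE.
Qed.

Definition rV_leb_step : set 'rV[R]_n.+1 -> \bar R :=
  pushforward (@lebesgue_measure R \x m) rV_cons.

Let step0 : rV_leb_step set0 = 0.
Proof. by rewrite /rV_leb_step /pushforward preimage_set0 measure0. Qed.

Let step_ge0 A : 0 <= rV_leb_step A.
Proof. by rewrite /rV_leb_step /pushforward measure_ge0. Qed.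

Let step_sigma_additive : semi_sigma_additive rV_leb_step.
Proof.
move=> F mF tF mUF; rewrite /rV_leb_step /pushforward preimage_bigcup.
apply: measure_semi_sigma_additive.
- by move=> k; rewrite -[X in measurable X]setTI; exact: measurable_rV_cons.
- apply/trivIsetP => /= i j _ _ ij; rewrite -preimage_setI.
  by move/trivIsetP : tF => /(_ _ _ _ _ ij) ->//; rewrite preimage_set0.
- by rewrite -preimage_bigcup -[X in measurable X]setTI;
    exact: measurable_rV_cons.
Qed.

HB.instance Definition _ := isMeasure.Build _ _ _
  rV_leb_step step0 step_ge0 step_sigma_additive.

Let step_sigma_finite : sigma_finite setT rV_leb_step.
Proof.
have /sigma_finiteP[F [TF ndF Foo]] := sigma_finiteT (@lebesgue_measure R).
have /sigma_finiteP[G [TG ndG Goo]] := sigma_finiteT m.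
exists (fun i => rV_uncons @^-1` (F i `*` G i)).
  rewrite -preimage_bigcup; apply/seteqP; split=> // x _.
  have [/= i _ Fi] : (\bigcup_i F i) (rV_uncons x).1 by rewrite -TF.
  have [/= j _ Gj] : (\bigcup_i G i) (rV_uncons x).2 by rewrite -TG.
  exists (maxn i j) => //; split.
    by move: Fi; exact/subsetPset/ndF/leq_maxl.
  by move: Gj; exact/subsetPset/ndG/leq_maxr.
move=> i; have [mF Fi] := Foo i; have [mG Gi] := Goo i.
have mFG : measurable (F i `*` G i) by exact: measurableX.
split; first by rewrite -[X in measurable X]setTI; exact: measurable_rV_uncons.
rewrite /rV_leb_step /pushforward -comp_preimage.
rewrite (_ : _ \o _ = id); last by apply/funext; exact: rV_consK.
by rewrite preimage_id product_measure1E// lte_mul_pinfty// ge0_fin_numE.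
Qed.

HB.instance Definition _ := Measure_isSigmaFinite.Build _ _ _
  rV_leb_step step_sigma_finite.

End lebesgue_step.

(* n-fold product of the Lebesgue measure on the real line *)
Fixpoint rV_lebesgue (R : realType) (n : nat) :
    {sigma_finite_measure set 'rV[R]_n -> \bar R} :=
  match n with
  | 0 => dirac (0 : 'rV[R]_0)
  | m.+1 => rV_leb_step (rV_lebesgue R m)
  end.

Definition memLp d (T : measurableType d) (R : realType)
    (m : {measure set T -> \bar R}) (p : R) (D : set T) (g : T -> R) : Prop :=
  measurable_fun D g /\ (\int[m]_(x in D) (`|g x| `^ p)%:E < +oo)%E.

Definition path_in (R : realType) (V : topologicalType) (A : set V)
    (c : R -> V) : Prop :=
  {within `[0, 1], continuous c} /\ (forall s, s \in `[0, 1] -> A (c s)).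

Definition simply_connected (R : realType) (V : topologicalType) (A : set V) :
    Prop :=
  (forall x y, A x -> A y ->
     exists c : R -> V, [/\ path_in A c, c 0 = x & c 1 = y]) /\
  (forall c : R -> V, path_in A c -> c 0 = c 1 ->
     exists H : R * R -> V,
       [/\ {within `[0, 1] `*` `[0, 1], continuous H},
           forall s t, s \in `[0, 1] -> t \in `[0, 1] -> A (H (s, t)),
           forall t, t \in `[0, 1] -> H (0, t) = c t,
           forall t, t \in `[0, 1] -> H (1, t) = c 0
         & forall s, s \in `[0, 1] -> H (s, 0) = c 0 /\ H (s, 1) = c 0]).

Definition boundary (V : topologicalType) (A : set V) : set V :=
  closure A `\` A°.

(* In orthonormal coordinates [y *m Q], the domain is locally the strict
   epigraph of a Lipschitz function of all coordinates but the last. *)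
Definition lipschitz_boundary (R : realType) (n : nat)
    (Om : set 'rV[R]_n.+1) : Prop :=
  forall x, boundary Om x ->
  exists (Q : 'M[R]_n.+1) (phi : 'rV[R]_n -> R) (L r : R),
    [/\ 0 < r, Q *m Q^T = 1%:M,
        forall y z, `|phi y - phi z| <= L * `|y - z|
      & forall y, ball x r y ->
          Om y <-> phi (col' ord_max (y *m Q)) < (y *m Q) ord0 ord_max].

Definition domain (R : realType) (n : nat) (Om : set 'rV[R]_n.+1) : Prop :=
  [/\ Om !=set0, open Om & bounded_set Om] /\
  [/\ convex_set (Om : set (convex_lmodType 'rV[R]_n.+1)),
      simply_connected R Om & lipschitz_boundary Om].

(* The space dimension is [n.+1]; element [k] is the simplex with the [n.+2]
   vertices [vtx k i]. *)
Record mesh (R : realType) (n : nat) := Mesh {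
  nel : nat;
  vtx : 'I_nel -> 'I_n.+2 -> 'rV[R]_n.+1
}.

Section mesh_geometry.
Variables (R : realType) (n : nat) (M : mesh R n).
Implicit Types (k l : 'I_(nel M)) (i j : 'I_n.+2).

Definition hull (k : 'I_(nel M)) (P : pred 'I_n.+2) : set 'rV[R]_n.+1 :=
  [set x | exists w : 'I_n.+2 -> R,
     [/\ forall i, 0 <= w i, forall i, ~~ P i -> w i = 0,
         \sum_i w i = 1 & x = \sum_i w i *: vtx k i]].

Definition elt k : set 'rV[R]_n.+1 := hull k predT.

Definition face k i : set 'rV[R]_n.+1 := hull k (predC1 i).

Definition mesh_of (Om : set 'rV[R]_n.+1) : Prop :=
  [/\ forall k,
        \det (\matrix_(i < n.+1) (vtx k (lift ord0 i) - vtx k ord0)) != 0,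
      \bigcup_(k in [set: 'I_(nel M)]) elt k = closure Om,
      forall k l, k != l -> (elt k)° `&` (elt l)° = set0
    & forall k l, k != l ->
        elt k `&` elt l =
        hull k [pred i | [exists j, vtx k i == vtx l j]]].

Definition enorm (x : 'rV[R]_n.+1) : R := Num.sqrt (\sum_i x ord0 i ^+ 2).

(* element diameter <= rho * (diameter of an inscribed Euclidean ball) *)
Definition shape_regular (rho : R) : Prop :=
  forall k, exists (c : 'rV[R]_n.+1) (r : R),
    [/\ 0 < r, forall x, enorm (x - c) <= r -> elt k x
      & forall x y, elt k x -> elt k y -> enorm (x - y) <= rho * (2 * r)].

Definition ref_simplex : set 'rV[R]_n :=
  [set y : 'rV[R]_n | (forall j : 'I_n, 0 <= y ord0 j) /\
                      \sum_(j < n) y ord0 j <= 1].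

(* Surface integral over a face: pull-back along the affine parametrization of
   the face by the reference simplex, with the Gram determinant as area
   factor. *)
Definition face_integral k i (g : 'rV[R]_n.+1 -> R) : R :=
  let a (j : 'I_n.+1) := vtx k (lift i j) in
  let J : 'M[R]_(n, n.+1) := \matrix_(j < n) (a (lift ord0 j) - a ord0) in
  Num.sqrt (\det (J *m J^T)) *
  \int[rV_lebesgue R n]_(y in ref_simplex) g (a ord0 + y *m J).

(* A piecewise affine function is given by its coefficients: on element [k] it
   is [x |-> v k 0 + \sum_i v k (i+1) * x_i]. *)
Definition brokenP1 := 'M[R]_(nel M, n.+2).

Definition p1 (v : brokenP1) k (x : 'rV[R]_n.+1) : R :=
  v k ord0 + \sum_(i < n.+1) v k (lift ord0 i) * x ord0 i.

(* the associated function, with value 0 on the (negligible) mesh skeleton *)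
Definition pw (v : brokenP1) (x : 'rV[R]_n.+1) : R :=
  \sum_k \1_((elt k)°) x * p1 v k x.

Definition pwgrad (v : brokenP1) (i : 'I_n.+1) (x : 'rV[R]_n.+1) : R :=
  \sum_k \1_((elt k)°) x * v k (lift ord0 i).

Definition CR (Om : set 'rV[R]_n.+1) (v : brokenP1) : Prop :=
  (forall k l i j, k != l -> face k i = face l j ->
     face_integral k i (fun x => p1 v k x - p1 v l x) = 0) /\
  (forall k i, face k i `<=` boundary Om -> face_integral k i (p1 v k) = 0).

End mesh_geometry.

(* For negative [s] and non-integer [delta] the power [s ^ delta] has no fixed
   meaning; this predicate covers the readings [|s|^delta] and
   [- |s|^delta] and imposes the algebraic power when [delta] is a natural
   number. *)
Definition real_power (R : realType) (delta : R) (pow : R -> R) : Prop :=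
  [/\ forall s, 0 <= s -> pow s = s `^ delta,
      exists2 e : R, e = 1 \/ e = -1 &
        forall s, s < 0 -> pow s = e * `|s| `^ delta
    & forall m : nat, delta = m%:R -> forall s, pow s = s ^+ m].

Definition positive_kernel (R : realType) (T : R) (K : R -> R) : Prop :=
  (@lebesgue_measure R).-integrable `]0, T[ (EFin \o K) /\
  forall S : R, 0 < S <= T ->
  forall v : R -> R, memLp (@lebesgue_measure R) 2 `]0, S[ v ->
  (0 <= \int[@lebesgue_measure R]_(t in `]0%R, S[)
          \int[@lebesgue_measure R]_(s in `]0%R, t[)
            (K (t - s) * v s * v t)%R%:E)%E.

Definition kernel_conv (R : realType) (K g : R -> R) (t : R) : R :=
  \int[@lebesgue_measure R]_(s in `]0, t[) (K (t - s) * g s).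

Section scheme.
Variables (R : realType) (n : nat) (Om : set 'rV[R]_n.+1) (M : mesh R n).
Variables (alpha delta beta gamma nu eta T : R) (pow : R -> R).
Local Notation fn := ('rV[R]_n.+1 -> R).
Local Notation leb := (rV_lebesgue R n.+1).

Definition ip (g h : fn) : R := \int[leb]_(x in Om) (g x * h x).

Definition ip_mesh (g h : fn) : R :=
  \sum_(k < nel M) \int[leb]_(x in elt k) (g x * h x).

Definition a_CR (u v : brokenP1 M) : R :=
  \sum_(i < n.+1) ip (pwgrad u i) (pwgrad v i).

Definition b_CR (u w : brokenP1 M) : R :=
  (delta + 2)^-1 *
    ip_mesh (fun x => pow (pw u x) * \sum_(i < n.+1) pwgrad u i x) (pw w) -
  (delta + 2)^-1 *
    ip_mesh (fun x => pow (pw u x) * \sum_(i < n.+1) pwgrad w i x) (pw u).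

Definition reaction (g : fn) : fn :=
  fun x => g x * (1 - pow (g x)) * (pow (g x) - gamma).

Definition A_CR (u chi : brokenP1 M) : R :=
  nu * a_CR u chi + alpha * b_CR u chi - beta * ip (reaction (pw u)) (pw chi).

(* integral form of: [u] is absolutely continuous on [0, T] with derivative [w]
   almost everywhere *)
Definition time_derivative (u w : R -> brokenP1 M) : Prop :=
  forall k j,
    (@lebesgue_measure R).-integrable `]0, T[ (fun s => (w s k j)%:E) /\
    forall t, 0 <= t <= T ->
      u t k j = u 0 k j + \int[@lebesgue_measure R]_(s in `]0, t[) w s k j.

Definition semidiscrete_solution (K : R -> R) (f : R -> fn)
    (u0h : brokenP1 M) (u : R -> brokenP1 M) : Prop :=
  [/\ forall t, 0 <= t <= T -> CR Om (u t),
      forall chi : brokenP1 M, CR Om chi ->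
        ip (pw (u 0)) (pw chi) = ip (pw u0h) (pw chi)
    & exists2 du : R -> brokenP1 M, time_derivative u du &
      {ae @lebesgue_measure R, forall t, 0 < t < T ->
        forall chi : brokenP1 M, CR Om chi ->
          ip (pw (du t)) (pw chi) + A_CR (u t) chi
          + eta * \sum_(i < n.+1)
              ip (fun x => kernel_conv K (fun s => pwgrad (u s) i x) t)
                 (pwgrad chi i)
          = ip (f t) (pw chi)}].

End scheme.

(* Main.v *)
From HB Require Import structures.
Require Import Defs.
From mathcomp Require Import all_boot all_order all_algebra.
From mathcomp Require Import all_classical all_reals all_analysis.
From mathcomp Require Import measurable_realfun.
From mathcomp Require Import lra ring.
Set Implicit Arguments.
Unset Strict Implicit.
Unset Printing Implicit Defensive.
Import Order.TTheory GRing.Theory Num.Theory.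
Import numFieldNormedType.Exports.
Local Open Scope classical_set_scope.
Local Open Scope ring_scope.

(** Tested against an [L^2]-orthonormal basis [e_j] of the Crouzeix-Raviart space,
the scheme becomes a system for the coordinates [c_j] of the discrete solution [u]:
[[
  c_j' = - A_CR (u, e_j) - memory_j (c) + (f, e_j),
]]
an ordinary differential equation in finitely many unknowns, perturbed by a
convolution with the past.  The equivalence is [scheme_atP].

Because [delta >= 1], the power is locally Lipschitz for every admissible reading
of it at negative arguments ([real_power_lipschitz]), hence so is the spatial form
as a function of [u] ([lip_A_CR]).  The memory is linear in [c] and its kernel is
integrable.  If the nonlinearity were globally Lipschitz, the right-hand side would
be a Lipschitz Volterra operator: two states that differ by at most [b e^(l r)] at
every time [r] are sent to functions that differ by at most [L b e^(l s)] at time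
[s], and integrating in time divides this by [l].  With [l = 2 L + 1] the solution
map halves weighted distances, so Picard iteration converges on all of [0, T]
([volterra_exists]), and a difference of two solutions vanishes ([volterra_zero]).

The true nonlinearity is only locally Lipschitz, so it is first cut off outside a
large ball.  The energy identity bounds the solution independently of the ball
([energy_bound]): the convection form is skew by construction, the diffusion has a
sign, the reaction satisfies [u c(u) <= (1 - gamma)^2 / 4 u^2]
([A_CR_coercive]), and the memory contributes a nonnegative combination of the
quadratic forms of the kernel, because broken gradients are constant on each element
([memory_form], [energy_split]).  A ball larger than this bound makes the cutoff
invisible, which gives existence ([memory_system_exists]).  For uniqueness, two
solutions are bounded on [0, T], so one local Lipschitz constant serves both and
[volterra_zero] applies to their difference. *)

(** * Integrals of real-valued functions *)

Section real_integrals.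
Context d (T : measurableType d) (R : realType) (mu : {measure set T -> \bar R}).
Implicit Types (D : set T) (f g : T -> R).

Definition rintegrable D f := mu.-integrable D (EFin \o f).

Lemma rintegrable_measurable D f : rintegrable D f -> measurable_fun D f.
Proof. by move=> /measurable_int/measurable_EFinP. Qed.

Lemma eq_rintegrable D f g : measurable D -> {in D, f =1 g} ->
  rintegrable D f -> rintegrable D g.
Proof. by move=> mD fg; apply: eq_integrable => // x xD /=; rewrite fg. Qed.

Lemma rintegrableD D f g : measurable D -> rintegrable D f -> rintegrable D g ->
  rintegrable D (fun x => f x + g x).
Proof. by move=> mD If Ig; have := integrableD mD If Ig. Qed.

Lemma rintegrableZ D r f : measurable D -> rintegrable D f ->
  rintegrable D (fun x => r * f x).
Proof. by move=> mD If; have := integrableZl mD r If. Qed.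

Lemma rintegrableB D f g : measurable D -> rintegrable D f -> rintegrable D g ->
  rintegrable D (fun x => f x - g x).
Proof. by move=> mD If Ig; have := integrableB mD If Ig. Qed.

Lemma rintegrable_sum D (I : Type) (s : seq I) (P : pred I) (F : I -> T -> R) :
  measurable D -> (forall i, P i -> rintegrable D (F i)) ->
  rintegrable D (fun x => \sum_(i <- s | P i) F i x).
Proof.
move=> mD IF.
have := integrable_sum mD s IF.
by apply: eq_integrable => // x _ /=; rewrite sumEFin.
Qed.

Lemma Rintegral_sum D (I : Type) (s : seq I) (P : pred I) (F : I -> T -> R) :
  measurable D -> (forall i, P i -> rintegrable D (F i)) ->
  \int[mu]_(x in D) (\sum_(i <- s | P i) F i x)
  = \sum_(i <- s | P i) \int[mu]_(x in D) F i x.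
Proof.
move=> mD IF; elim: s => [|i s ih].
  under eq_Rintegral do rewrite big_nil.
  by rewrite big_nil Rintegral_cst// mul0r.
under eq_Rintegral do rewrite big_cons.
rewrite big_cons; case: ifPn => // Pi.
rewrite RintegralD ?ih//; first exact: IF.
exact: rintegrable_sum.
Qed.

Lemma rintegrableW D f g : measurable D -> measurable_fun D f ->
  (forall x, D x -> `|f x| <= g x) -> rintegrable D g -> rintegrable D f.
Proof.
move=> mD mf fg Ig; apply: le_integrable Ig => //; first exact/measurable_EFinP.
by move=> x Dx; rewrite /= lee_fin (le_trans (fg _ Dx))// ler_norm.
Qed.

Lemma rintegrable_abs D f : measurable D -> rintegrable D f ->
  rintegrable D (fun x => `|f x|).
Proof. by move=> mD; exact: integrable_norm. Qed.

Lemma rintegrableM_bounded D f g B : measurable D -> measurable_fun D g ->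
  (forall x, D x -> `|g x| <= B) -> rintegrable D f ->
  rintegrable D (fun x => f x * g x).
Proof.
move=> mD mg gB If; apply: (@rintegrableW _ _ (fun x => B * `|f x|)) => //.
- exact: measurable_funM (rintegrable_measurable If) mg.
- by move=> x Dx; rewrite normrM mulrC ler_wpM2r// gB.
- exact/rintegrableZ/rintegrable_abs.
Qed.

Lemma rintegrable_bounded D f B : measurable D -> (mu D < +oo)%E ->
  measurable_fun D f -> (forall x, D x -> `|f x| <= B) -> rintegrable D f.
Proof.
move=> mD muD mf fB; apply: measurable_bounded_integrable => //.
exists B; split; first exact: num_real.
by move=> M BM x Dx; apply: (le_trans (fB _ Dx)); exact: ltW.
Qed.

Lemma norm_Rintegral_le D f g : measurable D -> measurable_fun D f ->
  rintegrable D g ->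
  (forall x, D x -> `|f x| <= g x) ->
  `|\int[mu]_(x in D) f x| <= \int[mu]_(x in D) g x.
Proof.
move=> mD mf Ig fg; have If : rintegrable D f by exact: rintegrableW Ig.
apply: (le_trans (le_normr_Rintegral mD If)).
by apply: le_Rintegral => //; exact: rintegrable_abs.
Qed.

(** Replacing [g] by the maximum of [g] and [|f|] changes it on a null set only and
makes the bound hold everywhere. *)
Lemma norm_Rintegral_le_ae D f g : measurable D -> rintegrable D f ->
  rintegrable D g ->
  {ae mu, forall x, D x -> `|f x| <= g x} ->
  `|\int[mu]_(x in D) f x| <= \int[mu]_(x in D) g x.
Proof.
move=> mD If Ig fg.
apply: (le_trans (le_normr_Rintegral mD If)).
have mf := rintegrable_measurable If.
have mg := rintegrable_measurable Ig.
pose g' x := Num.max (g x) `|f x|.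
have mg' : measurable_fun D g'.
  by apply: measurable_maxr => //; exact: measurableT_comp.
have eg : \int[mu]_(x in D) g' x = \int[mu]_(x in D) g x.
  congr fine; apply: ae_eq_integral => //; [exact/measurable_EFinP..|].
  by apply: filterS fg => x /[swap] Dx /(_ Dx) h /=; rewrite /g' max_l.
have Ig' : rintegrable D g'.
  apply: (@rintegrableW _ _ (fun x => `|g x| + `|f x|)) => //.
    move=> x Dx; rewrite /g'; have [h|h] := leP (g x) `|f x|.
      by rewrite normr_id lerDr.
    by rewrite lerDl.
  by apply: rintegrableD => //; exact: rintegrable_abs.
rewrite -eg; apply: le_Rintegral => //; first exact: rintegrable_abs.
by move=> x Dx; rewrite /g' le_max lexx orbT.
Qed.

Lemma rintegrable_cst D r : measurable D -> (mu D < +oo)%E ->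
  rintegrable D (fun=> r).
Proof.
by move=> mD muD; apply: (@rintegrable_bounded _ _ `|r|).
Qed.

Lemma rintegrable_patch D f : measurable D ->
  rintegrable D f <-> rintegrable setT (f \_ D).
Proof. by move=> mD; rewrite /rintegrable integrable_mkcond// restrict_EFin. Qed.

Lemma ge0_subset_Rintegral D E f : measurable D -> measurable E -> D `<=` E ->
  rintegrable E f -> (forall x, E x -> 0 <= f x) ->
  \int[mu]_(x in D) f x <= \int[mu]_(x in E) f x.
Proof.
move=> mD mE DE IfE f0; have IfD : rintegrable D f by exact: integrableS IfE.
rewrite Rintegral_mkcond [leRHS]Rintegral_mkcond; apply: le_Rintegral => //.
- exact: (rintegrable_patch _ mD).1.
- exact: (rintegrable_patch _ mE).1.
- move=> x _; rewrite !patchE; case: ifPn => [/set_mem/DE/mem_set ->//|_].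
  by case: ifPn => // /set_mem/f0.
Qed.

End real_integrals.

(** * Measurability, reflection and convolution on the line *)

Section measurability.
Variable R : realType.
Local Notation mu := (@lebesgue_measure R).

Lemma measurable_lt_set d (T : measurableType d) (f g : T -> R) :
  measurable_fun setT f -> measurable_fun setT g -> measurable [set x | f x < g x].
Proof.
move=> mf mg; have := measurable_fun_ltr mf mg.
move=> /(_ measurableT [set true] I); rewrite setTI.
by congr measurable; apply/seteqP; split => x /=.
Qed.

Lemma measurable_le_set d (T : measurableType d) (f g : T -> R) :
  measurable_fun setT f -> measurable_fun setT g -> measurable [set x | f x <= g x].
Proof.
move=> mf mg; have := measurable_fun_ler mf mg.
by move=> /(_ measurableT [set true] I); rewrite setTI.
Qed.

(** Tonelli gives measurability for nonnegative integrands, so the positive and the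
negative part are treated separately. *)
Lemma measurable_Rintegral2 (h : measurableTypeR R * measurableTypeR R -> R) :
  measurable_fun setT h -> measurable_fun setT (fun t : measurableTypeR R => \int[mu]_s (h (t, s))).
Proof.
move=> mh0.
have mh : measurable_fun setT (EFin \o h) by exact/measurable_EFinP.
have mFp : measurable_fun setT (fun x => \int[mu]_y ((EFin \o h)^\+%E (x, y)))%E.
  by apply: (measurable_fun_fubini_tonelli_F ((EFin \o h)^\+)%E) => //; exact: measurable_funepos.
have mFm : measurable_fun setT (fun x => \int[mu]_y ((EFin \o h)^\-%E (x, y)))%E.
  by apply: (measurable_fun_fubini_tonelli_F ((EFin \o h)^\-)%E) => //; exact: measurable_funeneg.
have -> : (fun t : measurableTypeR R => \int[mu]_s h (t, s)) =
    fine \o (fun t => \int[mu]_y ((EFin \o h)^\+%E (t, y)) - \int[mu]_y ((EFin \o h)^\-%E (t, y)))%E.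
  apply/funext => t; rewrite /Rintegral /=; congr fine.
  rewrite [LHS]integralE; congr (_ - _)%E; apply: eq_integral => y _;
    by rewrite ?funeposE ?funenegE.
apply: measurableT_comp; last exact: emeasurable_funB.
exact: fine_measurable.
Qed.

Lemma lebesgue_itvoo_lty (a b : R) : (mu (`]a, b[%classic : set R) < +oo)%E.
Proof. by rewrite lebesgue_measure_itv/=; case: ifP; rewrite ?ltry. Qed.

Lemma lebesgue_ae_filter : Filter (almost_everywhere mu).
Proof. exact: (ae_filter_ringOfSetsType (mu : {measure set (measurableTypeR R) -> \bar R})). Qed.

End measurability.

Section reflection.
Variable R : realType.
Local Notation mu := (@lebesgue_measure R).

Lemma measurable_reflection (t : R) :
  measurable_fun [set: measurableTypeR R] (fun x : R => t - x : measurableTypeR R).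
Proof. exact: measurable_funB. Qed.

(** The image of the Lebesgue measure under a reflection agrees with it on half-open
intervals, which determine it. *)
Lemma lebesgue_reflection (t : R) (A : set (measurableTypeR R)) :
  measurable A -> mu ((fun x : R => t - x) @^-1` A) = mu A.
Proof.
move=> mA.
pose phi : measurableTypeR R -> measurableTypeR R := fun x => t - x.
have mphi : measurable_fun setT phi := measurable_reflection t.
pose phi' : {mfun measurableTypeR R >-> measurableTypeR R} :=
  HB.pack phi (isMeasurableFun.Build _ _ _ _ _ mphi).
apply/esym.
apply: (@lebesgue_measure_unique R (pushforward mu phi' : {measure set _ -> \bar R})) => //.
move=> X [[a b] _ <-] /=.
rewrite /pushforward.
have -> : phi @^-1` `]a, b] = `[t - b, t - a[%classic.
  by apply/seteqP; split => x; rewrite /phi /= !in_itv/=; lra.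
rewrite !lebesgue_measure_itv/= !lte_fin.
have -> : (t - b < t - a) = (a < b) by apply/idP/idP; lra.
by case: ifP => // _; rewrite -!EFinB; congr EFin; ring.
Qed.

Lemma ge0_integral_reflection (t : R) (f : R -> \bar R) :
  measurable_fun [set: measurableTypeR R] f -> (forall x, 0 <= f x)%E ->
  (\int[mu]_x f (t - x)%R = \int[mu]_x f x)%E.
Proof.
move=> mf f0.
pose phi : measurableTypeR R -> measurableTypeR R := fun x => t - x.
have mphi : measurable_fun setT phi := measurable_reflection t.
pose phi' : {mfun measurableTypeR R >-> measurableTypeR R} :=
  HB.pack phi (isMeasurableFun.Build _ _ _ _ _ mphi).
have H := @ge0_integral_pushforward _ _ (measurableTypeR R) (measurableTypeR R) R
  phi mphi mu setT f measurableT mf (fun x _ => f0 x).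
rewrite preimage_setT in H.
have E := @eq_measure_integral _ (measurableTypeR R) R setT
  (pushforward mu phi' : {measure set _ -> \bar R}) mu f
  (fun A mA _ => esym (lebesgue_reflection t mA)).
by rewrite E; exact: (esym H).
Qed.

Lemma rintegrable_reflection (t : R) (f : R -> R) :
  rintegrable mu setT f -> rintegrable mu setT (fun x => f (t - x)).
Proof.
move=> If; have mf := rintegrable_measurable If.
apply/integrableP; split.
  by apply/measurable_EFinP; apply: (measurableT_comp mf); exact: measurable_reflection.
have := @ge0_integral_reflection t (fun x => `|f x|%:E).
move=> /= ->//.
  by case/integrableP : If.
by apply/measurable_EFinP; exact: measurableT_comp.
Qed.

Lemma Rintegral_abs_reflection (t : R) (f : R -> R) :
  measurable_fun [set: measurableTypeR R] f ->
  \int[mu]_x `|f (t - x)| = \int[mu]_x `|f x|.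
Proof.
move=> mf; rewrite /Rintegral (@ge0_integral_reflection t (fun x => `|f x|%:E))//.
by apply/measurable_EFinP; exact: measurableT_comp.
Qed.

End reflection.

Section convolution.
Variable R : realType.
Local Notation mu := (@lebesgue_measure R).
Implicit Types K v : R -> R.

(** Convolution over the whole line; causality will come from kernels and densities
that vanish outside a time interval. *)
Definition conv K v (t : R) : R := \int[mu]_s (K (t - s) * v s).

Lemma rintegrable_conv K v (B t : R) : rintegrable mu setT K ->
  measurable_fun setT v -> (forall s, `|v s| <= B) ->
  rintegrable mu setT (fun s => K (t - s) * v s).
Proof.
move=> IK mv vB; apply: (@rintegrableM_bounded _ _ _ _ _ _ _ B) => //.
exact: rintegrable_reflection.
Qed.

(** The bound on [v] is asked only where the kernel sees it.  For a causal kernel these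
are past times, which is what lets exponential weights pass through the convolution. *)
Lemma norm_conv_le K v (B t b : R) : rintegrable mu setT K ->
  measurable_fun setT v -> (forall s, `|v s| <= B) ->
  (forall s, K (t - s) != 0 -> `|v s| <= b) ->
  `|conv K v t| <= b * \int[mu]_s `|K s|.
Proof.
move=> IK mv vB Kb.
rewrite -(Rintegral_abs_reflection t (rintegrable_measurable IK)).
have IKt : rintegrable mu setT (fun s => `|K (t - s)|).
  by apply: rintegrable_abs => //; exact: rintegrable_reflection.
rewrite -RintegralZl//; apply: norm_Rintegral_le => //.
- exact: rintegrable_measurable (rintegrable_conv _ IK mv vB).
- exact: rintegrableZ.
- move=> s _; rewrite normrM mulrC; have [->|/Kb vb] := eqVneq (K (t - s)) 0.
    by rewrite normr0 !mulr0.
  by rewrite ler_wpM2r.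
Qed.

Lemma measurable_conv K v : rintegrable mu setT K -> measurable_fun setT v ->
  measurable_fun setT (conv K v).
Proof.
move=> IK mv; have mK := rintegrable_measurable IK.
apply: (@measurable_Rintegral2 R (fun z => K (z.1 - z.2) * v z.2)).
apply: measurable_funM; last exact: (measurableT_comp mv).
by apply: (measurableT_comp mK); exact: measurable_funB.
Qed.

End convolution.

(** * Primitives *)

Section primitive.
Variable R : realType.
Local Notation mu := (@lebesgue_measure R).

(** A real-valued integral is 0 when the extended one is infinite, so all sections must
be integrable for the iterated integrals to mean what they say. *)
Lemma Rintegral_Fubini (h : measurableTypeR R * measurableTypeR R -> R) :
  (mu \x mu)%E.-integrable setT (EFin \o h) ->
  (forall s, rintegrable mu setT (fun r => h (s, r))) ->
  (forall r, rintegrable mu setT (fun s => h (s, r))) ->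
  \int[mu]_s (\int[mu]_r h (s, r)) = \int[mu]_r (\int[mu]_s h (s, r)).
Proof.
move=> Ih I1 I2; rewrite [LHS]/Rintegral [RHS]/Rintegral; congr fine.
under eq_integral => s _.
  rewrite fineK; last exact: (integrable_fin_num _ (I1 s)).
  over.
under [RHS]eq_integral => s _.
  rewrite fineK; last exact: (integrable_fin_num _ (I2 s)).
  over.
exact: (Fubini Ih).
Qed.

Lemma integrable_tensor (v w : R -> R) : rintegrable mu setT v -> rintegrable mu setT w ->
  (mu \x mu)%E.-integrable setT
    (EFin \o (fun z : measurableTypeR R * measurableTypeR R => v z.1 * w z.2)).
Proof.
move=> Iv Iw.
have mv := rintegrable_measurable Iv; have mw := rintegrable_measurable Iw.
apply/integrable12ltyP.
  apply/measurable_EFinP; apply: measurable_funM.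
    exact: (measurableT_comp mv).
  exact: (measurableT_comp mw).
have Ie (u : R -> R) : rintegrable mu setT u ->
    (\int[mu]_y `|u y|%:E)%E = (\int[mu]_y `|u y|)%:E.
  move=> Iu; rewrite fineK//; apply: integrable_fin_num => //.
  exact: rintegrable_abs.
have E x : (\int[mu]_y `|(v x * w y)%:E|)%E = (`|v x|%:E * (\int[mu]_y `|w y|)%:E)%E.
  under eq_integral do rewrite abse_EFin normrM EFinM.
  by rewrite integralZl ?Ie//; exact: rintegrable_abs.
under eq_integral do rewrite E.
rewrite integralZr//; last exact: rintegrable_abs.
rewrite -ge0_fin_numE; last first.
  by apply: mule_ge0; [exact: integral_ge0|rewrite lee_fin; exact: Rintegral_ge0].
by apply: fin_numM => //; apply: integrable_fin_num => //; exact: rintegrable_abs.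
Qed.

Definition primitive (w : R -> R) (t : R) : R := \int[mu]_(s in `]0, t[) w s.

(** Seen as the integral of a function of two variables over a triangle, a primitive is
measurable by [measurable_Rintegral2]. *)
Lemma primitiveE (w : R -> R) t :
  primitive w t = \int[mu]_s (\1_[set z : measurableTypeR R * measurableTypeR R |
     0 < z.2 < z.1] (t, s) * w s).
Proof.
rewrite /primitive Rintegral_mkcond; apply: eq_Rintegral => s _.
rewrite patchE indicE; case: ifPn => [|] h.
  by rewrite mem_set ?mul1r//= ; move: h; rewrite inE/= in_itv.
rewrite memNset ?mul0r//=; apply/negP; move: h; apply: contraNN.
by rewrite inE/= in_itv.
Qed.

Let tri : set (measurableTypeR R * measurableTypeR R) := [set z | 0 < z.2 < z.1].
Let mtri : measurable tri.
Proof.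
rewrite (_ : tri = [set z | 0 < z.2] `&` [set z | z.2 < z.1]); last first.
  by apply/seteqP; split => x /= => [/andP[]|[? ?]] //; apply/andP.
by apply: measurableI; apply: measurable_lt_set.
Qed.

Lemma measurable_primitive (w : R -> R) : measurable_fun setT w ->
  measurable_fun setT (primitive w).
Proof.
move=> mw; rewrite (_ : primitive w = (fun t => \int[mu]_s (\1_tri (t, s) * w s))); last first.
  by apply/funext => t; exact: primitiveE.
apply: (@measurable_Rintegral2 R (fun z => \1_tri z * w z.2)).
by apply: measurable_funM => //; exact: (measurableT_comp mw).
Qed.

Lemma rintegrable_itv (w : R -> R) (i : interval R) : rintegrable mu setT w ->
  rintegrable mu [set` i] w.
Proof. by move=> Iw; apply: integrableS Iw. Qed.

Lemma norm_primitive_le (w : R -> R) t : rintegrable mu setT w ->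
  `|primitive w t| <= \int[mu]_s `|w s|.
Proof.
move=> Iw; apply: (le_trans (le_normr_Rintegral _ _)) => //.
  exact: rintegrable_itv.
rewrite Rintegral_mkcond; apply: le_Rintegral => //.
- apply: (rintegrable_patch _ _ _).1 => //; apply: rintegrable_abs => //; exact: rintegrable_itv.
- exact: rintegrable_abs.
- by move=> x _; rewrite patchE; case: ifP => // _; exact: normr_ge0.
Qed.

(** Chain rule for the square of an absolutely continuous function whose derivative [w]
is merely integrable.  The square of the primitive is the integral of [w s * w r] over
the square of ]0, t[; on each of the triangles [r < s] and [s <= r], Fubini turns it into the
integral of [w] times its primitive. *)
Lemma sqr_primitive (w : R -> R) a t : rintegrable mu setT w ->
  (a + primitive w t) ^+ 2
  = a ^+ 2 + 2 * \int[mu]_(s in `]0, t[) (w s * (a + primitive w s)).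
Proof.
move=> Iw; have mw := rintegrable_measurable Iw.
pose v := w \_ `]0, t[.
have Iv : rintegrable mu setT v by apply: (rintegrable_patch _ _ _).1 => //; exact: rintegrable_itv.
have mv := rintegrable_measurable Iv.
have vP : \int[mu]_s v s = primitive w t by rewrite /primitive [RHS]Rintegral_mkcond.
pose P := primitive v.
have PE s : s <= t -> P s = primitive w s.
  move=> st; apply: eq_Rintegral => r; rewrite inE/= in_itv/= => /andP[r0 rs].
  by rewrite /v patchE mem_set//= in_itv/= r0 (lt_le_trans rs).
have mP : measurable_fun setT P by exact: measurable_primitive.
have PB s : `|P s| <= \int[mu]_s `|v s| by exact: norm_primitive_le.
have v0 r : r <= 0 -> v r = 0.
  move=> r0; rewrite /v patchE memNset//= in_itv/=; lra.
(* The diagonal belongs to the complement of [A]; it gives the closed upper bound in [E2]. *)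
pose A : set (measurableTypeR R * measurableTypeR R) := [set z | z.2 < z.1].
have mA : measurable A by exact: measurable_lt_set.
pose H (z : measurableTypeR R * measurableTypeR R) := v z.1 * v z.2.
have IH : (mu \x mu)%E.-integrable setT (EFin \o H) by exact: integrable_tensor.
pose H1 z := H z * \1_A z.
pose H2 z := H z * \1_(~` A) z.
have IH2 : (mu \x mu)%E.-integrable setT (EFin \o H2).
  apply: (@rintegrableM_bounded _ _ _ _ _ _ _ 1) => //.
    by apply: measurable_indic; exact: measurableC.
  by move=> z _; rewrite indicE; case: (_ \in _); rewrite ?normr1 ?normr0.
have Isec (f : R -> R) c : measurable_fun setT f -> (forall x, `|f x| <= 1) ->
    rintegrable mu setT (fun r => c * v r * f r).
  move=> mf f1; apply: (@rintegrableM_bounded _ _ _ _ _ _ _ 1) => //.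
  exact: rintegrableZ.
have ind1 (B : set (measurableTypeR R * measurableTypeR R)) z : `|\1_B z : R| <= 1.
  by rewrite indicE; case: (_ \in _); rewrite ?normr1 ?normr0.
have mA2 s (B : set (measurableTypeR R * measurableTypeR R)) : measurable B ->
    measurable_fun setT (fun r : measurableTypeR R => \1_B (s, r) : R).
  move=> mB; apply: measurableT_comp; first exact: measurable_indic.
  exact: measurable_pair1.
have mA1 r (B : set (measurableTypeR R * measurableTypeR R)) : measurable B ->
    measurable_fun setT (fun s : measurableTypeR R => \1_B (s, r) : R).
  move=> mB; apply: measurableT_comp; first exact: measurable_indic.
  exact: measurable_pair2.
have mAC := measurableC mA.
have IHs s (B : set (measurableTypeR R * measurableTypeR R)) : measurable B ->
    rintegrable mu setT (fun r => H (s, r) * \1_B (s, r)).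
  by move=> mB; exact: (Isec (fun r => \1_B (s, r)) (v s) (mA2 s _ mB) (fun r => ind1 _ _)).
have E1 s : \int[mu]_r H1 (s, r) = v s * P s.
  rewrite /P primitiveE -RintegralZl//; last first.
    have := Isec (fun r => \1_tri (s, r)) 1 (mA2 s _ mtri) (fun r => ind1 _ _).
    by apply: eq_rintegrable => // r _; rewrite mul1r mulrC.
  apply: eq_Rintegral => r _; rewrite /H1 /H /= -mulrA; congr (_ * _).
  have [r0|r0] := leP r 0; first by rewrite v0// mul0r mulr0.
  rewrite mulrC; congr (_ * _); rewrite !indicE; congr (_%:R).
  by congr nat_of_bool; apply/idP/idP; rewrite !inE /A/=; [move->; rewrite r0|case/andP].
have E2 r : \int[mu]_s H2 (s, r) = v r * P r.
  transitivity (v r * \int[mu]_(s in `]0, r]) v s).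
    rewrite [in RHS]Rintegral_mkcond -RintegralZl//; last first.
      by apply: (rintegrable_patch _ _ _).1 => //; exact: rintegrable_itv.
    apply: eq_Rintegral => s _; rewrite /H2 /H /= (mulrC (v s)) -mulrA; congr (_ * _).
    rewrite patchE; have [s0|s0] := leP s 0; first by rewrite v0// mul0r if_same.
    rewrite indicE; have [sr|sr] := leP s r.
      rewrite mem_set; last by rewrite /A/=; apply/negP; rewrite -leNgt.
      by rewrite mem_set ?mulr1//= in_itv/= s0.
    rewrite memNset; last by rewrite /A/=; apply; exact: sr.
    by rewrite memNset ?mulr0//= in_itv/= s0; apply/negP; rewrite -ltNge.
  congr (_ * _); rewrite -Rintegral_itv_bndo_bndc//; exact: rintegrable_itv.
have IvP : rintegrable mu setT (fun s => v s * P s).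
  exact: (@rintegrableM_bounded _ _ _ _ _ _ _ (\int[mu]_s `|v s|)).
have sq : primitive w t ^+ 2 = 2 * \int[mu]_s (v s * P s).
  transitivity (\int[mu]_s (\int[mu]_r (H1 (s, r) + H2 (s, r)))).
    rewrite -vP expr2 -RintegralZr//; apply: eq_Rintegral => s _.
    rewrite -RintegralZl//; apply: eq_Rintegral => r _.
    rewrite /H1 /H2 -mulrDr /H /= !indicE in_setC.
    by case: (_ \in _); rewrite /= ?addr0 ?add0r mulr1.
  transitivity (\int[mu]_s (\int[mu]_r H1 (s, r) + \int[mu]_r H2 (s, r))).
    apply: eq_Rintegral => s _; rewrite RintegralD//; exact: IHs.
  have I2s : rintegrable mu setT (fun s => \int[mu]_r H2 (s, r)).
    have := integrable_fubini_F IH2; apply: eq_integrable => // s _.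
    rewrite /fubini_F /= fineK//; apply: integrable_fin_num => //.
    exact: IHs.
  rewrite RintegralD//; last by apply: eq_rintegrable IvP => // s _; rewrite E1.
  rewrite mulr2n mulrDl mul1r; congr (_ + _).
    by apply: eq_Rintegral => s _; exact: E1.
  rewrite Rintegral_Fubini//.
  - by apply: eq_Rintegral => s _; exact: E2.
  - by move=> s; exact: IHs.
  - move=> r; have := Isec (fun s => \1_(~` A) (s, r)) (v r) (mA1 r _ mAC) (fun r => ind1 _ _).
    by apply: eq_rintegrable => // s _; rewrite /H2/H/= (mulrC (v r)).
have Itw : rintegrable mu `]0, t[ w by exact: rintegrable_itv.
have ItwP : rintegrable mu `]0, t[ (fun s => w s * primitive w s).
  have : rintegrable mu `]0, t[ (fun s => v s * P s) by exact: rintegrable_itv.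
  apply: eq_rintegrable => // s si; rewrite /v patchE si PE//.
  by move: si; rewrite inE/= in_itv/= => /andP[_ /ltW].
rewrite sqrrD sq -addrA; congr (_ + _).
under [in RHS]eq_Rintegral do rewrite mulrDr.
have mI : measurable (`]0, t[%classic : set (measurableTypeR R)) by exact: measurable_itv.
have Iwa : rintegrable mu `]0, t[ (fun s => w s * a).
  by apply: eq_rintegrable (rintegrableZ a mI Itw) => // s _; rewrite mulrC.
rewrite (RintegralD mI Iwa ItwP) (RintegralZr a mI Itw) mulrDr -/(primitive w t).
congr (_ + _); first by ring.
congr (_ * _); rewrite Rintegral_mkcond [RHS]Rintegral_mkcond patch_setT.
apply: eq_Rintegral => s _.
rewrite patchE; case: ifPn => si; last by rewrite /v patchE (negbTE si) mul0r.
rewrite /v patchE si PE//.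
by move: si; rewrite inE/= in_itv/= => /andP[_ /ltW].
Qed.

Lemma continuous_expRM (l : R) : continuous (fun x : R => expR (l * x)).
Proof.
by move=> x; apply: continuous_comp; [exact: mulrl_continuous|exact: continuous_expR].
Qed.

Lemma rintegrable_expRM (l t : R) :
  rintegrable mu `]0, t[ (fun s => expR (l * s)).
Proof.
have mu_fin := lebesgue_itvoo_lty 0 t.
apply: (@rintegrable_bounded _ _ _ _ _ _ (expR (`|l| * t))) => //.
  apply: measurable_funTS; apply: continuous_measurable_fun; exact: continuous_expRM.
move=> x; rewrite /= in_itv/= => /andP[x0 xt]; rewrite ger0_norm ?expR_ge0// ler_expR.
rewrite (le_trans (ler_norm _))// normrM (gtr0_norm x0) ler_wpM2l// ltW//.
Qed.

Lemma Rintegral_expRM_le (l t : R) : 0 < l -> 0 <= t ->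
  \int[mu]_(s in `]0, t[) expR (l * s) <= expR (l * t) / l.
Proof.
move=> l0; rewrite le_eqVlt => /predU1P[<-|t0].
  by rewrite set_itv_ge ?bnd_simp// Rintegral_set0 divr_ge0// ?expR_ge0// ltW.
pose F := l^-1 \*: (expR \o (l \*: @id R^o)) : R -> R.
have dF (x : R) : is_derive x 1 F (expR (l * x)).
  have : is_derive x 1 F (l^-1 *: (expR (l *: x) * (l *: (1 : R)))).
    by apply: is_deriveZ; apply: is_derive1_comp.
  move=> /is_derive_eq; apply; rewrite /GRing.scale/=; field; exact: lt0r_neq0.
have dcF (x : R) : derivable F x 1 by [].
have cF : continuous F by move=> x; apply/differentiable_continuous/derivable1_diffP.
have ce := @continuous_expRM l.
have E : (\int[mu]_(x in `[0%R, t]) (expR (l * x))%:E = (F t)%:E - (F 0)%:E)%E.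
  apply: (@continuous_FTC2 R (fun x => expR (l * x)) F 0 t t0).
  - exact: continuous_subspaceT.
  - split; first by move=> x _; exact: dcF.
      by apply: cvg_at_right_filter; exact: cF.
    by apply: cvg_at_left_filter; exact: cF.
  - by move=> x _; rewrite derive1E; exact: derive_val.
have Ic : rintegrable mu `[0, t] (fun s => expR (l * s)).
  apply: continuous_compact_integrable; first exact: segment_compact.
  exact: continuous_subspaceT.
rewrite (@Rintegral_itv_bndo_bndc _ (BRight 0) t); last exact: rintegrable_expRM.
rewrite Rintegral_itv_obnd_cbnd; last by apply: integrableS Ic => //; exact: subset_itv_oc_cc.
rewrite /Rintegral E /F/= /GRing.scale/= mulr0 expR0 mulr1.
rewrite lerBlDr mulrC lerDl invr_ge0 ltW//.
Qed.

(** Integration against an exponential weight gains the factor [l^-1]; every contraction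
below comes from here. *)
Lemma norm_primitive_expR_le (w : R -> R) (l C t : R) : 0 < l -> 0 <= t ->
  rintegrable mu `]0, t[ w ->
  {ae mu, forall s, 0 < s < t -> `|w s| <= C * expR (l * s)} -> 0 <= C ->
  `|primitive w t| <= C * expR (l * t) / l.
Proof.
move=> l0 t0 Iw wC C0.
apply: (@le_trans _ _ (\int[mu]_(s in `]0, t[) (C * expR (l * s)))).
  apply: norm_Rintegral_le_ae => //; first by apply: rintegrableZ => //; exact: rintegrable_expRM.
rewrite RintegralZl//; last exact: rintegrable_expRM.
by rewrite -mulrA ler_wpM2l// Rintegral_expRM_le.
Qed.

End primitive.

(** * Lipschitz Volterra equations *)

Section geometric_sequences.
Variable R : realType.

(** The limit of an estimate whose error is halved each time it is fed back into itself. *)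
Lemma le_of_halving (x A B : R) : (forall k, x <= A + B / 2 ^+ k) -> x <= A.
Proof.
move=> h; rewrite leNgt; apply/negP => Ax.
have xA : 0 < x - A by rewrite subr_gt0.
have B0 : 0 <= `|B| / (x - A) by rewrite divr_ge0// ltW.
pose k := Num.truncn (`|B| / (x - A)).
have kB : `|B| / (x - A) < 2 ^+ k.
  have := truncnS_gt (`|B| / (x - A)); rewrite -/k => /lt_le_trans; apply.
  by rewrite -natrX ler_nat ltn_expl.
have := h k; rewrite leNgt => /negP; apply.
rewrite -ltrBrDl (le_lt_trans (y := `|B| / 2 ^+ k))//.
  by rewrite ler_wpM2r// ?ler_norm// invr_ge0 exprn_ge0.
by rewrite ltr_pdivrMr ?exprn_gt0// mulrC -ltr_pdivrMr.
Qed.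

(** The sequence [x k - 2 b / 2^k] increases, [x k + 2 b / 2^k] decreases, and the first
stays below the second; the supremum of the first is the limit, with an explicit rate. *)
Lemma geometric_limit (x : nat -> R) (b : R) :
  (forall k, `|x k.+1 - x k| <= b / 2 ^+ k) ->
  exists y, forall k, `|y - x k| <= 2 * b / 2 ^+ k.
Proof.
move=> xb.
have h2 k : 2 * b / 2 ^+ k.+1 = b / 2 ^+ k.
  by rewrite exprS invfM mulrACA mulfV// mul1r.
have b0 : 0 <= b by have := le_trans (normr_ge0 _) (xb 0%N); rewrite expr0 divr1.
have bk k : 0 <= 2 * b / 2 ^+ k by rewrite divr_ge0 ?mulr_ge0.
pose a k := x k - 2 * b / 2 ^+ k; pose d k := x k + 2 * b / 2 ^+ k.
have aS k : a k <= a k.+1.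
  have := xb k; rewrite /a h2 ler_norml => /andP[h _].
  have : 2 * b / 2 ^+ k = b / 2 ^+ k + b / 2 ^+ k by ring.
  lra.
have dS k : d k.+1 <= d k.
  have := xb k; rewrite /d h2 ler_norml => /andP[_ h].
  have : 2 * b / 2 ^+ k = b / 2 ^+ k + b / 2 ^+ k by ring.
  lra.
have ad k l : a k <= d l.
  have am i j : (i <= j)%N -> a i <= a j.
    move=> /subnKC <-; elim: (j - i)%N => [|n ih]; first by rewrite addn0.
    by rewrite addnS (le_trans ih).
  have dm i j : (i <= j)%N -> d j <= d i.
    move=> /subnKC <-; elim: (j - i)%N => [|n ih]; first by rewrite addn0.
    by rewrite addnS (le_trans _ ih).
  rewrite (le_trans (am _ _ (leq_maxl k l)))// (le_trans _ (dm _ _ (leq_maxr k l)))//.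
  by rewrite /a /d; have := bk (maxn k l); lra.
exists (sup (range a)) => k.
have ub : has_ubound (range a) by exists (d 0%N) => _ [l _ <-].
have h1 : a k <= sup (range a) by apply: ub_le_sup => //; exists k.
have h3 : sup (range a) <= d k by apply: ge_sup; [exists (a 0%N), 0%N|move=> _ [l _ <-]].
by rewrite ler_norml; move: h1 h3; rewrite /a /d; lra.
Qed.

End geometric_sequences.

Section row_norm.
Variables (R : realType) (m : nat).
Implicit Types x : 'rV[R]_m.

Lemma row_coord_le x j : `|x 0 j| <= `|x|.
Proof.
rewrite [leRHS]mx_normrE.
exact: (le_bigmax _ (fun ij : 'I_1 * 'I_m => `|x ij.1 ij.2|) (0, j)).
Qed.

Lemma row_norm_le x b : 0 <= b -> (forall j, `|x 0 j| <= b) -> `|x| <= b.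
Proof.
move=> b0 xb; rewrite [leLHS]mx_normrE; apply/bigmax_leP; split => // -[i j] _ /=.
by rewrite ord1.
Qed.

End row_norm.

Section volterra.
Variables (R : realType) (m : nat) (T : R).
Local Notation mu := (@lebesgue_measure R).
Local Notation state := (R -> 'rV[R]_m).

Definition bounded_measurable (c : state) :=
  (forall j, measurable_fun setT (fun t => c t 0 j)) /\
  exists B : R, forall t : R, `|c t| <= B.

(** One constant serves all exponential weights, so that a fast enough weight makes the
integrated operator a contraction whatever the constant. *)
Definition volterra_lipschitz (L : R) (Psi : state -> state) :=
  forall c c', bounded_measurable c -> bounded_measurable c' ->
  forall l b : R, 0 < l -> 0 <= b ->
  (forall r : R, 0 < r < T -> `|c r - c' r| <= b * expR (l * r)) ->
  forall s : R, 0 < s < T -> `|Psi c s - Psi c' s| <= L * b * expR (l * s).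

(** With [l = 2 L + 1], a weighted bound on [d] returns halved after one integration, so
it can be taken arbitrarily small. *)
Lemma volterra_zero (L : R) (d D : state) : 0 <= L ->
  (exists B : R, forall t : R, 0 <= t <= T -> `|d t| <= B) ->
  (forall j, rintegrable mu `]0, T[ (fun s => D s 0 j)) ->
  (forall j (t : R), 0 <= t <= T -> d t 0 j = primitive (fun s => D s 0 j) t) ->
  (forall l b : R, 0 < l -> 0 <= b ->
    (forall r : R, 0 < r < T -> `|d r| <= b * expR (l * r)) ->
    {ae mu, forall s : R, 0 < s < T -> `|D s| <= L * b * expR (l * s)}) ->
  forall t : R, 0 <= t <= T -> d t = 0.
Proof.
move=> L0 [B dB] ID dD Dd t tT.
pose l : R := 2 * L + 1.
have l0 : 0 < l by rewrite /l; lra.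
have B0 : 0 <= B by apply: le_trans (normr_ge0 _) (dB _ tT).
have key k : forall t : R, 0 <= t <= T -> `|d t| <= B / 2 ^+ k * expR (l * t).
  elim: k => [|k ih] s /andP[s0 sT].
    rewrite expr0 divr1 (le_trans (dB _ _)) ?s0// ler_peMr//.
    by rewrite -expR0 ler_expR mulr_ge0// ltW.
  have b0 : 0 <= B / 2 ^+ k by rewrite divr_ge0// exprn_ge0.
  have ih' (r : R) : 0 < r < T -> 0 <= r <= T by case/andP => /ltW -> /ltW ->.
  have aeD := Dd l _ l0 b0 (fun r rT => ih r (ih' r rT)).
  apply: row_norm_le => [|j]; first by rewrite mulr_ge0 ?expR_ge0// divr_ge0// exprn_ge0.
  rewrite dD ?s0//.
  have Ij : rintegrable mu `]0, s[ (fun s => D s 0 j).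
    by apply: integrableS (ID j) => //; apply: subset_itvl; rewrite bnd_simp.
  apply: le_trans (norm_primitive_expR_le (C := L * (B / 2 ^+ k)) l0 s0 Ij _ _) _.
  - have aeF := lebesgue_ae_filter R.
    apply: (@filterS _ _ aeF _ _ _ aeD) => r h /andP[r0 rs].
    by apply: le_trans (row_coord_le _ _) (h _); rewrite r0 (lt_le_trans rs).
  - exact: mulr_ge0.
  - have -> : B / 2 ^+ k.+1 = (B / 2 ^+ k) / 2 by rewrite exprSr invfM mulrA.
    have := expR_ge0 (l * s); move: b0; move: (B / _) (expR _) => q e q0 e0.
    rewrite ler_pdivrMr// /l; have : 0 <= q * e by exact: mulr_ge0.
    nra.
apply/rowP => j; rewrite mxE; apply/eqP; rewrite -normr_eq0; apply/eqP/le_anti.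
rewrite normr_ge0 andbT.
apply: (@le_of_halving _ _ _ (B * expR (l * t))) => k; rewrite add0r mulrAC.
exact: le_trans (row_coord_le _ _) (key k _ tT).
Qed.

Lemma half_of_weight (L q e : R) : 0 <= L -> 0 <= q -> 0 <= e ->
  L * q * e / (2 * L + 1) <= q / 2 * e.
Proof.
move=> L0 q0 e0; rewrite ler_pdivrMr; last lra.
by have : 0 <= q * e by [exact: mulr_ge0]; nra.
Qed.

Section primitive_state.
Variables (c0 : 'rV[R]_m) (w : state).
Hypothesis Iw : forall j, rintegrable mu `]0, T[ (fun s => w s 0 j).

(** Set to 0 outside [0, T], so that states are bounded and measurable on the whole
line and can be convolved. *)
Definition primitive_state : state := fun t =>
  if 0 <= t <= T then c0 + \row_j primitive (fun s => w s 0 j) t else 0.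

Let w0 j := (fun s => w s 0 j) \_ `]0, T[.

Let Iw0 j : rintegrable mu setT (w0 j).
Proof. by apply: (rintegrable_patch _ _ _).1 => //; exact: Iw. Qed.

Let primitive_stateE t j :
  primitive_state t 0 j = \1_(`[0, T]%classic) t * (c0 0 j + primitive (w0 j) t).
Proof.
rewrite /primitive_state indicE; case: ifPn => tT.
  rewrite mem_set ?mul1r/=; last by rewrite in_itv.
  rewrite !mxE; congr (_ + _); apply: eq_Rintegral => s.
  rewrite inE/= in_itv/= => /andP[s0 st]; rewrite /w0 patchE mem_set//= in_itv/= s0.
  by rewrite (lt_le_trans st)//; case/andP: tT.
by rewrite mxE memNset ?mul0r//= in_itv; exact/negP.
Qed.

Lemma bounded_measurable_primitive : bounded_measurable primitive_state.
Proof.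
split=> [j|].
  rewrite (_ : (fun t => _) = (fun t => \1_(`[0, T]%classic) t * (c0 0 j + primitive (w0 j) t))).
    apply: measurable_funM; first exact: measurable_indic.
    apply: measurable_funD => //; apply: measurable_primitive.
    exact: rintegrable_measurable (Iw0 j).
  by apply/funext => t; exact: primitive_stateE.
exists (`|c0| + \sum_j \int[mu]_s `|w0 j s|) => t.
have S0 i : 0 <= \int[mu]_s `|w0 i s| by exact: Rintegral_ge0.
apply: row_norm_le => [|j]; first by rewrite addr_ge0// sumr_ge0.
rewrite primitive_stateE normrM.
have i1 : `|\1_(`[0, T]%classic) t : R| <= 1.
  by rewrite indicE; case: (_ \in _); rewrite ?normr1 ?normr0.
apply: (le_trans (ler_pM _ _ i1 (lexx _))) => //; rewrite mul1r.
apply: (le_trans (ler_normD _ _)); apply: lerD; first exact: row_coord_le.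
apply: (le_trans (norm_primitive_le _ (Iw0 j))).
by rewrite (bigD1 j)//= lerDl sumr_ge0.
Qed.

End primitive_state.

Section picard.
Variables (L : R) (Psi : state -> state) (c0 : 'rV[R]_m).
Hypothesis L0 : 0 <= L.
Hypothesis IPsi : forall c, bounded_measurable c ->
  forall j, rintegrable mu `]0, T[ (fun s => Psi c s 0 j).
Hypothesis LPsi : volterra_lipschitz L Psi.

Let Phi (c : state) : state := primitive_state c0 (Psi c).

Let bmPhi c : bounded_measurable c -> bounded_measurable (Phi c).
Proof. by move=> bc; apply: bounded_measurable_primitive; exact: IPsi. Qed.

Let l : R := 2 * L + 1.
Let l0 : 0 < l. Proof. by rewrite /l; have := L0; lra. Qed.

Let contr c c' b : bounded_measurable c -> bounded_measurable c' -> 0 <= b ->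
  (forall r : R, 0 < r < T -> `|c r - c' r| <= b * expR (l * r)) ->
  forall t, `|Phi c t - Phi c' t| <= b / 2 * expR (l * t).
Proof.
move=> bc bc' b0 cb t; apply: row_norm_le => [|j].
  by rewrite mulr_ge0 ?expR_ge0// divr_ge0.
rewrite /Phi /primitive_state; case: ifPn => tT; last first.
  by rewrite subr0 mxE normr0 mulr_ge0 ?expR_ge0// divr_ge0.
move: tT => /andP[t0 tT]; rewrite !mxE opprD addrACA subrr add0r.
have It c1 : bounded_measurable c1 -> rintegrable mu `]0, t[ (fun s => Psi c1 s 0 j).
  move=> bc1; apply: integrableS (IPsi bc1 j) => //.
  by apply: subset_itvl; rewrite bnd_simp.
rewrite -RintegralB//; [|exact: It..].
apply: le_trans (half_of_weight L0 b0 (expR_ge0 _)).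
apply: norm_primitive_expR_le => //; last exact: mulr_ge0.
  by apply: rintegrableB => //; exact: It.
have aeF := lebesgue_ae_filter R.
apply: (@filterE _ _ aeF) => s /andP[s0 st].
have := LPsi bc bc' l0 b0 cb (s := s); rewrite s0 (lt_le_trans st)// => /(_ isT).
by apply: le_trans; have := row_coord_le (Psi c s - Psi c' s) j; rewrite !mxE.
Qed.

(** Picard iteration: successive iterates differ by at most [B 2^-k e^(l t)], so they
converge at every time with a rate that also passes the equation to the limit. *)
Lemma volterra_exists : exists2 c, bounded_measurable c &
  forall t, 0 <= t <= T -> forall j, c t 0 j = c0 0 j + primitive (fun s => Psi c s 0 j) t.
Proof.
pose x k : state := iter k Phi (fun=> 0).
have bx k : bounded_measurable (x k).
  elim: k => [|k]; last exact: bmPhi.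
  by split=> [j|]; [exact: measurable_cst|exists 0 => t; rewrite normr0].
have [B xB] := (bx 1%N).2.
have B0 : 0 <= B by exact: le_trans (normr_ge0 _) (xB 0).
have be k : 0 <= B / 2 ^+ k by rewrite divr_ge0// exprn_ge0.
have dx k t : `|x k.+1 t - x k t| <= B / 2 ^+ k * expR (l * t).
  elim: k t => [|k ih] t.
    rewrite subr0 expr0 divr1; have := xB t; rewrite /x/= /Phi /primitive_state.
    case: ifPn => [/andP[t0 _] h|_ _]; last by rewrite normr0 mulr_ge0// expR_ge0.
    by rewrite (le_trans h)// ler_peMr// -expR0 ler_expR mulr_ge0// ltW.
  rewrite exprSr invfM mulrA.
  by apply: (contr (bx k.+1) (bx k) (be k)) => r _; exact: ih.
have /choice [c cx] : forall t, exists y : 'rV[R]_m,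
    forall k, `|y - x k t| <= 2 * (B * expR (l * t)) / 2 ^+ k.
  move=> t.
  have /choice [y yx] : forall j, exists y,
      forall k, `|y - x k t 0 j| <= 2 * (B * expR (l * t)) / 2 ^+ k.
    move=> j; apply: geometric_limit => k.
    have := row_coord_le (x k.+1 t - x k t) j; rewrite !mxE => /le_trans; apply.
    by have := dx k t; rewrite mulrAC.
  exists (\row_j y j) => k; apply: row_norm_le => [|j]; last by rewrite !mxE.
  by rewrite divr_ge0 ?exprn_ge0// mulr_ge0// mulr_ge0// expR_ge0.
have cx0 t : (0 <= t <= T) = false -> c t = 0.
  move=> tT; apply/eqP; rewrite -normr_eq0; apply/eqP/le_anti; rewrite normr_ge0 andbT.
  apply: (@le_of_halving _ _ _ (2 * (B * expR (l * t)))) => k; rewrite add0r.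
  by have := cx t k; case: k => [|k]; rewrite /x/= /Phi /primitive_state ?tT subr0.
have bc : bounded_measurable c.
  split=> [j|].
    apply: (@measurable_fun_cvg _ _ _ _ (fun k t => x k t 0 j)) => [k|t _].
      exact: (bx k).1.
    apply/cvgrPdist_lt => e e0.
    have [k0 hk0] : exists k0, 2 * (B * expR (l * t)) / 2 ^+ k0 < e.
      apply: contrapT => /forallNP h.
      have : e <= 0; last by rewrite leNgt e0.
      apply: (@le_of_halving _ _ _ (2 * (B * expR (l * t)))) => k; rewrite add0r leNgt.
      by apply/negP; exact: h.
    exists k0 => // k /= k0k.
    have := row_coord_le (c t - x k t) j; rewrite !mxE => /le_lt_trans; apply.
    apply: le_lt_trans (cx t k) (le_lt_trans _ hk0).
    rewrite ler_wpM2l//; first by rewrite mulr_ge0// mulr_ge0// expR_ge0.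
    by rewrite lef_pV2 ?posrE ?exprn_gt0// ler_weXn2l// ler1n.
  exists (2 * (B * expR (l * T))) => t; have [/andP[t0 tT]|tT] := boolP (0 <= t <= T); last first.
    by rewrite cx0 ?normr0 ?(negbTE tT)// mulr_ge0// mulr_ge0// expR_ge0.
  have := cx t 0%N; rewrite subr0 expr0 divr1 => /le_trans; apply.
  by rewrite ler_wpM2l// ler_wpM2l// ler_expR ler_wpM2l// ltW.
exists c => // t tT j.
have fix_ : c t = Phi c t.
  apply/eqP; rewrite -subr_eq0 -normr_eq0; apply/eqP/le_anti; rewrite normr_ge0 andbT.
  apply: (@le_of_halving _ _ _ (2 * (B * expR (l * t)))) => k; rewrite add0r.
  have h1 := cx t k.+1.
  have h2 : `|Phi (x k) t - Phi c t| <= (2 * (B / 2 ^+ k)) / 2 * expR (l * t).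
    apply: contr => //; first by rewrite mulr_ge0.
    move=> r rT; rewrite distrC; apply: le_trans (cx r k) _.
    by rewrite le_eqVlt; apply/orP; left; apply/eqP; ring.
  apply: le_trans (ler_distD (x k.+1 t) _ _) _.
  apply: le_trans (lerD h1 h2) _.
  rewrite le_eqVlt; apply/orP; left; apply/eqP.
  by rewrite exprS invfM; move: (2 ^+ k)^-1 (expR _) => h E; field.
by rewrite fix_ /Phi /primitive_state tT !mxE.
Qed.

End picard.

End volterra.

(** * Lebesgue measure on row vectors *)

Section cubes.
Variables (R : realType) (n : nat).
Implicit Types (a x : 'rV[R]_n) (A : set 'rV[R]_n).

Definition cube a (r : R) : set 'rV[R]_n := [set x | forall i, `|x ord0 i - a ord0 i| < r].

Lemma open_cube A x : open A -> A x -> exists2 r : R, 0 < r & cube x r `<=` A.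
Proof.
rewrite openE => /[apply] /nbhs_ballP [r /= r0 xA]; exists r => // y yr.
apply: xA; split=> // i j; rewrite ord1 /ball/= distrC; exact: yr.
Qed.

Lemma cube_coord a r : cube a r =
  \bigcap_(i in [set: 'I_n]) (@rV_coord R n i @^-1` `]a ord0 i - r, a ord0 i + r[).
Proof.
apply/seteqP; split => x /= h i.
  by move=> _ /=; rewrite in_itv/= -ltr_distlC distrC; exact: h.
by have := h i I; rewrite /= in_itv/= -ltr_distlC distrC.
Qed.

Lemma measurable_cube a r : measurable (cube a r).
Proof.
rewrite cube_coord; apply: fin_bigcap_measurable => // i _.
by rewrite -[X in measurable X]setTI; apply: measurable_rV_coord.
Qed.

(** The cubes with rational centres and radii [1 / (N + 1)] are countably many, and those
contained in an open set cover it. *)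
Lemma open_measurable_rV A : open A -> measurable A.
Proof.
move=> oA.
pose q2r (q : 'rV[rat]_n) : 'rV[R]_n := map_mx ratr q.
pose P (p : 'rV[rat]_n * nat) : set 'rV[R]_n :=
  if `[< cube (q2r p.1) p.2.+1%:R^-1 `<=` A >] then cube (q2r p.1) p.2.+1%:R^-1 else set0.
have -> : A = \bigcup_p P p.
  apply/seteqP; split => [x Ax|x [p _]]; last first.
    by rewrite /P; case: asboolP => // h /h.
  have [r r0 xrA] := open_cube oA Ax.
  pose N := Num.truncn (2 / r).
  have N0 : 0 < (N.+1%:R : R)^-1 by rewrite invr_gt0 ltr0n.
  have Nr : 2 * (N.+1%:R : R)^-1 < r.
    by rewrite ltr_pdivrMr ?ltr0n// mulrC -ltr_pdivrMr// truncnS_gt.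
  have /choice [q qx] : forall i, exists q : rat, `|x ord0 i - ratr q| < N.+1%:R^-1.
    move=> i; have /rat_in_itvoo [q] : x ord0 i - N.+1%:R^-1 < x ord0 i + N.+1%:R^-1.
      by rewrite ltrBlDr -addrA ltrDl addr_gt0.
    by rewrite in_itv/= -ltr_distlC => ?; exists q.
  have xc : cube (q2r (\row_i q i)) N.+1%:R^-1 x by move=> i; rewrite !mxE; exact: qx.
  exists (\row_i q i, N) => //; rewrite /P; case: asboolP => // -[] y yq.
  apply: xrA => i; have := yq i; have := xc i; rewrite !mxE => h1 h2.
  apply: le_lt_trans (ler_distD (ratr (q i)) _ _) _.
  apply: lt_trans Nr; rewrite mulr2n mulrDl mul1r; apply: ltrD => //.
  by rewrite distrC.
apply: countable_bigcupT_measurable => [|p]; first exact: countableP.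
rewrite /P; case: ifP => _; [exact: measurable_cube|exact: measurable0].
Qed.

Lemma continuous_measurable_rV (f : 'rV[R]_n -> R) : continuous f ->
  measurable_fun setT f.
Proof.
move=> /continuousP cf; apply: (measurability _ (RGenOpens.measurableE R)).
move=> _ [_ [a [b ->] <-]]; rewrite setTI; apply: open_measurable_rV.
exact/cf/interval_open.
Qed.

Lemma measurable_rV_entry (i : 'I_n) : measurable_fun setT (fun x : 'rV[R]_n => x ord0 i).
Proof. exact: measurable_rV_coord. Qed.

End cubes.

Section cube_volume.
Variable R : realType.
Local Open Scope ereal_scope.

Lemma rV_lebesgue_cube n (a : 'rV[R]_n) (r : R) : (0 < r)%R ->
  rV_lebesgue R n (cube a r) = ((2 * r) ^+ n)%:E.
Proof.
move=> r0; elim: n a => [|n ih] a.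
  rewrite /= expr0 diracE mem_set// => i; by case: i.
have -> : rV_lebesgue R n.+1 (cube a r) =
    (@lebesgue_measure R \x rV_lebesgue R n)
      (`](a ord0 ord0 - r)%R, (a ord0 ord0 + r)%R[%classic `*` cube (\row_j a ord0 (lift ord0 j)) r).
  rewrite /= /rV_leb_step /pushforward; congr (_ _).
  apply/seteqP; split => [[t y]/= h|[t y]/= [h1 h2] i].
    split=> [|j].
      by have := h ord0; rewrite mxE unlift_none/= in_itv/= -ltr_distlC distrC.
    by have := h (lift ord0 j); rewrite !mxE liftK.
  rewrite mxE; case: unliftP => [j|] ->.
    by have := h2 j; rewrite mxE.
  by rewrite distrC ltr_distlC; move: h1; rewrite in_itv.
rewrite product_measure1E//; last exact: measurable_cube.
have E : @lebesgue_measure R `](a ord0 ord0 - r)%R, (a ord0 ord0 + r)%R[%classic = (2 * r)%:E.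
  rewrite lebesgue_measure_itv/= lte_fin ifT; last by rewrite ltrD2l; lra.
  by rewrite -EFinB; congr EFin; ring.
by rewrite ih exprS EFinM; congr (_ * _); exact: E.
Qed.

Lemma rV_lebesgue_bounded_lty n (A : set 'rV[R]_n) B : measurable A ->
  (forall x, A x -> `|x| <= B)%R -> rV_lebesgue R n A < +oo.
Proof.
move=> mA AB.
have B0 : (0 < `|B| + 1)%R by rewrite ltr_wpDl.
apply: (@le_lt_trans _ _ (rV_lebesgue R n (cube 0 (`|B| + 1)))).
  apply: le_measure; rewrite ?inE//; first exact: measurable_cube.
  move=> x Ax i; rewrite mxE subr0 (le_lt_trans (row_coord_le x i))//.
  by rewrite (le_lt_trans (AB _ Ax))// ltr_pwDr// ler_norm.
by rewrite rV_lebesgue_cube// ltry.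
Qed.

End cube_volume.

(** * Memory kernels *)

Section memory_kernel.
Variables (R : realType) (T : R) (K : R -> R).
Local Notation mu := (@lebesgue_measure R).
Hypothesis IK : rintegrable mu `]0, T[ K.

Let K0 := K \_ `]0, T[.

Let IK0 : rintegrable mu setT K0.
Proof. exact: (rintegrable_patch _ _ _).1. Qed.

Definition kernel_mass := \int[mu]_s `|K0 s|.

Lemma kernel_mass_ge0 : 0 <= kernel_mass.
Proof. exact: Rintegral_ge0. Qed.

Let K0E s : 0 < s < T -> K0 s = K s.
Proof. by move=> sT; rewrite /K0 patchE mem_set//= in_itv. Qed.

Let K0_neq0 s : K0 s != 0 -> 0 < s < T.
Proof.
rewrite /K0 patchE; case: ifPn => [|_]; last by rewrite eqxx.
by rewrite inE/= in_itv.
Qed.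

(** Cutting kernel and density off outside ]0, T[ turns the integral over the past into
a convolution over the line. *)
Let kconv_integrand v t s : 0 < t <= T ->
  ((fun r => K (t - r) * v r) \_ `]0, t[) s = K0 (t - s) * (v \_ `]0, T[) s.
Proof.
move=> /andP[t0 tT]; rewrite patchE; case: ifPn => [|].
  rewrite inE/= in_itv/= => /andP[s0 st].
  rewrite K0E ?patchE ?mem_set//=; first by rewrite in_itv/= s0 (lt_le_trans st).
  by rewrite subr_gt0 st /=; lra.
move=> st; have [->|/K0_neq0/andP[ts _]] := eqVneq (K0 (t - s)) 0; first by rewrite mul0r.
rewrite patchE memNset ?mulr0// => /=; rewrite in_itv/= => /andP[s0 _].
by move: st; rewrite notin_setE/= in_itv/= s0 -subr_gt0 ts.
Qed.

Lemma kernel_convE v t : 0 < t <= T -> kernel_conv K v t = conv K0 (v \_ `]0, T[) t.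
Proof.
move=> tT; rewrite /kernel_conv Rintegral_mkcond.
by apply: eq_Rintegral => s _; exact: kconv_integrand.
Qed.

Section bounded_density.
Variables (v : R -> R) (B : R).
Hypothesis mv : measurable_fun setT v.
Hypothesis vB : forall s, `|v s| <= B.

Let mv0 : measurable_fun setT (v \_ `]0, T[).
Proof. by apply/(measurable_restrictT v) => //; exact: measurable_funTS. Qed.

Let v0B s : `|(v \_ `]0, T[) s| <= B.
Proof.
rewrite patchE; case: ifP => _; first exact: vB.
by rewrite normr0 (le_trans _ (vB 0)).
Qed.

Lemma rintegrable_kernel t : 0 < t <= T -> rintegrable mu `]0, t[ (fun s => K (t - s) * v s).
Proof.
move=> tT; apply/rintegrable_patch => //.
by apply: eq_rintegrable (rintegrable_conv t IK0 mv0 v0B) => // s _; rewrite kconv_integrand.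
Qed.

Lemma measurable_kernel_conv : measurable_fun `]0, T[ (kernel_conv K v).
Proof.
have mc : measurable_fun `]0, T[ (conv K0 (v \_ `]0, T[)).
  by apply: measurable_funTS; exact: measurable_conv IK0 mv0.
apply: eq_measurable_fun mc => t; rewrite inE/= in_itv/= => /andP[t0 tT].
by rewrite kernel_convE// t0 ltW.
Qed.

Lemma norm_kernel_conv_le l b s : 0 < l -> 0 <= b ->
  (forall r : R, 0 < r < T -> `|v r| <= b * expR (l * r)) -> 0 < s < T ->
  `|kernel_conv K v s| <= b * expR (l * s) * kernel_mass.
Proof.
move=> l0 b0 vb /andP[s0 sT]; rewrite kernel_convE; last by rewrite s0 ltW.
apply: (norm_conv_le IK0 mv0 v0B) => r /K0_neq0/andP[sr _].
rewrite patchE; case: ifP => [|_].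
  rewrite inE/= in_itv/= => /vb/le_trans; apply.
  by rewrite ler_wpM2l// ler_expR ler_wpM2l//; lra.
by rewrite normr0 mulr_ge0// expR_ge0.
Qed.

Lemma kernel_conv_bounded s : 0 < s < T -> `|kernel_conv K v s| <= B * kernel_mass.
Proof.
move=> /andP[s0 sT]; rewrite kernel_convE; last by rewrite s0 ltW.
by apply: (norm_conv_le IK0 mv0 v0B) => r _.
Qed.

End bounded_density.

Lemma kernel_convB (v w : R -> R) (B B1 t : R) : 0 < t <= T ->
  measurable_fun setT v -> (forall s, `|v s| <= B) ->
  measurable_fun setT w -> (forall s, `|w s| <= B1) ->
  kernel_conv K (fun s => v s - w s) t = kernel_conv K v t - kernel_conv K w t.
Proof.
move=> tT mv vB mw wB; rewrite /kernel_conv -RintegralB//.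
- by under eq_Rintegral do rewrite mulrBr.
- exact: (rintegrable_kernel mv vB tT).
- exact: (rintegrable_kernel mw wB tT).
Qed.

Lemma kernel_conv_sum (I : finType) (a : I -> R) (v : I -> R -> R) (B t : R) : 0 < t <= T ->
  (forall i, measurable_fun setT (v i)) -> (forall i s, `|v i s| <= B) ->
  kernel_conv K (fun s => \sum_i a i * v i s) t = \sum_i a i * kernel_conv K (v i) t.
Proof.
move=> tT mv vB; rewrite /kernel_conv.
under eq_Rintegral do rewrite mulr_sumr.
have Iv i := rintegrable_kernel (mv i) (vB i) tT.
rewrite Rintegral_sum//.
  apply: eq_bigr => i _; rewrite -RintegralZl//; last exact: (Iv i).
  by under eq_Rintegral do rewrite mulrCA.
move=> i _; have := rintegrableZ (a i) _ (Iv i).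
by move=> /(_ (measurable_itv _)); apply: eq_rintegrable => // s _; rewrite mulrCA.
Qed.

(** Positivity is assumed for extended integrals; a bounded density makes the inner one
finite, hence equal to the real convolution. *)
Lemma kernel_form_ge0 (v : R -> R) (B S : R) : positive_kernel T K -> 0 <= S <= T ->
  measurable_fun setT v -> (forall s, `|v s| <= B) ->
  0 <= \int[mu]_(t in `]0, S[) (kernel_conv K v t * v t).
Proof.
move=> [_ posK] /andP[]; rewrite le_eqVlt => /predU1P[<- _ _ _|S0 ST mv vB].
  by rewrite set_itv_ge ?bnd_simp// Rintegral_set0.
have muS := lebesgue_itvoo_lty 0 S.
have mLp : memLp mu 2 `]0, S[ v.
  split; first exact: measurable_funTS.
  have : rintegrable mu `]0, S[ (fun x => `|v x| `^ 2).
    apply: (@rintegrable_bounded _ _ _ _ _ _ (B ^+ 2)) => //.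
      apply: measurable_funTS; apply: (measurableT_comp (measurable_powR 2)).
      exact: measurableT_comp.
    move=> x _; rewrite powR_mulrn// ger0_norm ?exprn_ge0//.
    by rewrite lerXn2r ?nnegrE// (le_trans _ (vB x)).
  by move/integrable_lty; apply.
have := posK S _ v mLp; rewrite S0 ST => /(_ isT).
move=> H; apply: fine_ge0; apply: (le_trans H).
rewrite le_eqVlt; apply/orP; left; apply/eqP; apply: eq_integral => t.
rewrite inE/= in_itv/= => /andP[t0 tS].
have It : rintegrable mu `]0, t[ (fun s => K (t - s) * v s).
  by apply: (rintegrable_kernel mv vB); rewrite t0 (le_trans (ltW tS)).
under eq_integral do rewrite EFinM.
rewrite integralZr// EFinM; congr (_ * _)%E.
by rewrite /kernel_conv fineK//; exact: (integrable_fin_num _ It).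
Qed.

End memory_kernel.

(** * Locally Lipschitz fields and their truncation *)

Section local_lipschitz.
Variables (R : realType) (m : nat).
Implicit Types (F : 'rV[R]_m -> 'rV[R]_m) (x y : 'rV[R]_m).

Definition locally_lipschitz F := forall r : R, exists2 L : R, 0 <= L &
  forall x y, `|x| <= r -> `|y| <= r -> `|F x - F y| <= L * `|x - y|.

Lemma locally_lipschitz_bounded F r : locally_lipschitz F ->
  exists2 B : R, 0 <= B & forall x, `|x| <= r -> `|F x| <= B.
Proof.
move=> /(_ r) [L L0 FL].
have [r0|r0] := leP 0 r; last first.
  by exists 0 => // x xr; have := le_trans (normr_ge0 x) xr; rewrite leNgt r0.
exists (`|F 0| + L * r) => [|x xr]; first by rewrite addr_ge0// mulr_ge0.
have := FL x 0 xr; rewrite normr0 subr0 => /(_ r0) h.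
rewrite -(subrK (F 0) (F x)) (le_trans (ler_normD _ _))// addrC lerD2l.
by rewrite (le_trans h)// ler_wpM2l.
Qed.

Lemma locally_lipschitz_measurable F j : locally_lipschitz F ->
  measurable_fun setT (fun x => F x 0 j).
Proof.
move=> FL; apply: continuous_measurable_rV => x.
have nx := @nbhs_filter 'rV[R]_m x.
apply: (proj2 (cvgrPdist_lt _ _)) => e e0.
have [L L0 xL] := FL (`|x| + 1).
have L1 : 0 < L + 1 by lra.
suff: nbhs x (fun y => `|F x 0 j - F y 0 j| < e) by [].
apply/nbhs_ballP; exists (Num.min 1 (e / (L + 1))) => /=.
  by rewrite lt_min ltr01 divr_gt0.
move=> y; rewrite mx_norm_ball /ball_/= lt_min => /andP[xy1 xye].
have yx : `|y| <= `|x| + 1.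
  rewrite -(subrK x y) (le_trans (ler_normD _ _))// addrC lerD2l distrC ltW//.
have := row_coord_le (F x - F y) j; rewrite !mxE => /le_lt_trans; apply.
apply: le_lt_trans (xL x y _ yx) _; first by rewrite lerDl.
apply: (@le_lt_trans _ _ ((L + 1) * `|x - y|)).
  by rewrite ler_wpM2r// lerDl.
by rewrite mulrC -ltr_pdivlMr.
Qed.

Lemma bounded_measurable_comp F (c : R -> 'rV[R]_m) : locally_lipschitz F ->
  bounded_measurable c -> bounded_measurable (F \o c).
Proof.
move=> FL [mc [B cB]]; split=> [j|].
  have mc' : measurable_fun setT c by apply/measurable_fun_rVP => i; exact: mc.
  exact: (measurableT_comp (locally_lipschitz_measurable j FL) mc').
have [B' _ FB] := locally_lipschitz_bounded B FL.
by exists B' => t; exact: FB.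
Qed.

Definition cutoff (r : R) x : R := Num.max 0 (Num.min 1 (2 - `|x| / r)).

Lemma cutoff_bounds r x : 0 <= cutoff r x <= 1.
Proof. by rewrite /cutoff le_max lexx/= ge_max ler01 ge_min lexx. Qed.

Lemma cutoff1 r x : 0 < r -> `|x| <= r -> cutoff r x = 1.
Proof.
move=> r0 xr; rewrite /cutoff min_l ?max_r//.
by rewrite lerBrDr -lerBrDl ler_pdivrMr//; lra.
Qed.

Lemma cutoff0 r x : 0 < r -> 2 * r <= `|x| -> cutoff r x = 0.
Proof.
move=> r0 xr; have h : 2 - `|x| / r <= 0 by rewrite subr_le0 ler_pdivlMr.
by rewrite /cutoff max_l// ge_min h orbT.
Qed.

Lemma cutoff_lipschitz r x y : 0 < r -> `|cutoff r x - cutoff r y| <= `|x - y| / r.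
Proof.
move=> r0.
have h : `|(2 - `|x| / r) - (2 - `|y| / r)| <= `|x - y| / r.
  have -> : (2 - `|x| / r) - (2 - `|y| / r) = (`|y| - `|x|) * r^-1 by ring.
  rewrite normrM [`|r^-1|]gtr0_norm ?invr_gt0//.
  by rewrite ler_wpM2r ?invr_ge0 ?(ltW r0)// (distrC x) ler_dist_dist.
apply: le_trans h; rewrite /cutoff; move: (2 - _) (2 - _) => u v.
have := ler_norm (u - v); have := ler_norm (v - u); rewrite (distrC v u).
move: `|u - v| => d uv vu; rewrite ler_norml; apply/andP.
case: (leP 1 u) => ?; case: (leP 1 v) => ?; rewrite ?[Num.max 0 1]max_r ?ler01//;
  case: (leP 0 u) => ?; case: (leP 0 v) => ?; split; lra.
Qed.

Definition truncated r F x := cutoff r x *: F x.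

(** Inside the ball of radius [2 r] the product of two bounded Lipschitz functions is
Lipschitz.  For a point outside, the cutoff vanishes and its own Lipschitz constant
suffices. *)
Lemma truncated_lipschitz r F : 0 < r -> locally_lipschitz F ->
  exists2 L : R, 0 <= L & forall x y, `|truncated r F x - truncated r F y| <= L * `|x - y|.
Proof.
move=> r0 FL; have [L L0 FxL] := FL (2 * r).
have [B B0 FB] := locally_lipschitz_bounded (2 * r) FL.
exists (L + B / r) => [|x y]; first by rewrite addr_ge0// divr_ge0// ltW.
(* With both points outside the ball of radius [2 r] the left-hand side vanishes. *)
wlog xr : x y / `|x| <= 2 * r.
  move=> wl; have [xr|xr] := leP `|x| (2 * r); first exact: wl.
  have [yr|yr] := leP `|y| (2 * r).
    by rewrite distrC (distrC x); exact: wl.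
  rewrite /truncated !cutoff0// ?(ltW xr) ?(ltW yr)// !scale0r subr0 normr0.
  by rewrite mulr_ge0// addr_ge0// divr_ge0// ltW.
have cxy := cutoff_lipschitz x y r0.
have [yr|yr] := leP `|y| (2 * r).
  have -> : truncated r F x - truncated r F y =
      cutoff r x *: (F x - F y) + (cutoff r x - cutoff r y) *: F y.
    by rewrite /truncated scalerBr scalerBl addrA subrK.
  rewrite (le_trans (ler_normD _ _))// mulrDl lerD// normrZ.
    have /andP[c0 c1] := cutoff_bounds r x.
    rewrite ger0_norm// -[leRHS]mul1r ler_pM//; exact: FxL.
  have -> : B / r * `|x - y| = (`|x - y| / r) * B by ring.
  by rewrite ler_pM//; exact: FB.
have cy : cutoff r y = 0 by apply: cutoff0 => //; exact: ltW.
rewrite /truncated cy scale0r subr0 normrZ; move: cxy; rewrite cy subr0 => cxy.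
apply: (@le_trans _ _ (B / r * `|x - y|)); last by rewrite ler_wpM2r// lerDr.
have -> : B / r * `|x - y| = (`|x - y| / r) * B by ring.
by rewrite ler_pM//; exact: FB.
Qed.

Lemma lipschitz_locally F (L : R) : 0 <= L ->
  (forall x y, `|F x - F y| <= L * `|x - y|) -> locally_lipschitz F.
Proof. by move=> L0 FL r; exists L => // x y _ _; exact: FL. Qed.

Definition dissipative (C : R) F :=
  forall x, \sum_j F x 0 j * x 0 j <= C * \sum_j x 0 j ^+ 2.

(** Multiplying by a factor in [0, 1] can only lower the growth, since [C >= 0]. *)
Lemma truncated_dissipative r C F : 0 <= C -> dissipative C F ->
  dissipative C (truncated r F).
Proof.
move=> C0 FC x; rewrite /truncated.
under eq_bigr do rewrite mxE -mulrA.
rewrite -mulr_sumr; have /andP[c0 c1] := cutoff_bounds r x.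
apply: (@le_trans _ _ (cutoff r x * (C * \sum_j x 0 j ^+ 2))); first by rewrite ler_wpM2l.
by rewrite ler_piMl// mulr_ge0// sumr_ge0// => j _; exact: sqr_ge0.
Qed.

End local_lipschitz.

(** * Dissipative systems with memory *)

Section memory_system.
Variables (R : realType) (m : nat) (T : R).
Local Notation mu := (@lebesgue_measure R).
Local Notation state := (R -> 'rV[R]_m).
Variable K : R -> R.
Hypothesis IK : rintegrable mu `]0, T[ K.
Variables (Q : finType) (om : Q -> R) (b : Q -> 'I_m -> R).
Hypothesis om0 : forall q, 0 <= om q.
Variable g : 'I_m -> R -> R.
Hypothesis Ig : forall j, rintegrable mu `]0, T[ (g j).

Definition mode q (c : state) (s : R) : R := \sum_i b q i * c s 0 i.

(** The coupling matrix is the sum of the rank-one matrices [b q i * b q j] with weights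
[om q >= 0], so that the energy of the memory is a nonnegative combination of the
scalar quadratic forms of [K]. *)
Definition memory (c : state) (j : 'I_m) (s : R) : R :=
  \sum_q om q * b q j * kernel_conv K (mode q c) s.

Definition memory_rhs (F : 'rV[R]_m -> 'rV[R]_m) (c : state) : state :=
  fun s => \row_j (F (c s) 0 j - memory c j s + g j s).

Lemma measurable_mode q c : bounded_measurable c -> measurable_fun setT (mode q c).
Proof.
move=> [mc _]; rewrite /mode; apply: measurable_sum => i.
by apply: measurable_funM => //; exact: mc.
Qed.

Lemma norm_mode_le q (c : state) s B : `|c s| <= B ->
  `|mode q c s| <= B * \sum_i `|b q i|.
Proof.
move=> cB; apply: (le_trans (ler_norm_sum _ _ _)); rewrite mulr_sumr ler_sum// => i _.
by rewrite normrM mulrC ler_wpM2r// (le_trans (row_coord_le _ _)).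
Qed.

Lemma modeB q (c c' : state) s :
  mode q (fun r => c r - c' r) s = mode q c s - mode q c' s.
Proof.
rewrite /mode -sumrB; apply: eq_bigr => i _.
by rewrite !mxE mulrBr.
Qed.

Let kappa := kernel_mass T K.
Let kappa0 : 0 <= kappa. Proof. exact: kernel_mass_ge0. Qed.

Definition memory_lipschitz : R :=
  \sum_j \sum_q om q * `|b q j| * (\sum_i `|b q i|) * kappa.

Lemma memory_lipschitz_ge0 : 0 <= memory_lipschitz.
Proof.
apply: sumr_ge0 => j _; apply: sumr_ge0 => q _.
by rewrite !mulr_ge0// sumr_ge0.
Qed.

Let IBmode q c : bounded_measurable c -> exists B : R, forall s : R, `|mode q c s| <= B.
Proof. by move=> [_ [B cB]]; eexists => s; exact: norm_mode_le (cB s). Qed.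

Lemma bounded_measurableB (c c' : state) : bounded_measurable c -> bounded_measurable c' ->
  bounded_measurable (fun s => c s - c' s).
Proof.
move=> [mc [B cB]] [mc' [B' cB']]; split=> [j|].
  rewrite (_ : (fun t => _) = (fun t => c t 0 j - c' t 0 j)).
    exact: measurable_funB.
  by apply/funext => t; rewrite !mxE.
by exists (B + B') => t; rewrite (le_trans (ler_normB _ _))// lerD.
Qed.

Lemma memoryB (c c' : state) j s : bounded_measurable c -> bounded_measurable c' -> 0 < s < T ->
  memory (fun r => c r - c' r) j s = memory c j s - memory c' j s.
Proof.
move=> bc bc' /andP[s0 sT]; rewrite /memory -sumrB; apply: eq_bigr => q _.
rewrite -mulrBr; congr (_ * _).
have [B cB] := IBmode q bc; have [B' cB'] := IBmode q bc'.
rewrite -(kernel_convB IK _ (measurable_mode q bc) cB (measurable_mode q bc') cB').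
  by congr (kernel_conv _ _ _); apply/funext => r; exact: modeB.
by rewrite s0 ltW.
Qed.

Lemma norm_memory_le (c : state) j (l B s : R) : bounded_measurable c -> 0 < l -> 0 <= B ->
  (forall r : R, 0 < r < T -> `|c r| <= B * expR (l * r)) -> 0 < s < T ->
  `|memory c j s| <= memory_lipschitz * B * expR (l * s).
Proof.
move=> bc l0 B0 cB sT.
apply: (@le_trans _ _ ((\sum_q om q * `|b q j| * (\sum_i `|b q i|) * kappa) * (B * expR (l * s)))).
  rewrite mulr_suml; apply: (le_trans (ler_norm_sum _ _ _)); apply: ler_sum => q _.
  rewrite !normrM (ger0_norm (om0 q)) -!mulrA ler_wpM2l// ler_wpM2l//.
  have [M cM] := IBmode q bc.
  apply: le_trans (norm_kernel_conv_le IK (measurable_mode q bc) cM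
    (b := B * \sum_i `|b q i|) l0 _ _ sT) _.
  - by rewrite mulr_ge0// sumr_ge0.
  - by move=> r rT; rewrite mulrAC; apply: norm_mode_le; exact: cB.
  - by rewrite le_eqVlt; apply/orP; left; apply/eqP; rewrite /kappa; ring.
rewrite -mulrA ler_wpM2r//; first by rewrite mulr_ge0// expR_ge0.
rewrite /memory_lipschitz [leRHS](bigD1 j)//= lerDl; apply: sumr_ge0 => i _.
by apply: sumr_ge0 => q _; rewrite !mulr_ge0// sumr_ge0.
Qed.

Lemma measurable_memory c j : bounded_measurable c -> measurable_fun `]0, T[ (memory c j).
Proof.
move=> bc; apply: measurable_sum => q; apply: measurable_funM => //.
exact: (measurable_kernel_conv IK (measurable_mode q bc)).
Qed.

Lemma rintegrable_memory_rhs F c j : locally_lipschitz F -> bounded_measurable c ->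
  rintegrable mu `]0, T[ (fun s => memory_rhs F c s 0 j).
Proof.
move=> FL bc.
have [mF [BF FB]] := bounded_measurable_comp FL bc.
have IF : rintegrable mu `]0, T[ (fun s => F (c s) 0 j).
  apply: (@rintegrable_bounded _ _ _ _ _ _ BF) => //; first exact: lebesgue_itvoo_lty.
    by apply: measurable_funTS; exact: mF.
  by move=> s _; apply: le_trans (row_coord_le _ _) (FB s).
have Im : rintegrable mu `]0, T[ (memory c j).
  have [B cB] := bc.2.
  have B0 : 0 <= B by exact: le_trans (normr_ge0 _) (cB 0).
  apply: (@rintegrable_bounded _ _ _ _ _ _ (memory_lipschitz * B * expR (1 * T))) => //.
    exact: lebesgue_itvoo_lty.
    exact: measurable_memory.
  move=> s; rewrite /= in_itv/= => sT.
  apply: (@le_trans _ _ (memory_lipschitz * B * expR (1 * s))).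
    apply: norm_memory_le => // r /andP[r0 _].
    by rewrite (le_trans (cB r))// ler_peMr// mul1r -expR0 ler_expR ltW.
  rewrite ler_wpM2l ?mulr_ge0 ?memory_lipschitz_ge0// ler_expR !mul1r.
  by case/andP: sT => _ /ltW.
by apply: eq_rintegrable (rintegrableD _ (rintegrableB _ IF Im) (Ig j)) => // s _;
  rewrite mxE.
Qed.

Lemma norm_memory_rhsB_le F (L : R) (c c' : state) (l B s : R) :
  bounded_measurable c -> bounded_measurable c' -> 0 <= L -> 0 < l -> 0 <= B ->
  (forall r : R, 0 < r < T -> `|F (c r) - F (c' r)| <= L * `|c r - c' r|) ->
  (forall r : R, 0 < r < T -> `|c r - c' r| <= B * expR (l * r)) -> 0 < s < T ->
  `|memory_rhs F c s - memory_rhs F c' s| <= (L + memory_lipschitz) * B * expR (l * s).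
Proof.
move=> bc bc' L0 l0 B0 FL cB sT; apply: row_norm_le => [|j].
  by rewrite !mulr_ge0 ?addr_ge0 ?memory_lipschitz_ge0 ?expR_ge0.
rewrite !mxE.
have -> : F (c s) 0 j - memory c j s + g j s - (F (c' s) 0 j - memory c' j s + g j s) =
  (F (c s) - F (c' s)) 0 j - (memory c j s - memory c' j s) by rewrite !mxE; ring.
rewrite -memoryB// (le_trans (ler_normB _ _))// !mulrDl lerD//.
  rewrite (le_trans (row_coord_le _ _))// (le_trans (FL s sT))//.
  by rewrite -mulrA ler_wpM2l// cB.
by apply: norm_memory_le => //; exact: bounded_measurableB.
Qed.

Lemma memory_rhs_lipschitz F L : 0 <= L ->
  (forall x y, `|F x - F y| <= L * `|x - y|) ->
  volterra_lipschitz T (L + memory_lipschitz) (memory_rhs F).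
Proof.
by move=> L0 FL c c' bc bc' l B l0 B0 cB s sT; exact: norm_memory_rhsB_le.
Qed.

Definition memory_solution F (c0 : 'rV[R]_m) (c : state) :=
  forall t : R, 0 <= t <= T -> forall j,
    c t 0 j = c0 0 j + primitive (fun s => memory_rhs F c s 0 j) t.

Section energy.
Variables (F : 'rV[R]_m -> 'rV[R]_m) (c0 : 'rV[R]_m) (c : state) (C : R).
Hypothesis C0 : 0 <= C.
Hypothesis posK : positive_kernel T K.
Hypothesis FL : locally_lipschitz F.
Hypothesis FC : dissipative C F.
Hypothesis bc : bounded_measurable c.
Hypothesis solc : memory_solution F c0 c.

Definition forcing_mass : R := \sum_j \int[mu]_(s in `]0, T[) `|g j s|.

Definition energy_constant : R := \sum_j c0 0 j ^+ 2 + 4 * forcing_mass ^+ 2.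

Lemma energy_constant_ge0 : 0 <= energy_constant.
Proof.
apply: addr_ge0; last by rewrite mulr_ge0// sqr_ge0.
by apply: sumr_ge0 => i _; exact: sqr_ge0.
Qed.

Definition energy_rate : R := 4 * C * m%:R + 1.

Let l := energy_rate.
Let l0 : 0 < l.
Proof. by rewrite /l /energy_rate ltr_wpDl// !mulr_ge0. Qed.

Let sub_itv S : S <= T -> `]0, S[%classic `<=` (`]0, T[%classic : set R).
Proof. by move=> ST; apply: subset_itvl; rewrite bnd_simp. Qed.

Let w j s := memory_rhs F c s 0 j.

Let Iw j S : S <= T -> rintegrable mu `]0, S[ (w j).
Proof.
by move=> ST; apply: integrableS (rintegrable_memory_rhs j FL bc) => //; exact: sub_itv.
Qed.

Let mcT j S : measurable_fun (`]0, S[%classic : set R) (fun s => c s 0 j).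
Proof. by apply: measurable_funTS; exact: bc.1. Qed.

Let IwM j S : S <= T -> rintegrable mu `]0, S[ (fun s => w j s * c s 0 j).
Proof.
move=> ST; have [B cB] := bc.2.
apply: (@rintegrableM_bounded _ _ _ _ _ _ _ B) => //; [exact: mcT| |exact: Iw].
by move=> s _; exact: le_trans (row_coord_le _ _) (cB s).
Qed.

Let square_coord j t : 0 <= t <= T ->
  c t 0 j ^+ 2 = c0 0 j ^+ 2 + 2 * \int[mu]_(s in `]0, t[) (w j s * c s 0 j).
Proof.
move=> /andP[t0 tT].
pose W := w j \_ `]0, T[.
have IW : rintegrable mu setT W by apply: (rintegrable_patch _ _ _).1 => //; exact: Iw.
have cW s : 0 <= s <= T -> c s 0 j = c0 0 j + primitive W s.
  move=> sT; rewrite solc//; congr (_ + _); apply: eq_Rintegral => r.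
  rewrite inE/= in_itv/= => /andP[r0 rs]; rewrite /W patchE mem_set//= in_itv/= r0.
  by case/andP: sT => _; apply: lt_le_trans.
rewrite cW ?t0// sqr_primitive//; congr (_ + 2 * _); apply: eq_Rintegral => s.
rewrite inE/= in_itv/= => /andP[s0 st].
have sT : s < T by exact: lt_le_trans tT.
rewrite -cW; last by rewrite (ltW s0) ltW.
by rewrite /W patchE mem_set//= in_itv/= s0.
Qed.

Let N s := \sum_j c s 0 j ^+ 2.

Let N_eq t : 0 <= t <= T ->
  N t = \sum_j c0 0 j ^+ 2 + 2 * \int[mu]_(s in `]0, t[) (\sum_j w j s * c s 0 j).
Proof.
move=> /[dup] tT /andP[t0 tT']; rewrite /N (eq_bigr _ (fun j _ => square_coord j tT)).
rewrite big_split/= -mulr_sumr; congr (_ + 2 * _).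
by rewrite Rintegral_sum// => j _; exact: IwM.
Qed.

Let Ikm q S : S <= T ->
  rintegrable mu `]0, S[ (fun s => kernel_conv K (mode q c) s * mode q c s).
Proof.
move=> ST; have [M cM] := IBmode q bc; have mq := measurable_mode q bc.
apply: (@rintegrable_bounded _ _ _ _ _ _ (M * kappa * M)) => //; first exact: lebesgue_itvoo_lty.
  apply: measurable_funM; last exact: measurable_funTS.
  apply: measurable_funS (measurable_kernel_conv IK mq) => //; exact: sub_itv.
move=> s; rewrite /= in_itv/= => /andP[s0 sS]; rewrite normrM ler_pM//.
by apply: (kernel_conv_bounded IK mq cM); rewrite s0 (lt_le_trans sS).
Qed.

(** Testing the memory with [c] gives [sum_q om q (K * v_q) v_q] with [v_q] the mode
[mode q c]; its time integral is nonnegative and can be dropped. *)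
Let energy_split t : 0 <= t <= T ->
  \int[mu]_(s in `]0, t[) (\sum_j w j s * c s 0 j) <=
  \int[mu]_(s in `]0, t[) (\sum_j (F (c s) 0 j * c s 0 j + g j s * c s 0 j)).
Proof.
move=> /[dup] tT /andP[t0 tT'].
pose k s := \sum_q om q * (kernel_conv K (mode q c) s * mode q c s).
have Ik : rintegrable mu `]0, t[ k.
  by apply: rintegrable_sum => // q _; apply: rintegrableZ => //; exact: Ikm.
have Iwc : rintegrable mu `]0, t[ (fun s => \sum_j w j s * c s 0 j).
  by apply: rintegrable_sum => // j _; exact: IwM.
have k0 : 0 <= \int[mu]_(s in `]0, t[) k s.
  rewrite Rintegral_sum//; last by move=> q _; apply: rintegrableZ => //; exact: Ikm.
  apply: sumr_ge0 => q _; rewrite RintegralZl//; last exact: Ikm.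
  have [M cM] := IBmode q bc.
  by rewrite mulr_ge0//; exact: (kernel_form_ge0 IK posK tT (measurable_mode q bc) cM).
apply: (@le_trans _ _ (\int[mu]_(s in `]0, t[) (\sum_j w j s * c s 0 j) +
    \int[mu]_(s in `]0, t[) k s)); first by rewrite lerDl.
rewrite -RintegralD// le_eqVlt; apply/orP; left; apply/eqP.
apply: eq_Rintegral => s _.
have -> : k s = \sum_j memory c j s * c s 0 j.
  rewrite /k /memory; under [RHS]eq_bigr do rewrite mulr_suml.
  rewrite exchange_big/=; apply: eq_bigr => q _; rewrite /mode !mulr_sumr.
  by apply: eq_bigr => j _; ring.
rewrite -big_split/=; apply: eq_bigr => j _; rewrite /w mxE; ring.
Qed.

(** A weighted bound [X] on the squared coordinates is fed into the energy identity.  The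
rate [energy_rate] makes the growth term at most [X / 4], and Young's inequality bounds
the forcing by another [X / 4] plus a constant: half of [X] is gained. *)
Let energy_step X : 0 <= X ->
  (forall (s : R) j, 0 <= s <= T -> c s 0 j ^+ 2 <= X * expR (2 * l * s)) ->
  forall (t : R) j, 0 <= t <= T ->
    c t 0 j ^+ 2 <= (energy_constant + X / 2) * expR (2 * l * t).
Proof.
move=> X0 cX t j /[dup] tT /andP[t0 tT'].
pose e := expR (l * t).
have e2 : expR (2 * l * t) = e ^+ 2.
  by rewrite /e -expRM_natl; congr expR; rewrite -mulr_natl; ring.
have e1 : 1 <= e by rewrite /e -expR0 ler_expR mulr_ge0// ltW.
have G0 : 0 <= forcing_mass by apply: sumr_ge0 => i _; exact: Rintegral_ge0.
have cN : c t 0 j ^+ 2 <= N t.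
  by rewrite /N (bigD1 j)//= lerDl sumr_ge0// => i _; exact: sqr_ge0.
apply: (le_trans cN); rewrite N_eq//.
pose y := Num.sqrt X.
have y0 : 0 <= y by exact: sqrtr_ge0.
have yX : y ^+ 2 = X by rewrite sqr_sqrtr.
have cy s i : 0 < s < t -> `|c s 0 i| <= y * e.
  move=> /andP[s0 st].
  have := cX s i; rewrite (ltW s0) (le_trans (ltW st))// => /(_ isT) h.
  rewrite -[leLHS]ger0_norm// -ler_sqr ?nnegrE//; last by rewrite mulr_ge0// expR_ge0.
  rewrite normr_id -normrX ger0_norm ?sqr_ge0// (le_trans h)// exprMn yX -e2.
  by rewrite ler_wpM2l// ler_expR ler_wpM2l ?mulr_ge0// ?ltW.
have Ie : rintegrable mu `]0, t[ (fun s => expR (2 * l * s)) by exact: rintegrable_expRM.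
have Iga i : rintegrable mu `]0, t[ (fun s => `|g i s|).
  by apply: integrableS (rintegrable_abs _ (Ig i)) => //; exact: sub_itv.
have If1 : rintegrable mu `]0, t[ (fun s => C * (m%:R * X) * expR (2 * l * s)).
  exact: rintegrableZ.
have If2 : rintegrable mu `]0, t[ (fun s => \sum_i y * e * `|g i s|).
  by apply: rintegrable_sum => // i _; exact: rintegrableZ.
have bound : \int[mu]_(s in `]0, t[) (\sum_i w i s * c s 0 i) <=
    C * (m%:R * X) * (e ^+ 2 / (2 * l)) + y * e * forcing_mass.
  apply: le_trans (energy_split tT) _.
  have IFg : rintegrable mu `]0, t[
      (fun s => \sum_i (F (c s) 0 i * c s 0 i + g i s * c s 0 i)).
    have [B cB] := bc.2.
    apply: rintegrable_sum => // i _; apply: rintegrableD => //.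
      have [mF [BF FB]] := bounded_measurable_comp FL bc.
      apply: (@rintegrable_bounded _ _ _ _ _ _ (BF * B)) => //; first exact: lebesgue_itvoo_lty.
        by apply: measurable_funM; [apply: measurable_funTS; exact: mF|exact: mcT].
      move=> s _; rewrite normrM ler_pM//.
        by apply: le_trans (row_coord_le _ _) (FB s).
      by apply: le_trans (row_coord_le _ _) (cB s).
    apply: (@rintegrableM_bounded _ _ _ _ _ _ _ B) => //.
    - exact: mcT.
    - by move=> s _; apply: le_trans (row_coord_le _ _) (cB s).
    by apply: integrableS (Ig i) => //; exact: sub_itv.
  apply: (@le_trans _ _ (\int[mu]_(s in `]0, t[)
      (C * (m%:R * X) * expR (2 * l * s) + \sum_i y * e * `|g i s|))).
    apply: le_Rintegral => //; first exact: rintegrableD.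
    move=> s; rewrite /= in_itv/= => /andP[s0 st].
    rewrite big_split/=; apply: lerD.
      apply: (le_trans (FC _)); rewrite -mulrA ler_wpM2l//.
      have sT : 0 <= s <= T by rewrite (ltW s0) (le_trans (ltW st)).
      apply: le_trans (ler_sum _ (fun i _ => cX s i sT)) _.
      by rewrite sumr_const card_ord -[leLHS]mulr_natl mulrA.
    apply: ler_sum => i _; rewrite (le_trans (ler_norm _))// normrM mulrC ler_wpM2r//.
    by apply: cy; rewrite s0.
  rewrite RintegralD// RintegralZl// lerD//.
    rewrite ler_wpM2l ?mulr_ge0// -e2; apply: Rintegral_expRM_le => //.
    by rewrite mulr_gt0.
  rewrite Rintegral_sum//; last by move=> i _; exact: rintegrableZ.
  rewrite /forcing_mass mulr_sumr ler_sum// => i _; rewrite RintegralZl//; last exact: Iga.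
  rewrite ler_wpM2l//; first by rewrite mulr_ge0// expR_ge0.
  apply: ge0_subset_Rintegral => //; first exact: sub_itv.
  exact: rintegrable_abs.
apply: (@le_trans _ _ (\sum_i c0 0 i ^+ 2 +
   2 * (C * (m%:R * X) * (e ^+ 2 / (2 * l)) + y * e * forcing_mass))).
  by rewrite lerD2l ler_wpM2l.
rewrite e2 /energy_constant.
have N0 : 0 <= \sum_i c0 0 i ^+ 2 by apply: sumr_ge0 => i _; exact: sqr_ge0.
have h1 : C * (m%:R * X) * (e ^+ 2 / (2 * l)) <= X / 8 * e ^+ 2.
  have Cml : C * m%:R / (2 * l) <= 8^-1.
    rewrite ler_pdivrMr ?mulr_gt0// /l /energy_rate -mulrA.
    by have : 0 <= C * m%:R; [exact: mulr_ge0|lra].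
  have Xe : 0 <= X * e ^+ 2 by rewrite mulr_ge0// sqr_ge0.
  have -> : C * (m%:R * X) * (e ^+ 2 / (2 * l)) = C * m%:R / (2 * l) * (X * e ^+ 2).
    by field; exact: lt0r_neq0.
  have -> : X / 8 * e ^+ 2 = 8^-1 * (X * e ^+ 2) by ring.
  exact: ler_wpM2r.
move: N0 G0 h1; move: (\sum_i _) forcing_mass (C * _ * _) => n0 G z n00 G0 h1.
have e2e : e <= e ^+ 2 by rewrite expr2 ler_peMl// (le_trans _ e1).
have h2 : 2 * (y * e * G) <= (X / 4 + 4 * G ^+ 2) * e ^+ 2.
  have h : 2 * (y * G) <= X / 4 + 4 * G ^+ 2.
    by rewrite -yX; have := sqr_ge0 (y / 2 - 2 * G); nra.
  apply: le_trans (ler_wpM2r (sqr_ge0 e) h); rewrite -!mulrA ler_wpM2l// ler_wpM2l//.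
  by rewrite mulrC ler_wpM2l.
have h3 : n0 <= n0 * e ^+ 2 by rewrite ler_peMr// (le_trans e1).
have -> : (n0 + 4 * G ^+ 2 + X / 2) * e ^+ 2 =
  n0 * e ^+ 2 + 2 * (X / 8 * e ^+ 2) + (X / 4 + 4 * G ^+ 2) * e ^+ 2 by field.
by rewrite mulrDr addrA lerD// lerD// ler_wpM2l.
Qed.

(** Iterating [energy_step] from the crude bound provided by the boundedness of [c].  This
replaces Gronwall's inequality for a forcing that is only integrable in time. *)
Lemma energy_bound (t : R) j : 0 <= t <= T ->
  c t 0 j ^+ 2 <= 2 * energy_constant * expR (2 * l * t).
Proof.
move=> tT; have [B cB] := bc.2.
have B0 : 0 <= B by exact: le_trans (normr_ge0 _) (cB 0).
have A0 := energy_constant_ge0.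
apply: (@le_of_halving _ _ _ (B ^+ 2 * expR (2 * l * t))) => k.
have -> : 2 * energy_constant * expR (2 * l * t) + B ^+ 2 * expR (2 * l * t) / 2 ^+ k =
  (2 * energy_constant + B ^+ 2 / 2 ^+ k) * expR (2 * l * t).
  by rewrite [RHS]mulrDl; congr (_ + _); rewrite mulrAC.
elim: k t j tT => [|k ih] t j tT.
  rewrite expr0 divr1; apply: (@le_trans _ _ (B ^+ 2)).
    rewrite -[leLHS]ger0_norm ?sqr_ge0// normrX lerXn2r ?nnegrE//.
    exact: le_trans (row_coord_le _ _) (cB t).
  apply: (@le_trans _ _ (2 * energy_constant + B ^+ 2)); first by rewrite lerDr mulr_ge0.
  rewrite ler_peMr//; first by rewrite addr_ge0 ?sqr_ge0// mulr_ge0.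
  by rewrite -expR0 ler_expR !mulr_ge0//; [exact: ltW|case/andP: tT].
apply: le_trans (energy_step _ ih j tT) _.
  by rewrite addr_ge0 ?mulr_ge0// divr_ge0 ?sqr_ge0// exprn_ge0.
rewrite ler_wpM2r ?expR_ge0// [2 ^+ k.+1]exprSr le_eqVlt; apply/orP; left; apply/eqP.
by field; rewrite expf_eq0 /=; lra.
Qed.

End energy.

(** The a priori bound depends on the growth [C] but not on the Lipschitz constant, hence
not on the cutoff radius [r]; choosing [r] above it makes the cutoff equal to 1 along
the solution. *)
Theorem memory_system_exists F (c0 : 'rV[R]_m) (C : R) : 0 <= C ->
  positive_kernel T K -> locally_lipschitz F -> dissipative C F ->
  exists2 c, bounded_measurable c & memory_solution F c0 c.
Proof.
move=> C0 posK FL FC.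
pose A := 2 * energy_constant c0 * expR (2 * energy_rate C * T).
have A0 : 0 <= A.
  by rewrite /A !mulr_ge0 ?expR_ge0 ?energy_constant_ge0.
(* By [energy_bound] every coordinate is at most [Num.sqrt A] in absolute value on [0, T]. *)
pose r := Num.sqrt A + 1.
have r0 : 0 < r by rewrite ltr_wpDl// sqrtr_ge0.
have [L L0 GL] := truncated_lipschitz r0 FL.
have GLl := lipschitz_locally L0 GL.
have GC := truncated_dissipative r C0 FC.
have [c bc solc] := volterra_exists c0 (addr_ge0 L0 memory_lipschitz_ge0)
   (fun c bc j => rintegrable_memory_rhs j GLl bc) (memory_rhs_lipschitz L0 GL).
exists c => // t tT j; rewrite solc//; congr (_ + _).
apply: eq_Rintegral => s; rewrite inE/= in_itv/= => /andP[s0 st].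
rewrite /memory_rhs !mxE; congr (_ - _ + _).
have cr : `|c s| <= r.
  apply: row_norm_le => [|i]; first exact: ltW.
  apply: (@le_trans _ _ (Num.sqrt A)); last by rewrite lerDl.
  rewrite -sqrtr_sqr ler_wsqrtr//.
  have sT : 0 <= s <= T.
    by rewrite (ltW s0) (le_trans (ltW st)) //; case/andP: tT.
  apply: le_trans (energy_bound C0 posK GLl GC bc solc i sT) _.
  rewrite /A ler_wpM2l//.
    by rewrite mulr_ge0// energy_constant_ge0.
  rewrite ler_expR ler_wpM2l//; last by case/andP: sT.
  by rewrite mulr_ge0// /energy_rate addr_ge0// !mulr_ge0.
by rewrite cutoff1// mul1r.
Qed.


End memory_system.

(** * Orthonormal bases *)

Section orthonormal_basis.
Variables (R : rcfType) (V : vectType R) (P : V -> Prop) (ip : V -> V -> R).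
Hypothesis P0 : P 0.
Hypothesis PL : forall a u v, P u -> P v -> P (a *: u + v).
Hypothesis ipL : forall a u v w, ip (a *: u + v) w = a * ip u w + ip v w.
Hypothesis ipC : forall u v, ip u v = ip v u.
Hypothesis ip_gt0 : forall v, v != 0 -> 0 < ip v v.

Let ip0 w : ip 0 w = 0.
Proof.
have := ipL 1 0 0 w; rewrite scale1r addr0 mul1r => /eqP.
by rewrite -subr_eq0 opprD addNKr oppr_eq0 => /eqP.
Qed.

Let ipD u v w : ip (u + v) w = ip u w + ip v w.
Proof. by have := ipL 1 u v w; rewrite scale1r mul1r. Qed.

Let ipZ a u w : ip (a *: u) w = a * ip u w.
Proof. by have := ipL a u 0 w; rewrite !addr0 ip0 addr0. Qed.

Let ip_sum (I : finType) (F : I -> V) w : ip (\sum_i F i) w = \sum_i ip (F i) w.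
Proof. by elim/big_rec2 : _ => // i x y _ <-. Qed.

Definition orthonormal_in m (e : 'I_m -> V) :=
  (forall j, P (e j)) /\ forall i j, ip (e i) (e j) = (i == j)%:R.

Let coord_orthonormal m (e : 'I_m -> V) (a : 'I_m -> R) j : orthonormal_in e ->
  ip (\sum_i a i *: e i) (e j) = a j.
Proof.
move=> [_ eo]; rewrite ip_sum (bigD1 j)//= big1 ?addr0 => [|i ij].
  by rewrite ipZ eo eqxx mulr1.
by rewrite ipZ eo (negbTE ij) mulr0.
Qed.

Let orthonormal_size m (e : 'I_m -> V) : orthonormal_in e -> (m <= \dim {:V})%N.
Proof.
move=> eo; pose X := [tuple e i | i < m].
have fX : free X.
  apply/freeP => k k0 i.
  have := congr1 (ip ^~ (e i)) k0; rewrite ip0 => {1}<-.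
  rewrite -(coord_orthonormal k i eo); congr (ip _ _); apply: eq_bigr => j _.
  by rewrite (nth_map j) ?size_enum_ord// nth_ord_enum.
have := dimvS (subvf <<X>>%VS).
by rewrite (eqP fX) size_tuple.
Qed.

(** An orthonormal family of maximal size spans: a vector of [P] outside its span, minus
its projection, could be normalised and added. *)
Lemma orthonormal_basis : exists m (e : 'I_m -> V), orthonormal_in e /\
  forall v, P v -> v = \sum_j ip v (e j) *: e j.
Proof.
pose Q m := `[< exists e : 'I_m -> V, orthonormal_in e >].
have Q0 : exists m, Q m.
  by exists 0%N; apply/asboolP; exists (fun=> 0); split=> [|i]; [case|case: i].
have QN m : Q m -> (m <= \dim {:V})%N by move=> /asboolP [e]; exact: orthonormal_size.
have [m /asboolP [e eo] mmax] := ex_maxnP Q0 QN.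
exists m, e; split=> // v Pv; apply/eqP; rewrite -subr_eq0; apply: contraT => w0.
set w := v - _ in w0.
have Psum (s : seq 'I_m) : P (\sum_(j <- s) ip v (e j) *: e j).
  by elim: s => [|i s ih]; rewrite ?big_nil// big_cons; apply: PL => //; exact: eo.1.
have Pw : P w by rewrite /w addrC -scaleN1r; apply: PL.
have we j : ip w (e j) = 0.
  by rewrite /w ipD -scaleN1r ipZ coord_orthonormal// mulN1r subrr.
have ww := ip_gt0 w0.
pose z := (Num.sqrt (ip w w))^-1 *: w.
have Pz : P z by rewrite /z -[X in P X]addr0; apply: PL.
have zz : ip z z = 1.
  rewrite /z ipZ ipC ipZ mulrA -invfM -expr2 sqr_sqrtr ?ltW// mulVf//.
  exact: lt0r_neq0.
have ze j : ip z (e j) = 0 by rewrite /z ipZ we mulr0.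
have : Q m.+1.
  apply/asboolP; exists (fun i => oapp e z (unlift ord_max i)); split=> [i|i j].
    by case: unliftP => [j|] _ //=; exact: eo.1.
  case: unliftP => [i'|] ->; case: unliftP => [j'|] -> /=.
  - by rewrite eo.2 (inj_eq (lift_inj (h := ord_max))).
  - by rewrite ipC ze eq_sym (negbTE (neq_lift _ _)).
  - by rewrite ze (negbTE (neq_lift _ _)).
  - by rewrite zz eqxx.
by move=> /mmax; rewrite ltnn.
Qed.

End orthonormal_basis.

(** * Powers with a real exponent *)

Section power.
Variables (R : realType) (delta : R) (pow : R -> R).
Hypothesis delta1 : 1 <= delta.
Hypothesis hpow : real_power delta pow.

Lemma measurable_real_power : measurable_fun setT pow.
Proof.
have [p0 [e _ pn] _] := hpow.
have -> : pow = (fun s => if s < 0 then e * `|s| `^ delta else `|s| `^ delta).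
  apply/funext => s; case: ltP => s0; first exact: pn.
  by rewrite p0// ger0_norm.
have m1 : measurable_fun setT (fun s : R => `|s| `^ delta).
  have mn : measurable_fun [set: R] (fun s : R => `|s|) by apply: normr_measurable.
  exact: (measurableT_comp (measurable_powR delta) mn).
apply: measurable_fun_ifT => //; first exact: measurable_fun_ltr.
exact: measurable_funM.
Qed.

(** Bernoulli's inequality for the integer exponent [k >= delta], applied to [t = a / b],
replaces the mean value theorem and covers [a = 0]. *)
Let powR_increment (a b : R) : 0 <= a <= b ->
  b `^ delta - a `^ delta <= (Num.truncn delta).+1%:R * b `^ (delta - 1) * (b - a).
Proof.
move=> /andP[a0 ab]; set k := (Num.truncn delta).+1.
have d0 : 0 < delta by rewrite (lt_le_trans ltr01).
have [b0|b0] := leP b 0.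
  have -> : b = a by apply/le_anti; rewrite ab (le_trans b0 a0).
  by rewrite !subrr mulr0.
pose t := a / b.
have t0 : 0 <= t by rewrite divr_ge0// ltW.
have t1 : t <= 1 by rewrite ler_pdivrMr// mul1r.
have ta : a = b * t by rewrite /t mulrC divfK// gt_eqF.
have tk : 1 - k%:R * (1 - t) <= t ^+ k.
  elim: k => [|k ih]; first by rewrite mul0r subr0.
  rewrite exprS -addn1 natrD.
  have h : t * (1 - k%:R * (1 - t)) <= t * t ^+ k by rewrite ler_wpM2l.
  apply: le_trans h; have k0 : 0 <= k%:R :> R by [].
  have : 0 <= k%:R * (1 - t) ^+ 2 by rewrite mulr_ge0// sqr_ge0.
  by nra.
have td : 1 - k%:R * (1 - t) <= t `^ delta.
  apply: (le_trans tk); have [->|tn0] := eqVneq t 0.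
    by rewrite expr0n/= powR_ge0.
  rewrite -powR_mulrn//; apply: ger_powR; first by rewrite t1 andbT lt0r tn0.
  by rewrite ltW// truncnS_gt.
rewrite ta powRM//; last exact: ltW.
have -> : b `^ delta = b * b `^ (delta - 1) by rewrite mulr_powRB1// ltW.
have bd := powR_ge0 b (delta - 1).
have : 0 <= b * b `^ (delta - 1) by rewrite mulr_ge0// ltW.
move: bd; move: (b `^ _) (t `^ _) td => p q td p0 bp0.
have : b * p * (1 - q) <= b * p * (k%:R * (1 - t)) by rewrite ler_wpM2l//; lra.
lra.
Qed.

(** Arguments of equal sign are handled by [powR_increment]; arguments of opposite signs
are both compared with 0, where [|s|^delta <= r^(delta - 1) |s|]. *)
Lemma real_power_lipschitz (r : R) : exists2 L : R, 0 <= L &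
  forall x y, `|x| <= r -> `|y| <= r -> `|pow x - pow y| <= L * `|x - y|.
Proof.
have [p0 [e e1 pn] _] := hpow.
have d0 : 0 < delta by rewrite (lt_le_trans ltr01).
pose k : R := (Num.truncn delta).+1%:R.
have k1 : 1 <= k by rewrite /k ler1n.
pose p := `|r| `^ (delta - 1).
have pp : 0 <= p by exact: powR_ge0.
have kp : 0 <= k * p by rewrite mulr_ge0.
exists (k * p) => // x y xr yr.
have pr (s : R) : `|s| <= r -> `|s| `^ (delta - 1) <= p.
  move=> sr; apply: ge0_ler_powR; rewrite ?nnegrE ?subr_ge0//.
  by rewrite (le_trans sr)// ler_norm.
have en : `|e| = 1 by case: e1 => ->; rewrite ?normrN normr1.
have absL (a b : R) : `|a| <= `|b| -> `|b| <= r ->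
    `| `|b| `^ delta - `|a| `^ delta| <= k * p * (`|b| - `|a|).
  move=> ab br; rewrite ger0_norm; last first.
    by rewrite subr_ge0; apply: ge0_ler_powR; rewrite ?nnegrE// ltW.
  apply: le_trans (powR_increment _) _; first by rewrite normr_ge0 ab.
  by rewrite ler_wpM2r ?subr_ge0// ler_wpM2l ?pr// (le_trans ler01).
have abs2 (a b : R) : `|a| <= r -> `|b| <= r ->
    `| `|a| `^ delta - `|b| `^ delta| <= k * p * `| `|a| - `|b| |.
  move=> ar br; have [ab|ab] := leP `|a| `|b|.
    rewrite distrC; apply: (le_trans (absL _ _ ab br)).
    by rewrite (distrC `|a|) ler_wpM2l// ler_norm.
  by apply: (le_trans (absL _ _ (ltW ab) ar)); rewrite ler_wpM2l// ler_norm.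
have up (s : R) : `|s| <= r -> `|s| `^ delta <= k * p * `|s|.
  move=> sr; rewrite -mulr_powRB1// mulrC ler_wpM2r// (le_trans (pr _ sr))//.
  by rewrite ler_peMl.
wlog xy : x y xr yr / x <= y.
  move=> wl; have [xy|xy] := leP x y; first exact: wl.
  by rewrite distrC (distrC x); apply: wl => //; exact: ltW.
have [x0|x0] := leP 0 x.
  have y0 := le_trans x0 xy.
  rewrite !p0//; by have := abs2 x y xr yr; rewrite (ger0_norm x0) (ger0_norm y0).
have [y0|y0] := leP 0 y; last first.
  rewrite !pn// -mulrBr normrM en mul1r; apply: (le_trans (abs2 _ _ xr yr)).
  by rewrite ler_wpM2l// ler_dist_dist.
rewrite pn// p0//; apply: (le_trans (ler_normB _ _)).
rewrite normrM en mul1r (ger0_norm (powR_ge0 _ _)) (ger0_norm (powR_ge0 _ _)).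
have := up x xr; have := up y yr; rewrite (ger0_norm y0) (ltr0_norm x0) => h1 h2.
rewrite distrC (ger0_norm (x := y - x)) ?subr_ge0//.
apply: le_trans (lerD h2 h1) _; rewrite -mulrDr addrC//.
Qed.

End power.

(** * Integrands that are Lipschitz in a parameter *)

Section lipschitz_families.
Context d (T : measurableType d) (R : realType) (mu : {measure set T -> \bar R}).
Variables (D : set T) (V : normedZmodType R).
Hypothesis mD : measurable D.
Hypothesis muD : (mu D < +oo)%E.
Implicit Types (phi psi : V -> T -> R) (p : R -> R).

(** Integrands depending on a parameter, with bounds uniform in the integration variable.
The class is closed under sums, products and composition with locally Lipschitz
functions, so every term of the scheme is reached from [pw] and [pwgrad]. *)
Definition lip_family phi :=
  (forall u, measurable_fun D (phi u)) /\
  forall r : R, exists2 L : R, 0 <= L & forall u v x, `|u| <= r -> `|v| <= r -> D x ->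
    `|phi u x| <= L /\ `|phi u x - phi v x| <= L * `|u - v|.

Definition lip_functional (F : V -> R) := forall r : R, exists2 L : R, 0 <= L &
  forall u v, `|u| <= r -> `|v| <= r -> `|F u - F v| <= L * `|u - v|.

Lemma lip_family_cst (h : T -> R) B : measurable_fun D h ->
  (forall x, D x -> `|h x| <= B) -> lip_family (fun _ => h).
Proof.
move=> mh hB; split=> // r; exists `|B| => // u v x _ _ Dx.
by rewrite subrr normr0 mulr_ge0//; split=> //; rewrite (le_trans (hB _ Dx))// ler_norm.
Qed.

Lemma lip_familyD phi psi : lip_family phi -> lip_family psi ->
  lip_family (fun u x => phi u x + psi u x).
Proof.
move=> [m1 L1] [m2 L2]; split=> [u|r]; first exact: measurable_funD.
have [A A0 PA] := L1 r; have [B B0 PB] := L2 r.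
exists (A + B) => [|u v x ur vr Dx]; first exact: addr_ge0.
have [a1 a2] := PA u v x ur vr Dx; have [b1 b2] := PB u v x ur vr Dx.
split; first by rewrite (le_trans (ler_normD _ _))// lerD.
by rewrite opprD addrACA (le_trans (ler_normD _ _))// mulrDl lerD.
Qed.

Lemma lip_familyM phi psi : lip_family phi -> lip_family psi ->
  lip_family (fun u x => phi u x * psi u x).
Proof.
move=> [m1 L1] [m2 L2]; split=> [u|r]; first exact: measurable_funM.
have [A A0 PA] := L1 r; have [B B0 PB] := L2 r.
exists (2 * (A * B)) => [|u v x ur vr Dx]; first by rewrite !mulr_ge0.
have [a1 a2] := PA u v x ur vr Dx; have [b1 b2] := PB u v x ur vr Dx.
have [b3 _] := PB v v x vr vr Dx.
have AB : 0 <= A * B by exact: mulr_ge0.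
split; first by rewrite normrM (le_trans (ler_pM _ _ a1 b1))//; lra.
have -> : phi u x * psi u x - phi v x * psi v x =
  phi u x * (psi u x - psi v x) + (phi u x - phi v x) * psi v x by ring.
rewrite (le_trans (ler_normD _ _))// !normrM.
apply: le_trans (lerD (ler_pM _ _ a1 b2) (ler_pM _ _ a2 b3)) _ => //.
by rewrite le_eqVlt; apply/orP; left; apply/eqP; ring.
Qed.

Lemma lip_familyN phi : lip_family phi -> lip_family (fun u x => - phi u x).
Proof.
move=> [m1 L1]; split=> [u|r]; first exact: measurable_funN.
have [A A0 PA] := L1 r; exists A => // u v x ur vr Dx.
have [a1 a2] := PA u v x ur vr Dx.
by rewrite normrN -opprD normrN.
Qed.

Lemma lip_family_sum (I : Type) (s : seq I) (phi : I -> V -> T -> R) :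
  (forall i, lip_family (phi i)) -> lip_family (fun u x => \sum_(i <- s) phi i u x).
Proof.
move=> H; elim: s => [|i s ih].
  rewrite (_ : (fun _ => _) = (fun _ => cst 0)).
    by apply: (@lip_family_cst _ 0) => // x _; rewrite normr0.
  by apply/funext => u; apply/funext => x; rewrite big_nil.
rewrite (_ : (fun _ => _) = (fun u x => phi i u x + \sum_(j <- s) phi j u x)).
  exact: lip_familyD.
by apply/funext => u; apply/funext => x; rewrite big_cons.
Qed.

Lemma lip_family_comp p phi : measurable_fun setT p ->
  (forall r : R, exists2 L : R, 0 <= L &
    forall x y, `|x| <= r -> `|y| <= r -> `|p x - p y| <= L * `|x - y|) ->
  lip_family phi -> lip_family (fun u x => p (phi u x)).
Proof.
move=> mp pL [m1 L1]; split=> [u|r]; first exact: measurableT_comp.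
have [A A0 PA] := L1 r; have [L L0 PL] := pL A.
exists (`|p 0| + L * A) => [|u v x ur vr Dx]; first by rewrite addr_ge0// mulr_ge0.
have [a1 a2] := PA u v x ur vr Dx; have [a3 _] := PA v v x vr vr Dx.
have n0 : `|0 : R| <= A by rewrite normr0.
split.
  have := PL _ _ a1 n0; rewrite subr0 => h.
  rewrite -(subrK (p 0) (p (phi u x))) (le_trans (ler_normD _ _))// addrC lerD2l.
  by rewrite (le_trans h)// ler_wpM2l.
apply: (le_trans (PL _ _ a1 a3)); apply: (@le_trans _ _ (L * (A * `|u - v|))).
  by rewrite ler_wpM2l.
by rewrite mulrA ler_wpM2r// lerDr.
Qed.

Lemma lip_family_integrable phi u : lip_family phi -> rintegrable mu D (phi u).
Proof.
move=> [m1 L1]; have [A A0 PA] := L1 `|u|.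
apply: (@rintegrable_bounded _ _ _ _ _ _ A) => // x Dx.
by have [] := PA u u x (lexx _) (lexx _) Dx.
Qed.

Lemma lip_functional_integral phi : lip_family phi ->
  lip_functional (fun u => \int[mu]_(x in D) phi u x).
Proof.
move=> Lphi r; have [m1 L1] := Lphi; have [A A0 PA] := L1 r.
exists (A * fine (mu D)) => [|u v ur vr]; first by rewrite mulr_ge0// fine_ge0.
rewrite -RintegralB//; [|exact: lip_family_integrable..].
rewrite mulrAC -Rintegral_cst//; apply: norm_Rintegral_le => //.
- exact: measurable_funB.
- exact: rintegrable_cst.
- by move=> x Dx; have [] := PA u v x ur vr Dx.
Qed.

Lemma lip_functionalD F G : lip_functional F -> lip_functional G ->
  lip_functional (fun u => F u + G u).
Proof.
move=> LF LG r; have [A A0 PA] := LF r; have [B B0 PB] := LG r.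
exists (A + B) => [|u v ur vr]; first exact: addr_ge0.
rewrite opprD addrACA (le_trans (ler_normD _ _))// mulrDl lerD//; first exact: PA.
exact: PB.
Qed.

Lemma lip_functionalZ a F : lip_functional F -> lip_functional (fun u => a * F u).
Proof.
move=> LF r; have [A A0 PA] := LF r.
exists (`|a| * A) => [|u v ur vr]; first exact: mulr_ge0.
by rewrite -mulrBr normrM -mulrA ler_wpM2l// PA.
Qed.

Lemma lip_functional_sum (I : Type) (s : seq I) (F : I -> V -> R) :
  (forall i, lip_functional (F i)) -> lip_functional (fun u => \sum_(i <- s) F i u).
Proof.
move=> H; elim: s => [|i s ih] r.
  by exists 0 => // u v _ _; rewrite !big_nil subrr normr0 mul0r.
have [L L0 PL] := lip_functionalD (H i) ih r.
by exists L => // u v ur vr; rewrite !big_cons; exact: PL.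
Qed.

End lipschitz_families.

(** * Elements and broken affine functions *)

Lemma mx_entry_le (R : realType) p q (A : 'M[R]_(p, q)) i j : `|A i j| <= `|A|.
Proof.
rewrite [leRHS]mx_normrE.
exact: (le_bigmax _ (fun ij : 'I_p * 'I_q => `|A ij.1 ij.2|) (i, j)).
Qed.

Section elements.
Variables (R : realType) (n : nat) (M : mesh R n).
Implicit Types (k : 'I_(nel M)) (x : 'rV[R]_n.+1).

Definition edges k : 'M[R]_n.+1 := \matrix_(i < n.+1) (vtx k (lift ord0 i) - vtx k ord0).

(** Barycentric coordinates are affine functions of the point; an element is cut out by
inequalities between them. *)
Lemma eltE k : \det (edges k) != 0 ->
  elt k = [set x | (forall j, 0 <= ((x - vtx k ord0) *m invmx (edges k)) ord0 j) /\
                   \sum_j ((x - vtx k ord0) *m invmx (edges k)) ord0 j <= 1].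
Proof.
move=> dk; have uk : edges k \in unitmx by rewrite unitmxE unitfE.
have comb (y : 'rV[R]_n.+1) : y *m edges k = \sum_j y ord0 j *: (vtx k (lift ord0 j) - vtx k ord0).
  by rewrite mulmx_sum_row; apply: eq_bigr => j _; rewrite rowK.
apply/seteqP; split => [x [w [w0 _ w1 ->]]|x [y0 y1]].
  pose y : 'rV[R]_n.+1 := \row_j w (lift ord0 j).
  have E : \sum_i w i *: vtx k i - vtx k ord0 = y *m edges k.
    rewrite comb -{1}[vtx k ord0]scale1r -w1 scaler_suml -sumrB big_ord_recl subrr add0r.
    by apply: eq_bigr => j _; rewrite mxE scalerBr.
  rewrite /= E mulmxK//; split=> [j|]; first by rewrite mxE.
  rewrite -w1 [leRHS]big_ord_recl -[leLHS]add0r lerD// le_eqVlt.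
  by apply/orP; left; apply/eqP; apply: eq_bigr => j _; rewrite mxE.
set y := (x - vtx k ord0) *m invmx (edges k) in y0 y1.
have xE : x = vtx k ord0 + y *m edges k by rewrite mulmxKV// addrC subrK.
exists (fun i => if unlift ord0 i is Some j then y ord0 j else 1 - \sum_j y ord0 j).
split=> [i|i|/=|].
- by case: unliftP => [j|] _ //; rewrite subr_ge0.
- by [].
- rewrite big_ord_recl unlift_none [X in _ + X](eq_bigr (fun j => y ord0 j)) => [|j _].
    by rewrite subrK.
  by rewrite liftK.
- rewrite xE comb [in RHS]big_ord_recl unlift_none scalerBl scale1r -addrA; congr (_ + _).
  rewrite scaler_suml addrC -sumrB; apply: eq_bigr => j _.
  by rewrite liftK scalerBr.
Qed.

Lemma measurable_elt k : \det (edges k) != 0 -> measurable (elt k).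
Proof.
move=> /eltE ->.
have my j : measurable_fun setT
    (fun x : 'rV[R]_n.+1 => ((x - vtx k ord0) *m invmx (edges k)) ord0 j).
  rewrite (_ : (fun x => _) = (fun x : 'rV[R]_n.+1 =>
      \sum_i (x ord0 i - vtx k ord0 ord0 i) * invmx (edges k) i j)).
    apply: measurable_sum => i; apply: measurable_funM => //.
    by apply: measurable_funB => //; exact: measurable_rV_entry.
  by apply/funext => x; rewrite mxE; apply: eq_bigr => i _; rewrite !mxE.
rewrite (_ : [set x | _] = (\bigcap_(j in [set: 'I_n.+1])
    [set x | 0 <= ((x - vtx k ord0) *m invmx (edges k)) ord0 j]) `&`
    [set x | \sum_j ((x - vtx k ord0) *m invmx (edges k)) ord0 j <= 1]); last first.
  by apply/seteqP; split => [x [h1 h2]|x [h1 h2]]; split => // j; [move=> _; exact: h1|exact: h1].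
apply: measurableI.
  by apply: fin_bigcap_measurable => // j _; exact: measurable_le_set.
by apply: measurable_le_set => //; exact: measurable_sum.
Qed.

Lemma interior_elt_ball (rho : R) k : shape_regular M rho -> (elt k)° !=set0.
Proof.
move=> /(_ k) [c [r [r0 cr _]]]; exists c.
apply/nbhs_ballP; exists (r / n.+1%:R) => /=; first by rewrite divr_gt0.
move=> x; rewrite mx_norm_ball /ball_/= => xc; apply: cr.
rewrite /enorm -[leRHS](ger0_norm (ltW r0)) -sqrtr_sqr ler_wsqrtr//.
apply: (@le_trans _ _ (\sum_(i < n.+1) (r / n.+1%:R) ^+ 2)).
  apply: ler_sum => i _; rewrite -[leLHS]ger0_norm ?sqr_ge0// normrX.
  rewrite lerXn2r ?nnegrE//; first by rewrite divr_ge0// ltW.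
  by rewrite (le_trans (row_coord_le _ _))// distrC ltW.
rewrite sumr_const card_ord -[leLHS]mulr_natl expr_div_n mulrCA ler_piMr ?sqr_ge0//.
by rewrite ler_pdivrMr ?exprn_gt0// mul1r expr2 ler_peMr// ler1n.
Qed.

End elements.

Section broken_functions.
Variables (R : realType) (n : nat) (Om : set 'rV[R]_n.+1) (M : mesh R n).
Hypothesis hM : mesh_of M Om.
Hypothesis oOm : open Om.
Hypothesis bOm : bounded_set Om.
Local Notation leb := (rV_lebesgue R n.+1).
Implicit Types (k l : 'I_(nel M)) (v w : brokenP1 M) (x : 'rV[R]_n.+1).

(** Elements lie in the closure of the domain, hence within distance 1 of its points. *)
Lemma domain_bound : exists2 B : R, 0 <= B &
  (forall x, Om x -> `|x| <= B) /\ (forall k x, elt k x -> `|x| <= B).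
Proof.
have [B0 [_ hB]] := bOm.
pose B := Num.max 0 (B0 + 1).
have OmB x : Om x -> `|x| <= B.
  by apply: hB; rewrite /B lt_max ltrDl ltr01 orbT.
have B0' : 0 <= B by rewrite le_max lexx.
exists (B + 1) => [|]; first by rewrite addr_ge0.
split=> [x /OmB h|k x xk]; first by rewrite (le_trans h)// lerDl.
have [_ cov _ _] := hM.
have /(_ (ball x 1)) [] : closure Om x by rewrite -cov; exists k.
  exact: nbhsx_ballx.
move=> y [/OmB yB]; rewrite mx_norm_ball /ball_/= => xy.
by rewrite -(subrK y x) (le_trans (ler_normD _ _))// addrC lerD// ltW.
Qed.

Lemma measurable_domain : measurable Om.
Proof. exact: open_measurable_rV. Qed.

Lemma domain_lty : (leb Om < +oo)%E.
Proof.
have [B _ [OmB _]] := domain_bound.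
exact: (rV_lebesgue_bounded_lty measurable_domain OmB).
Qed.

Lemma measurable_mesh_elt k : measurable (elt k).
Proof. by have [h _ _ _] := hM; exact: (measurable_elt (h k)). Qed.

Lemma mesh_elt_lty k : (leb (elt k) < +oo)%E.
Proof.
have [B _ [_ kB]] := domain_bound.
exact: (rV_lebesgue_bounded_lty (measurable_mesh_elt k) (kB k)).
Qed.

Lemma measurable_interior_elt k : measurable (elt k)°.
Proof. by apply: open_measurable_rV; exact: open_interior. Qed.

Lemma interior_elt_inj k l x : (elt k)° x -> (elt l)° x -> k = l.
Proof.
move=> xk xl; apply/eqP/negPn/negP => kl.
have [_ _ dis _] := hM; have := dis k l kl.
by move/seteqP => [/(_ x) h _]; apply: h.
Qed.

Lemma pw_interior v k x : (elt k)° x -> pw v x = p1 v k x.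
Proof.
move=> xk; rewrite /pw (bigD1 k)//= indicE mem_set// mul1r big1 ?addr0// => l lk.
rewrite indicE memNset ?mul0r// => xl; move: lk.
by rewrite (interior_elt_inj xl xk) eqxx.
Qed.

Lemma pwL a v w x : pw (a *: v + w) x = a * pw v x + pw w x.
Proof.
rewrite /pw mulr_sumr -big_split/=; apply: eq_bigr => k _.
rewrite mulrCA -mulrDr; congr (_ * _).
rewrite /p1 !mxE mulrDr addrACA; congr (_ + _).
rewrite mulr_sumr -big_split/=; apply: eq_bigr => i _.
by rewrite !mxE mulrDl mulrA.
Qed.

Lemma pwgradL a v w i x : pwgrad (a *: v + w) i x = a * pwgrad v i x + pwgrad w i x.
Proof.
rewrite /pwgrad mulr_sumr -big_split/=; apply: eq_bigr => k _.
by rewrite mulrCA -mulrDr !mxE.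
Qed.

Lemma lip_family_entry (D : set 'rV[R]_n.+1) k (j : 'I_n.+2) :
  lip_family D (fun v _ => v k j).
Proof.
split=> [u|r]; first exact: measurable_cst.
exists (Num.max 1 r) => [|u v x ur vr Dx]; first by rewrite le_max ler01.
split; first by rewrite (le_trans (mx_entry_le _ _ _))// (le_trans ur)// le_max lexx orbT.
have := mx_entry_le (u - v) k j; rewrite !mxE => /le_trans; apply.
by rewrite ler_peMl// le_max lexx.
Qed.

Lemma lip_family_indic (D : set 'rV[R]_n.+1) (A : set 'rV[R]_n.+1) : measurable A ->
  lip_family D (fun (v : brokenP1 M) x => \1_A x : R).
Proof.
move=> mA; apply: (@lip_family_cst _ _ _ _ _ _ 1); first exact: measurable_indic.
by move=> x _; rewrite indicE; case: (_ \in _); rewrite ?normr1 ?normr0.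
Qed.

Lemma lip_family_pw (D : set 'rV[R]_n.+1) : (exists B, forall x, D x -> `|x| <= B) ->
  lip_family D (@pw R n M).
Proof.
move=> [B DB]; apply: lip_family_sum => k; apply: lip_familyM.
  by apply: lip_family_indic; exact: measurable_interior_elt.
apply: lip_familyD; first exact: lip_family_entry.
apply: lip_family_sum => i; apply: lip_familyM; first exact: lip_family_entry.
apply: (@lip_family_cst _ _ _ _ _ _ B).
  by apply: measurable_funTS; exact: measurable_rV_entry.
by move=> x Dx; exact: le_trans (row_coord_le _ _) (DB _ Dx).
Qed.

Lemma lip_family_pwgrad (D : set 'rV[R]_n.+1) i :
  lip_family D (fun v : brokenP1 M => pwgrad v i).
Proof.
apply: lip_family_sum => k; apply: lip_familyM; last exact: lip_family_entry.
by apply: lip_family_indic; exact: measurable_interior_elt.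
Qed.

Definition elt_mass k : R := fine (leb (Om `&` (elt k)°)).

Lemma elt_mass_ge0 k : 0 <= elt_mass k.
Proof. by rewrite fine_ge0. Qed.

(** Interiors of distinct elements are disjoint, so the mixed products vanish. *)
Lemma ip_indic_sum (a b : 'I_(nel M) -> R) :
  ip Om (fun x => \sum_k \1_((elt k)°) x * a k) (fun x => \sum_k \1_((elt k)°) x * b k)
  = \sum_k elt_mass k * (a k * b k).
Proof.
have mOm := measurable_domain; rewrite /ip.
have I1 k : rintegrable leb Om (fun x => \1_((elt k)°) x).
  apply: (@rintegrable_bounded _ _ _ _ _ _ 1) => //; first exact: domain_lty.
    apply: measurable_indic; exact: measurable_interior_elt.
  by move=> x _; rewrite indicE; case: (_ \in _); rewrite ?normr1 ?normr0.
transitivity (\int[leb]_(x in Om) (\sum_k (a k * b k) * \1_((elt k)°) x)).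
  apply: eq_Rintegral => x _.
  have [[k xk]|nx] := pselect (exists k, (elt k)° x); last first.
    rewrite !big1 ?mul0r// => k _; rewrite indicE memNset ?mul0r ?mulr0// => xk;
      by apply: nx; exists k.
  have off l : l != k -> \1_((elt l)°) x = 0 :> R.
    move=> lk; rewrite indicE memNset// => xl; move: lk.
    by rewrite (interior_elt_inj xl xk) eqxx.
  have on : \1_((elt k)°) x = 1 :> R by rewrite indicE mem_set.
  have pick (c : 'I_(nel M) -> R) : \sum_l \1_((elt l)°) x * c l = c k.
    by rewrite (bigD1 k)//= on mul1r big1 ?addr0// => l lk; rewrite off// mul0r.
  rewrite !pick -(pick (fun k => a k * b k)); apply: eq_bigr => l _; exact: mulrC.
rewrite Rintegral_sum//; last by move=> k _; exact: rintegrableZ.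
apply: eq_bigr => k _; rewrite RintegralZl//; last exact: I1.
rewrite mulrC; congr (_ * _).
rewrite /Rintegral integral_indic//; last exact: measurable_interior_elt.
by rewrite setIC.
Qed.

End broken_functions.

(** * The Crouzeix-Raviart space and its inner product *)

Section face_conditions.
Variables (R : realType) (n : nat) (Om : set 'rV[R]_n.+1) (M : mesh R n).
Implicit Types (k : 'I_(nel M)) (v w : brokenP1 M).
Local Notation lebn := (rV_lebesgue R n).

Lemma p1L a v w k x : p1 (a *: v + w) k x = a * p1 v k x + p1 w k x.
Proof.
rewrite /p1 !mxE mulrDr addrACA; congr (_ + _).
rewrite mulr_sumr -big_split/=; apply: eq_bigr => i _.
by rewrite !mxE mulrDl mulrA.
Qed.

Lemma measurable_ref_simplex : measurable (@ref_simplex R n).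
Proof.
rewrite (_ : @ref_simplex R n = (\bigcap_(j in [set: 'I_n]) [set y | 0 <= y ord0 j]) `&`
    [set y | \sum_(j < n) y ord0 j <= 1]); last first.
  by apply/seteqP; split => [x [h1 h2]|x [h1 h2]]; split => // j; [move=> _; exact: h1|exact: h1].
apply: measurableI.
  apply: fin_bigcap_measurable => // j _; apply: measurable_le_set => //; exact: measurable_rV_entry.
by apply: measurable_le_set => //; apply: measurable_sum => j; exact: measurable_rV_entry.
Qed.

Lemma ref_simplex_coord (y : 'rV[R]_n) j : ref_simplex y -> `|y ord0 j| <= 1.
Proof.
move=> [y0 y1]; rewrite ger0_norm// (le_trans _ y1)// (bigD1 j)//= lerDl.
by apply: sumr_ge0.
Qed.

Lemma ref_simplex_lty : (lebn (@ref_simplex R n) < +oo)%E.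
Proof.
apply: (rV_lebesgue_bounded_lty (B := 1) measurable_ref_simplex) => y yr.
by apply: row_norm_le => // j; exact: ref_simplex_coord.
Qed.

Lemma rintegrable_face (c : 'rV[R]_n.+1) (J : 'M[R]_(n, n.+1)) v k :
  rintegrable lebn (@ref_simplex R n) (fun y => p1 v k (c + y *m J)).
Proof.
have ms := measurable_ref_simplex.
have fs := ref_simplex_lty.
have Iy j : rintegrable lebn (@ref_simplex R n) (fun y => y ord0 j).
  apply: (@rintegrable_bounded _ _ _ _ _ _ 1) => //.
    by apply: measurable_funTS; exact: measurable_rV_entry.
  by move=> y; exact: ref_simplex_coord.
have Icst r : rintegrable lebn (@ref_simplex R n) (fun=> r) by exact: rintegrable_cst.
apply: (@eq_rintegrable _ _ _ _ _ (fun y : 'rV[R]_n => v k ord0 + \sum_(i < n.+1)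
    v k (lift ord0 i) * (c ord0 i + \sum_j J j i * y ord0 j))) => //.
  move=> y _; rewrite /p1; congr (_ + _); apply: eq_bigr => i _.
  by rewrite !mxE; congr (_ * (_ + _)); apply: eq_bigr => j _; rewrite mulrC.
apply: rintegrableD => //; apply: rintegrable_sum => // i _; apply: rintegrableZ => //.
apply: rintegrableD => //; apply: rintegrable_sum => // j _; exact: rintegrableZ.
Qed.

Lemma CR0 : CR Om (0 : brokenP1 M).
Proof.
have p10 k x : p1 (0 : brokenP1 M) k x = 0.
  by rewrite /p1 mxE big1 ?addr0// => i _; rewrite mxE mul0r.
split=> [k l i j _ _|k i _]; rewrite /face_integral.
  under eq_Rintegral do rewrite !p10 subrr.
  by rewrite Rintegral_cst ?mul0r ?mulr0//; exact: measurable_ref_simplex.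
under eq_Rintegral do rewrite p10.
by rewrite Rintegral_cst ?mul0r ?mulr0//; exact: measurable_ref_simplex.
Qed.

Lemma CRL a v w : CR Om v -> CR Om w -> CR Om (a *: v + w).
Proof.
have ms := measurable_ref_simplex.
move=> [v1 v2] [w1 w2]; split=> [k l i j kl kil|k i ki].
  have := v1 k l i j kl kil; have := w1 k l i j kl kil.
  rewrite /face_integral; set c := vtx _ _; set J := \matrix_(_ < _) _.
  have Iv u : rintegrable lebn (@ref_simplex R n)
      (fun y => p1 u k (c + y *m J) - p1 u l (c + y *m J)).
    by apply: rintegrableB => //; exact: rintegrable_face.
  move=> Ew Ev.
  transitivity (a * 0 + 0 : R); last by rewrite mulr0 addr0.
  rewrite -[X in a * X]Ev -[X in _ = _ + X]Ew mulrCA -mulrDr; congr (_ * _).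
  rewrite -RintegralZl; [|exact: ms|exact: Iv].
  rewrite -RintegralD; [|exact: ms|by apply: rintegrableZ => //; exact: Iv|exact: Iv].
  by apply: eq_Rintegral => y _; rewrite !p1L; ring.
have := v2 k i ki; have := w2 k i ki.
rewrite /face_integral; set c := vtx _ _; set J := \matrix_(_ < _) _.
have Iv u := rintegrable_face c J u k.
move=> Ew Ev; transitivity (a * 0 + 0 : R); last by rewrite mulr0 addr0.
rewrite -[X in a * X]Ev -[X in _ = _ + X]Ew mulrCA -mulrDr; congr (_ * _).
rewrite -RintegralZl; [|exact: ms|exact: Iv].
rewrite -RintegralD; [|exact: ms|by apply: rintegrableZ => //; exact: Iv|exact: Iv].
by apply: eq_Rintegral => y _; rewrite !p1L.
Qed.

End face_conditions.

Section forms.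
Variables (R : realType) (n : nat) (Om : set 'rV[R]_n.+1) (M : mesh R n).
Hypothesis hM : mesh_of M Om.
Hypothesis oOm : open Om.
Hypothesis bOm : bounded_set Om.
Local Notation leb := (rV_lebesgue R n.+1).
Implicit Types (k l : 'I_(nel M)) (u v w : brokenP1 M) (x : 'rV[R]_n.+1).

Let mOm : measurable Om. Proof. exact: measurable_domain oOm. Qed.
Let fOm : (leb Om < +oo)%E. Proof. exact: (domain_lty hM oOm bOm). Qed.

Lemma lip_pw_domain : lip_family Om (@pw R n M).
Proof.
have [B _ [OB _]] := domain_bound hM bOm.
by apply: lip_family_pw; exists B.
Qed.

Lemma lip_pw_elt k : lip_family (elt k) (@pw R n M).
Proof.
have [B _ [_ kB]] := domain_bound hM bOm.
by apply: lip_family_pw; exists B; exact: kB.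
Qed.

Lemma lip_family_fix (D : set 'rV[R]_n.+1) (phi : brokenP1 M -> 'rV[R]_n.+1 -> R) v :
  lip_family D phi -> lip_family D (fun _ : brokenP1 M => phi v).
Proof.
move=> [m1 L1]; have [B _ PB] := L1 `|v|.
apply: (@lip_family_cst _ _ _ _ _ _ B) => // x Dx.
by have [] := PB v v x (lexx _) (lexx _) Dx.
Qed.

Lemma rintegrableM_lip (D : set 'rV[R]_n.+1) (h : 'rV[R]_n.+1 -> R)
    (phi : brokenP1 M -> 'rV[R]_n.+1 -> R) v : measurable D ->
  lip_family D phi -> rintegrable leb D h -> rintegrable leb D (fun x => h x * phi v x).
Proof.
move=> mD [m1 L1] Ih; have [B _ PB] := L1 `|v|.
apply: (@rintegrableM_bounded _ _ _ _ _ _ _ B) => // x Dx.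
by have [] := PB v v x (lexx _) (lexx _) Dx.
Qed.

Lemma rintegrable_pw v : rintegrable leb Om (pw v).
Proof. exact: (lip_family_integrable mOm fOm v lip_pw_domain). Qed.

Lemma rintegrable_pwgrad v i : rintegrable leb Om (pwgrad v i).
Proof. exact: (lip_family_integrable mOm fOm v (lip_family_pwgrad _ Om i)). Qed.

Lemma ip_pwL (h : 'rV[R]_n.+1 -> R) a v w : rintegrable leb Om h ->
  ip Om h (pw (a *: v + w)) = a * ip Om h (pw v) + ip Om h (pw w).
Proof.
move=> Ih; have Ihv u := rintegrableM_lip u mOm lip_pw_domain Ih.
rewrite /ip -RintegralZl; [|exact: mOm|exact: Ihv].
rewrite -RintegralD; [|exact: mOm|by apply: rintegrableZ => //; exact: Ihv|exact: Ihv].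
by apply: eq_Rintegral => x _; rewrite pwL; ring.
Qed.

Lemma ip_pwgradL (h : 'rV[R]_n.+1 -> R) a v w i : rintegrable leb Om h ->
  ip Om h (pwgrad (a *: v + w) i) = a * ip Om h (pwgrad v i) + ip Om h (pwgrad w i).
Proof.
move=> Ih; have Ihv u := rintegrableM_lip u mOm (lip_family_pwgrad _ Om i) Ih.
rewrite /ip -RintegralZl; [|exact: mOm|exact: Ihv].
rewrite -RintegralD; [|exact: mOm|by apply: rintegrableZ => //; exact: Ihv|exact: Ihv].
by apply: eq_Rintegral => x _; rewrite pwgradL; ring.
Qed.

Lemma ipC (g h : 'rV[R]_n.+1 -> R) : ip Om g h = ip Om h g.
Proof. by apply: eq_Rintegral => x _; rewrite mulrC. Qed.

(** An affine function that vanishes on a nonempty open set has zero slopes, as small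
moves along the axes show, and then a zero constant term. *)
Lemma affine_nonzero k v (U : set 'rV[R]_n.+1) j : open U -> U !=set0 ->
  v k j != 0 -> exists2 x, U x & p1 v k x != 0.
Proof.
move=> oU [x0 Ux0] vkj; apply: contrapT => /forall2NP h.
have p0 x : U x -> p1 v k x = 0.
  by move=> Ux; apply/eqP/negPn/negP => px; have [] := h x.
have [r r0 xr] := open_cube oU Ux0.
have slope i : v k (lift ord0 i) = 0.
  pose x1 := x0 + (r / 2) *: delta_mx ord0 i.
  have Ux1 : U x1.
    apply: xr => i'; rewrite /x1 !mxE addrAC subrr add0r eqxx/=.
    have r2 : `|r / 2| < r by rewrite gtr0_norm; lra.
    by case: (i' == i); rewrite ?mulr1// mulr0 normr0.
  have : p1 v k x1 - p1 v k x0 = 0 by rewrite !p0// subrr.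
  rewrite /p1 opprD addrACA subrr add0r -sumrB (bigD1 i)//= big1 => [|i' ii'].
    rewrite addr0 /x1 !mxE !eqxx mulr1 -mulrBr addrAC subrr add0r => /eqP.
    by rewrite mulf_eq0 => /orP[/eqP//|]; rewrite gt_eqF//; lra.
  by rewrite /x1 !mxE (negbTE ii') andbF mulr0 addr0 subrr.
have v0 : v k ord0 = 0.
  have := p0 _ Ux0; rewrite /p1 big1 ?addr0// => i _.
  by rewrite slope mul0r.
move: vkj; case: (unliftP ord0 j) => [i|] ->; first by rewrite slope eqxx.
by rewrite v0 eqxx.
Qed.

(** The interior of an element is open and contained in the closure of the domain. *)
Lemma interior_meets_domain k : (elt k)° !=set0 -> (Om `&` (elt k)°) !=set0.
Proof.
move=> [x xk]; have [_ cov _ _] := hM.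
have : closure Om x by rewrite -cov; exists k => //; exact: interior_subset xk.
by move=> /(_ (elt k)°) [|y [? ?]]; [exact: open_nbhs_nbhs (conj (open_interior _) xk)|exists y].
Qed.

(** A nonzero [v] has a nonzero coefficient on some element, hence a point inside that
element and the domain where it does not vanish; it keeps half of its absolute value on
a small cube, which has positive volume. *)
Lemma ip_pw_gt0 (rho : R) v : shape_regular M rho -> v != 0 -> 0 < ip Om (pw v) (pw v).
Proof.
move=> hrho v0.
have [k [j vkj]] : exists k j, v k j != 0.
  apply: contrapT => h; move/eqP : v0; apply; apply/matrixP => k j; rewrite mxE.
  by apply/eqP/negPn/negP => vkj; apply: h; exists k, j.
pose U := Om `&` (elt k)°.
have oU : open U by apply: openI => //; exact: open_interior.
have U0 : U !=set0 by apply: interior_meets_domain; exact: interior_elt_ball hrho.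
have [x0 Ux0 a0] := affine_nonzero oU U0 vkj.
set a := p1 v k x0 in a0.
have [r r0 xr] := open_cube oU Ux0.
pose S := 1 + \sum_(i < n.+1) `|v k (lift ord0 i)|.
have S0 : 0 < S by rewrite ltr_pwDl// sumr_ge0.
have aa : 0 < `|a| by rewrite normr_gt0.
(* On a cube of radius [r1] the function varies by at most [S * r1 <= |a| / 2]. *)
pose r1 := Num.min r (`|a| / (2 * S)).
have r10 : 0 < r1 by rewrite lt_min r0 divr_gt0// mulr_gt0.
have QU x : cube x0 r1 x -> U x.
  by move=> xc; apply: xr => i; rewrite (lt_le_trans (xc i))// ge_min lexx.
have lowb x : cube x0 r1 x -> (`|a| / 2) ^+ 2 <= pw v x * pw v x.
  move=> xc; have [_ xk] := QU _ xc; rewrite (pw_interior hM v xk) -expr2.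
  have d : `|p1 v k x - a| <= `|a| / 2.
    rewrite /a /p1 opprD addrACA subrr add0r -sumrB (le_trans (ler_norm_sum _ _ _))//.
    apply: (@le_trans _ _ (\sum_(i < n.+1) `|v k (lift ord0 i)| * r1)).
      apply: ler_sum => i _; rewrite -mulrBr normrM ler_wpM2l// ltW//; exact: xc.
    rewrite -mulr_suml; apply: (@le_trans _ _ (S * r1)).
      by rewrite ler_wpM2r ?(ltW r10)// /S lerDr.
    apply: (@le_trans _ _ (S * (`|a| / (2 * S)))).
      by rewrite ler_wpM2l ?(ltW S0)// ge_min lexx orbT.
    by rewrite le_eqVlt; apply/orP; left; apply/eqP; field; exact: lt0r_neq0.
  rewrite -[leRHS]ger0_norm ?sqr_ge0// normrX lerXn2r ?nnegrE ?divr_ge0//.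
  have h : `|a| <= `|p1 v k x| + `|p1 v k x - a|.
    rewrite (distrC _ a) -[X in `|X| <= _](subrKC (p1 v k x)) ler_normD//.
  by rewrite -lerBlDr in h; apply: le_trans h; lra.
have mQ := measurable_cube x0 r1.
have Ipp : rintegrable leb Om (fun x => pw v x * pw v x).
  exact: rintegrableM_lip mOm lip_pw_domain (rintegrable_pw v).
have QOm : cube x0 r1 `<=` Om by move=> x /QU[].
have Q_lty : (leb (cube x0 r1) < +oo)%E by rewrite rV_lebesgue_cube// ltry.
apply: (@lt_le_trans _ _ (\int[leb]_(x in cube x0 r1) ((`|a| / 2) ^+ 2))).
  rewrite Rintegral_cst//; apply: mulr_gt0; first by rewrite exprn_gt0// divr_gt0.
  have : 0 < fine (leb (cube x0 r1)) by rewrite rV_lebesgue_cube//= exprn_gt0// mulr_gt0.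
  exact.
apply: (@le_trans _ _ (\int[leb]_(x in cube x0 r1) (pw v x * pw v x))).
  apply: le_Rintegral => //; first exact: rintegrable_cst.
  exact: integrableS Ipp.
apply: ge0_subset_Rintegral => // x _; rewrite -expr2; exact: sqr_ge0.
Qed.

End forms.

(** * The spatial form *)

Section spatial_form.
Variables (R : realType) (n : nat) (Om : set 'rV[R]_n.+1) (M : mesh R n).
Hypothesis hM : mesh_of M Om.
Hypothesis oOm : open Om.
Hypothesis bOm : bounded_set Om.
Variables (alpha delta beta gamma nu : R) (pow : R -> R).
Hypothesis delta1 : 1 <= delta.
Hypothesis hpow : real_power delta pow.
Local Notation leb := (rV_lebesgue R n.+1).
Implicit Types (k l : 'I_(nel M)) (u v w : brokenP1 M) (x : 'rV[R]_n.+1).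
Local Notation A := (@A_CR R n Om M alpha delta beta gamma nu pow).

Let mOm : measurable Om. Proof. exact: measurable_domain oOm. Qed.
Let fOm : (leb Om < +oo)%E. Proof. exact: (domain_lty hM oOm bOm). Qed.

Lemma lip_pow (D : set 'rV[R]_n.+1) : lip_family D (@pw R n M) ->
  lip_family D (fun u x => pow (pw u x)).
Proof.
by apply: lip_family_comp (measurable_real_power hpow) (real_power_lipschitz delta1 hpow).
Qed.

Lemma lip_reaction : lip_family Om (fun u : brokenP1 M => reaction gamma pow (pw u)).
Proof.
have Lpw := lip_pw_domain hM bOm.
have Lp := lip_pow Lpw.
have Lc r : lip_family Om (fun (_ : brokenP1 M) (_ : 'rV[R]_n.+1) => r).
  by apply: (@lip_family_cst _ _ _ _ _ _ `|r|).
exact: (lip_familyM (lip_familyM Lpw (lip_familyD (Lc 1) (lip_familyN Lp)))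
  (lip_familyD Lp (lip_familyN (Lc gamma)))).
Qed.

Let lip_convection k (phi : brokenP1 M -> 'I_n.+1 -> 'rV[R]_n.+1 -> R)
    (chi : brokenP1 M -> 'rV[R]_n.+1 -> R) :
  (forall i, lip_family (elt k) (fun u => phi u i)) -> lip_family (elt k) chi ->
  lip_family (elt k) (fun u x => pow (pw u x) * (\sum_(i < n.+1) phi u i x) * chi u x).
Proof.
move=> Lphi Lchi; apply: lip_familyM => //; apply: lip_familyM.
  exact/lip_pow/(lip_pw_elt hM bOm).
exact: lip_family_sum.
Qed.

Lemma lip_A_CR chi : lip_functional (fun u => A u chi).
Proof.
rewrite /A_CR; apply: lip_functionalD; first apply: lip_functionalD.
- apply: lip_functionalZ; apply: lip_functional_sum => i.
  apply: lip_functional_integral => //; apply: lip_familyM; first exact: lip_family_pwgrad.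
  by apply: (lip_family_fix chi (phi := fun v => pwgrad v i)); exact: lip_family_pwgrad.
- apply: lip_functionalZ; rewrite /b_CR.
  have Lg k i : lip_family (elt k) (fun v : brokenP1 M => pwgrad v i) by exact: lip_family_pwgrad.
  have Lpw k := lip_pw_elt hM bOm k.
  apply: lip_functionalD.
    apply: lip_functionalZ; apply: lip_functional_sum => k.
    apply: lip_functional_integral; [exact: (measurable_mesh_elt hM)|exact: (mesh_elt_lty hM bOm)|].
    by apply: (lip_convection (phi := fun v i => pwgrad v i)) => //; exact: lip_family_fix.
  rewrite (_ : (fun _ => _) = (fun u : brokenP1 M => -1 * ((delta + 2)^-1 *
    ip_mesh M (fun x => pow (pw u x) * \sum_(i < n.+1) pwgrad chi i x) (pw u)))); last first.
    by apply/funext => u; rewrite mulN1r.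
  apply: lip_functionalZ; apply: lip_functionalZ; apply: lip_functional_sum => k.
  apply: lip_functional_integral; [exact: (measurable_mesh_elt hM)|exact: (mesh_elt_lty hM bOm)|].
  apply: (lip_convection (phi := fun _ i => pwgrad chi i)) => // i.
  exact: (lip_family_fix chi (Lg k i)).
- rewrite (_ : (fun _ => _) = (fun u : brokenP1 M => -1 * (beta *
    ip Om (reaction gamma pow (pw u)) (pw chi)))); last first.
    by apply/funext => u; rewrite mulN1r.
  apply: lip_functionalZ; apply: lip_functionalZ.
  apply: lip_functional_integral => //; apply: lip_familyM; first exact: lip_reaction.
  exact: lip_family_fix (lip_pw_domain hM bOm).
Qed.

Lemma A_CRL u a v w : A u (a *: v + w) = a * A u v + A u w.
Proof.
have Ea : a_CR Om u (a *: v + w) = a * a_CR Om u v + a_CR Om u w.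
  rewrite /a_CR mulr_sumr -big_split/=; apply: eq_bigr => i _.
  apply: ip_pwgradL => //; exact: rintegrable_pwgrad.
have Er : ip Om (reaction gamma pow (pw u)) (pw (a *: v + w)) =
    a * ip Om (reaction gamma pow (pw u)) (pw v) + ip Om (reaction gamma pow (pw u)) (pw w).
  by apply: ip_pwL => //; exact: (lip_family_integrable mOm fOm u lip_reaction).
have Eb : b_CR delta pow u (a *: v + w) = a * b_CR delta pow u v + b_CR delta pow u w.
  have Lg k i : lip_family (elt k) (fun v : brokenP1 M => pwgrad v i) by exact: lip_family_pwgrad.
  have Lpw k := lip_pw_elt hM bOm k.
  have mk k := measurable_mesh_elt hM k.
  have fk k := mesh_elt_lty hM bOm k.
  pose b1 (z : brokenP1 M) := ip_mesh M (fun x => pow (pw u x) * \sum_(i < n.+1) pwgrad u i x) (pw z).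
  pose b2 (z : brokenP1 M) := ip_mesh M (fun x => pow (pw u x) * \sum_(i < n.+1) pwgrad z i x) (pw u).
  have E1 : b1 (a *: v + w) = a * b1 v + b1 w.
    rewrite /b1 /ip_mesh mulr_sumr -big_split/=; apply: eq_bigr => k _.
    have I1 (z : brokenP1 M) : rintegrable leb (elt k)
        (fun x => pow (pw u x) * (\sum_(i < n.+1) pwgrad u i x) * pw z x).
      have L := lip_convection (phi := fun v i => pwgrad v i) (Lg k)
        (lip_family_fix z (Lpw k)).
      exact: (lip_family_integrable (mk k) (fk k) u L).
    rewrite -RintegralZl; [|exact: mk|exact: I1].
    rewrite -RintegralD; [|exact: mk|by apply: rintegrableZ => //; exact: I1|exact: I1].
    by apply: eq_Rintegral => x _; rewrite pwL; ring.
  have E2 : b2 (a *: v + w) = a * b2 v + b2 w.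
    rewrite /b2 /ip_mesh mulr_sumr -big_split/=; apply: eq_bigr => k _.
    have I2 (z : brokenP1 M) : rintegrable leb (elt k)
        (fun x => pow (pw u x) * (\sum_(i < n.+1) pwgrad z i x) * pw u x).
      have L := lip_convection (phi := fun _ i => pwgrad z i)
        (fun i => lip_family_fix z (Lg k i)) (Lpw k).
      exact: (lip_family_integrable (mk k) (fk k) u L).
    rewrite -RintegralZl; [|exact: mk|exact: I2].
    rewrite -RintegralD; [|exact: mk|by apply: rintegrableZ => //; exact: I2|exact: I2].
    apply: eq_Rintegral => x _.
    have -> : \sum_(i < n.+1) pwgrad (a *: v + w) i x =
        a * \sum_(i < n.+1) pwgrad v i x + \sum_(i < n.+1) pwgrad w i x.
      by rewrite mulr_sumr -big_split/=; apply: eq_bigr => i _; rewrite pwgradL.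
    by ring.
  rewrite /b_CR -/(b1 _) -/(b2 _) -/(b1 v) -/(b2 v) -/(b1 w) -/(b2 w) E1 E2; ring.
rewrite /A_CR Ea Eb Er; ring.
Qed.

(** The convection form vanishes on the diagonal, the diffusion is nonnegative, and
[(1 - p) (p - gamma)] is at most [(1 - gamma)^2 / 4], its value at the midpoint of the
roots. *)
Lemma A_CR_coercive u : 0 <= nu -> 0 <= beta ->
  - A u u <= beta * ((1 - gamma) ^+ 2 / 4) * ip Om (pw u) (pw u).
Proof.
move=> nu0 beta0.
have b0 : b_CR delta pow u u = 0 by rewrite /b_CR subrr.
have a0 : 0 <= a_CR Om u u.
  apply: sumr_ge0 => i _; apply: Rintegral_ge0 => x _; rewrite -expr2; exact: sqr_ge0.
rewrite /A_CR b0 mulr0 addr0 opprB lerBlDr.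
apply: (@le_trans _ _ (beta * ((1 - gamma) ^+ 2 / 4) * ip Om (pw u) (pw u))); last first.
  by rewrite lerDl mulr_ge0.
rewrite -mulrA ler_wpM2l// /ip.
have Ipp : rintegrable leb Om (fun x => pw u x * pw u x).
  exact: rintegrableM_lip mOm (lip_pw_domain hM bOm) (rintegrable_pw hM oOm bOm u).
rewrite -RintegralZl//; apply: le_Rintegral => //.
- exact: (lip_family_integrable mOm fOm u (lip_familyM lip_reaction (lip_pw_domain hM bOm))).
- exact: rintegrableZ.
- move=> x _; rewrite /reaction; move: (pw u x) (pow _) => s p.
  have -> : s * (1 - p) * (p - gamma) * s = (1 - p) * (p - gamma) * (s * s) by ring.
  rewrite ler_wpM2r// ?sqr_ge0// -?expr2 ?sqr_ge0//.
  by have := sqr_ge0 (p - (1 + gamma) / 2); nra.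
Qed.

(** Broken gradients are constant on each element, so the memory splits into scalar
convolutions weighted by the measures of the elements. *)
Lemma memory_form (T : R) (K : R -> R) (z : R -> brokenP1 M) chi (t B : R) :
  rintegrable (@lebesgue_measure R) `]0, T[ K -> 0 < t <= T ->
  (forall k j, measurable_fun setT (fun s => z s k j)) ->
  (forall k j s, `|z s k j| <= B) ->
  \sum_(i < n.+1) ip Om (fun x => kernel_conv K (fun s => pwgrad (z s) i x) t) (pwgrad chi i)
  = \sum_(q : 'I_(nel M) * 'I_n.+1) elt_mass Om q.1 * chi q.1 (lift ord0 q.2) *
      kernel_conv K (fun s => z s q.1 (lift ord0 q.2)) t.
Proof.
move=> IK tT mz zB.
rewrite -(pair_bigA _ (fun k i => elt_mass Om k * chi k (lift ord0 i) *
      kernel_conv K (fun s => z s k (lift ord0 i)) t))/= exchange_big/=.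
apply: eq_bigr => i _.
rewrite (_ : (fun x => kernel_conv K _ t) = (fun x => \sum_k \1_((elt k)°) x *
    kernel_conv K (fun s => z s k (lift ord0 i)) t)); last first.
  by apply/funext => x; rewrite -(kernel_conv_sum IK _ tT (fun k => mz k _) (fun k => zB k _)).
rewrite (ip_indic_sum hM oOm bOm); apply: eq_bigr => k _; ring.
Qed.

End spatial_form.

(** * The forcing *)

Section forcing.
Variables (R : realType) (n : nat) (Om : set 'rV[R]_n.+1) (M : mesh R n).
Hypothesis hM : mesh_of M Om.
Hypothesis oOm : open Om.
Hypothesis bOm : bounded_set Om.
Variables (T : R) (f : R -> 'rV[R]_n.+1 -> R).
Local Notation mu := (@lebesgue_measure R).
Local Notation leb := (rV_lebesgue R n.+1).
Hypothesis hf : memLp (mu \x leb)%E 2 (`]0, T[ `*` Om) (fun z => f z.1 z.2).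

Let mOm : measurable Om. Proof. exact: measurable_domain oOm. Qed.
Let fOm : (leb Om < +oo)%E. Proof. exact: (domain_lty hM oOm bOm). Qed.

Let D : set (measurableTypeR R * 'rV[R]_n.+1) := `]0, T[%classic `*` Om.
Let mD : measurable D. Proof. exact: measurableX. Qed.

Let muT : (mu `]0%R, T[ < +oo)%E.
Proof. exact: lebesgue_itvoo_lty. Qed.

Let fD : ((mu \x leb)%E D < +oo)%E.
Proof.
rewrite /D product_measure1E//; apply: lte_mul_pinfty => //.
by rewrite ge0_fin_numE.
Qed.

Let If : rintegrable (mu \x leb)%E D (fun z => f z.1 z.2).
Proof.
have [mf f2] := hf.
have If2 : rintegrable (mu \x leb)%E D (fun z => `|f z.1 z.2| `^ 2).
  apply/integrableP; split.
    apply/measurable_EFinP; apply: (measurableT_comp (measurable_powR 2)).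
    exact: measurableT_comp.
  apply: le_lt_trans f2; apply: ge0_le_integral => //.
  - apply/measurable_EFinP; apply: measurableT_comp => //.
    by apply: (measurableT_comp (measurable_powR 2)); exact: measurableT_comp.
  - apply/measurable_EFinP.
    by apply: (measurableT_comp (measurable_powR 2)); exact: measurableT_comp.
  - by move=> z _; rewrite /= ger0_norm ?powR_ge0.
apply: (@rintegrableW _ _ _ _ _ _
  (fun z : measurableTypeR R * 'rV[R]_n.+1 => 1 + `|f z.1 z.2| `^ 2)) => //.
  move=> z _; rewrite powR_mulrn//; move: `|_| (normr_ge0 (f z.1 z.2)) => a a0.
  by have := sqr_ge0 (a - 1); nra.
by apply: rintegrableD => //; exact: rintegrable_cst.
Qed.

Let h := (fun z : measurableTypeR R * 'rV[R]_n.+1 => f z.1 z.2) \_ D.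

Let Ih : rintegrable (mu \x leb)%E setT h.
Proof. by apply: (rintegrable_patch _ _ _).1. Qed.

Let hE t : 0 < t < T -> (fun x => h (t, x)) = (f t \_ Om).
Proof.
move=> tT; apply/funext => x; rewrite /h !patchE.
have -> : ((t, x) \in D) = (x \in Om).
  by apply/idP/idP; rewrite !inE /D/= in_itv/= tT; [case|].
by [].
Qed.

(** Needed because Fubini's theorem yields an extended-valued marginal, finite only almost
everywhere. *)
Lemma rintegrable_fine d (S : measurableType d) (m : {measure set S -> \bar R})
    (G : S -> \bar R) (E : set S) : measurable E ->
  m.-integrable E G -> rintegrable m E (fun t => fine (G t)).
Proof.
move=> mE IG; have mG := measurable_int _ IG; apply: le_integrable IG => //.
  apply/measurable_EFinP; apply: (measurable_comp measurableT _ (fine_measurable measurableT)) => //.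
by move=> x _ /=; case: (G x) => [r| |] //=; rewrite normr0 leey.
Qed.

Lemma forcing_integrable_ae :
  {ae mu, forall t, 0 < t < T -> rintegrable leb Om (f t)}.
Proof.
have aeF := lebesgue_ae_filter R.
have := ae_integrable1 Ih; apply: (@filterS _ _ aeF) => t It tT.
by apply/(rintegrable_patch leb (f t) mOm); rewrite -hE.
Qed.

(** A square integrable function on a set of finite measure is integrable, and pairing it
with a bounded function and applying Fubini leaves an integrable function of time. *)
Lemma rintegrable_forcing (v : brokenP1 M) :
  rintegrable mu `]0, T[ (fun t => ip Om (f t) (pw v)).
Proof.
have [mpw LB] := lip_family_fix v (lip_pw_domain hM bOm).
have [B _ PB] := LB 0.
pose p := (pw v) \_ Om.
have mp : measurable_fun setT p by apply/(measurable_restrictT _ mOm); exact: (mpw 0).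
have pB x : `|p x| <= `|B|.
  rewrite /p patchE; case: ifPn => [/set_mem Ox|_]; last by rewrite normr0.
  have [] := PB 0 0 x _ _ Ox; rewrite ?normr0// => hh _.
  by rewrite (le_trans hh)// ler_norm.
have Ihp : (mu \x leb)%E.-integrable setT (EFin \o (fun z => h z * p z.2)).
  apply: (@rintegrableM_bounded _ _ _ _ _ _ _ `|B|) => //.
    exact: (measurableT_comp mp).
have IG := integrable_fubini_F Ihp.
have IG' : rintegrable mu `]0, T[ (fun t => fine (fubini_F leb (EFin \o (fun z => h z * p z.2)) t)).
  by apply: integrableS (rintegrable_fine _ IG).
apply: eq_rintegrable IG' => // t; rewrite inE/= in_itv/= => tT.
rewrite /ip Rintegral_mkcond /fubini_F /Rintegral; congr fine; apply: eq_integral => x _ /=.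
have := congr1 (@^~ x) (hE tT) => /= ->.
by rewrite /p !patchE; case: ifP => // _; rewrite mul0r.
Qed.

End forcing.

(** * The scheme in coordinates *)

Lemma linear_form_sum (R : realType) (V : lmodType R) (F : V -> R) (I : Type)
    (s : seq I) (a : I -> R) (e : I -> V) :
  (forall r u v, F (r *: u + v) = r * F u + F v) ->
  F (\sum_(i <- s) a i *: e i) = \sum_(i <- s) a i * F (e i).
Proof.
move=> FL; elim: s => [|i s ih]; last by rewrite !big_cons FL ih.
rewrite !big_nil; have := FL 1 0 0; rewrite scale1r addr0 mul1r => /eqP.
by rewrite -subr_eq0 opprD addNKr oppr_eq0 => /eqP.
Qed.

Section galerkin.
Variables (R : realType) (n : nat) (Om : set 'rV[R]_n.+1) (M : mesh R n).
Hypothesis hM : mesh_of M Om.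
Hypothesis oOm : open Om.
Hypothesis bOm : bounded_set Om.
Variables (T alpha delta beta gamma nu eta : R) (pow K : R -> R).
Hypothesis T0 : 0 < T.
Hypothesis delta1 : 1 <= delta.
Hypothesis beta0 : 0 < beta.
Hypothesis nu0 : 0 < nu.
Hypothesis eta0 : 0 <= eta.
Hypothesis hpow : real_power delta pow.
Hypothesis hK : positive_kernel T K.
Variable f : R -> 'rV[R]_n.+1 -> R.
Local Notation mu := (@lebesgue_measure R).
Local Notation leb := (rV_lebesgue R n.+1).
Hypothesis hf : memLp (mu \x leb)%E 2 (`]0, T[ `*` Om) (fun z => f z.1 z.2).
Local Notation A := (@A_CR R n Om M alpha delta beta gamma nu pow).
Local Notation IP u v := (ip Om (pw (u : brokenP1 M)) (pw (v : brokenP1 M))).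

Variables (m : nat) (e : 'I_m -> brokenP1 M).
Hypothesis eo : orthonormal_in (CR Om) (fun u v : brokenP1 M => IP u v) e.
Hypothesis ee : forall v, CR Om v -> v = \sum_j IP v (e j) *: e j.

Let IK : rintegrable mu `]0, T[ K := hK.1.

Definition assemble (c : 'rV[R]_m) : brokenP1 M := \sum_j c 0 j *: e j.

Let IPLr u a v w : IP u (a *: v + w) = a * IP u v + IP u w.
Proof. by apply: (ip_pwL hM oOm bOm); exact: rintegrable_pw. Qed.

Let IPLl u a v w : IP (a *: v + w) u = a * IP v u + IP w u.
Proof. by rewrite ![ip _ _ (pw u)]ipC IPLr. Qed.

Lemma assemble_coord c j : IP (assemble c) (e j) = c 0 j.
Proof.
rewrite /assemble (linear_form_sum _ _ _ (IPLl (e j))) (bigD1 j)//= big1 ?addr0.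
  by rewrite eo.2 eqxx mulr1.
by move=> i ij; rewrite eo.2 (negbTE ij) mulr0.
Qed.

Lemma assembleK v : CR Om v -> assemble (\row_j IP v (e j)) = v.
Proof. by move=> /ee {2}->; apply: eq_bigr => j _; rewrite mxE. Qed.

Lemma CR_assemble c : CR Om (assemble c).
Proof.
rewrite /assemble; elim: (index_enum _) => [|j s ih].
  by rewrite big_nil; exact: CR0.
by rewrite big_cons; apply: CRL => //; exact: eo.1.
Qed.

Lemma assembleB c c' : assemble c - assemble c' = assemble (c - c').
Proof. by rewrite /assemble -sumrB; apply: eq_bigr => j _; rewrite !mxE scalerBl. Qed.

Lemma norm_assemble_le c : `|assemble c| <= (\sum_j `|e j|) * `|c|.
Proof.
rewrite /assemble mulr_suml; apply: (le_trans (ler_norm_sum _ _ _)).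
apply: ler_sum => j _; rewrite mx_normZ mulrC ler_wpM2l//.
exact: row_coord_le.
Qed.

Definition galerkin (c : 'rV[R]_m) : 'rV[R]_m := \row_j (- A (assemble c) (e j)).

Lemma galerkin_lipschitz : locally_lipschitz galerkin.
Proof.
move=> r; pose E := \sum_j `|e j|; have E0 : 0 <= E by exact: sumr_ge0.
have /choice [L HL] : forall j, exists L : R, 0 <= L /\ forall u v : brokenP1 M,
    `|u| <= E * r -> `|v| <= E * r -> `|A u (e j) - A v (e j)| <= L * `|u - v|.
  move=> j; have [L L0 HL] := lip_A_CR hM oOm bOm alpha beta gamma nu delta1 hpow (e j) (E * r).
  by exists L; split.
have SL : 0 <= \sum_j L j by apply: sumr_ge0 => j _; have [] := HL j.
exists ((\sum_j L j) * E) => [|x y xr yr]; first exact: mulr_ge0.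
apply: row_norm_le => [|j]; first by rewrite !mulr_ge0.
have [L0 Lj] := HL j.
have -> : (galerkin x - galerkin y) 0 j = A (assemble y) (e j) - A (assemble x) (e j).
  by rewrite !mxE opprK addrC.
rewrite distrC.
have bd z : `|z| <= r -> `|assemble z| <= E * r.
  by move=> zr; rewrite (le_trans (norm_assemble_le z))// ler_wpM2l.
apply: (le_trans (Lj _ _ (bd _ xr) (bd _ yr))).
rewrite assembleB -mulrA; apply: ler_pM => //; last exact: norm_assemble_le.
by rewrite (bigD1 j)//= lerDl; apply: sumr_ge0 => i _; have [] := HL i.
Qed.

Definition galerkin_growth : R := beta * ((1 - gamma) ^+ 2 / 4).

(** Summing over an orthonormal basis turns the left-hand side into [- A_CR (u, u)] and
the right-hand side into the squared [L^2] norm of [u]. *)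
Lemma galerkin_dissipative : dissipative galerkin_growth galerkin.
Proof.
move=> c.
have AL := A_CRL hM oOm bOm alpha beta gamma nu delta1 hpow (assemble c).
apply: (@le_trans _ _ (- A (assemble c) (assemble c))).
  rewrite {2}/assemble (linear_form_sum _ _ _ AL) -sumrN le_eqVlt.
  apply/orP; left; apply/eqP; apply: eq_bigr => j _.
  by rewrite mxE mulNr mulrC.
apply: le_trans (A_CR_coercive hM oOm bOm alpha gamma delta1 hpow _ (ltW nu0) (ltW beta0)) _.
rewrite -/galerkin_growth le_eqVlt; apply/orP; left; apply/eqP; congr (_ * _).
rewrite {2}/assemble (linear_form_sum _ _ _ (IPLr _)); apply: eq_bigr => j _.
by rewrite assemble_coord expr2.
Qed.

Local Notation Q := ('I_(nel M) * 'I_n.+1)%type.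

(** One scalar memory for each element and each space direction, i.e. for each entry of the
broken gradient. *)
Definition memory_weight (q : Q) : R := eta * elt_mass Om q.1.
Definition slope (q : Q) (j : 'I_m) : R := e j q.1 (lift ord0 q.2).
Definition load (j : 'I_m) (t : R) : R := ip Om (f t) (pw (e j)).

Local Notation rhs := (memory_rhs K memory_weight slope load galerkin).

Lemma memory_weight_ge0 q : 0 <= memory_weight q.
Proof. by rewrite mulr_ge0// elt_mass_ge0. Qed.

Lemma rintegrable_load j : rintegrable mu `]0, T[ (load j).
Proof. exact: (rintegrable_forcing hM oOm bOm hf). Qed.

Definition scheme_at (z : R -> brokenP1 M) (w : brokenP1 M) (t : R) := forall chi, CR Om chi ->
  ip Om (pw w) (pw chi) + A (z t) chi
  + eta * \sum_(i < n.+1)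
      ip Om (fun x => kernel_conv K (fun s => pwgrad (z s) i x) t) (pwgrad chi i)
  = ip Om (f t) (pw chi).

(** Both sides of the scheme are linear in the test function, so it is enough to test with
the basis. *)
Lemma scheme_atP (c : R -> 'rV[R]_m) w t : bounded_measurable c -> 0 < t < T ->
  rintegrable leb Om (f t) ->
  scheme_at (assemble \o c) w t <-> forall j, IP w (e j) = rhs c t 0 j.
Proof.
move=> [mc [B cB]] /andP[t0 tT] If.
have tT' : 0 < t <= T by rewrite t0 ltW.
pose z := assemble \o c.
have zE s k i : z s k i = \sum_j e j k i * c s 0 j.
  by rewrite /z /= /assemble summxE; apply: eq_bigr => j _; rewrite mxE mulrC.
have mz k i : measurable_fun setT (fun s => z s k i).
  rewrite (_ : (fun s => _) = (fun s => \sum_j e j k i * c s 0 j)); last first.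
    by apply/funext => s; exact: zE.
  by apply: measurable_sum => j; apply: measurable_funM => //; exact: mc.
have B0 : 0 <= B by exact: le_trans (normr_ge0 _) (cB 0).
have zB k i s : `|z s k i| <= (\sum_j `|e j|) * B.
  rewrite (le_trans (mx_entry_le _ _ _))// (le_trans (norm_assemble_le _))//.
  by rewrite ler_wpM2l// sumr_ge0.
have memE chi : eta * \sum_(i < n.+1)
    ip Om (fun x => kernel_conv K (fun s => pwgrad (z s) i x) t) (pwgrad chi i) =
    \sum_(q : Q) memory_weight q * chi q.1 (lift ord0 q.2) *
      kernel_conv K (mode slope q c) t.
  rewrite (memory_form hM oOm bOm chi IK tT' mz zB) mulr_sumr; apply: eq_bigr => q _.
  rewrite /memory_weight !mulrA; congr (_ * kernel_conv K _ t).
  by apply/funext => s; rewrite zE.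
(* Linear in [chi], and zero exactly when the scheme holds against [chi]. *)
pose residual chi := ip Om (pw w) (pw chi) + A (z t) chi
  + \sum_(q : Q) memory_weight q * chi q.1 (lift ord0 q.2) *
      kernel_conv K (mode slope q c) t - ip Om (f t) (pw chi).
have resL r u v : residual (r *: u + v) = r * residual u + residual v.
  have AL := A_CRL hM oOm bOm alpha beta gamma nu delta1 hpow (z t) r u v.
  have FL := ip_pwL hM oOm bOm r u v If.
  have -> : residual (r *: u + v) = (r * IP w u + IP w v) + (r * A (z t) u + A (z t) v)
    + (r * (\sum_(q : Q) memory_weight q * u q.1 (lift ord0 q.2) * kernel_conv K (mode slope q c) t)
       + \sum_(q : Q) memory_weight q * v q.1 (lift ord0 q.2) * kernel_conv K (mode slope q c) t)
    - (r * ip Om (f t) (pw u) + ip Om (f t) (pw v)).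
    rewrite /residual IPLr AL FL; congr (_ + _ - _).
    rewrite mulr_sumr -big_split/=; apply: eq_bigr => q _.
    by rewrite !mxE; ring.
  by rewrite /residual; ring.
have rese j : residual (e j) = IP w (e j) - rhs c t 0 j.
  rewrite /residual mxE /galerkin mxE /memory /load /slope /z/=; ring.
split=> [H j|H chi Cchi].
  apply/eqP; rewrite -subr_eq0 -rese /residual subr_eq0 -memE; apply/eqP.
  by apply: H; exact: eo.1.
rewrite -/z memE; apply/eqP; rewrite -subr_eq0 -/(residual chi).
rewrite (ee Cchi) (linear_form_sum _ _ _ resL) big1// => j _.
by rewrite rese H subrr mulr0.
Qed.

Local Notation solution := (@semidiscrete_solution R n Om M alpha delta beta gamma nu eta T pow K f).

Let aeF := lebesgue_ae_filter R.

Lemma galerkin_exists u0h : CR Om u0h -> exists u, solution u0h u.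
Proof.
move=> C0h.
have C0 : 0 <= galerkin_growth.
  by rewrite mulr_ge0 ?(ltW beta0)// divr_ge0 ?sqr_ge0.
have [c bc solc] := memory_system_exists IK slope memory_weight_ge0 rintegrable_load
  (\row_j IP u0h (e j)) C0 hK galerkin_lipschitz galerkin_dissipative.
have c00 : c 0 = \row_j IP u0h (e j).
  apply/rowP => j; rewrite solc ?lexx ?ltW//.
  by rewrite /primitive set_itv_ge ?bnd_simp// Rintegral_set0 addr0.
have u0E : assemble (c 0) = u0h by rewrite c00 assembleK.
exists (assemble \o c); split.
- by move=> t _; exact: CR_assemble.
- by move=> chi _; rewrite /= u0E.
- exists (assemble \o rhs c).
    move=> k i.
    have dE s : (assemble \o rhs c) s k i = \sum_j e j k i * rhs c s 0 j.
      by rewrite /= /assemble summxE; apply: eq_bigr => j _; rewrite mxE mulrC.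
    have Ij j : rintegrable mu `]0, T[ (fun s => rhs c s 0 j).
      exact: (rintegrable_memory_rhs IK slope memory_weight_ge0 rintegrable_load j
        galerkin_lipschitz bc).
    split.
      have : rintegrable mu `]0, T[ (fun s => \sum_j e j k i * rhs c s 0 j).
        by apply: rintegrable_sum => // j _; exact: rintegrableZ.
      by apply: eq_rintegrable => // s _; rewrite dE.
    move=> t /[dup] tT /andP[t0 tT']; rewrite [(assemble \o c) 0]/= c00 /=.
    have -> : \int[mu]_(s in `]0, t[) (assemble (rhs c s)) k i =
        \sum_j e j k i * primitive (fun s => rhs c s 0 j) t.
      have Ijt j : rintegrable mu `]0, t[ (fun s => rhs c s 0 j).
        by apply: integrableS (Ij j) => //; apply: subset_itvl; rewrite bnd_simp.
      transitivity (\int[mu]_(s in `]0, t[) (\sum_j e j k i * rhs c s 0 j)).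
        by apply: eq_Rintegral => s _; exact: dE.
      rewrite Rintegral_sum//; last by move=> j _; exact: rintegrableZ.
      by apply: eq_bigr => j _; rewrite RintegralZl; [|by []|exact: Ijt].
    rewrite /assemble !summxE -big_split/=; apply: eq_bigr => j _.
    by rewrite !mxE solc// mxE mulrDl (mulrC _ (primitive _ _)).
  have := forcing_integrable_ae hM oOm bOm hf; apply: (@filterS _ _ aeF) => t If tT.
  apply/(scheme_atP _ bc tT (If tT)) => j.
  exact: assemble_coord.
Qed.

(** The derivative [du] of a solution is not asked to lie in the Crouzeix-Raviart space;
the scheme sees it through its inner products with the basis only, and these are linear
combinations of its entries. *)
Lemma solution_coord u0h u : solution u0h u ->
  exists c D : R -> 'rV[R]_m,
    [/\ bounded_measurable c,
        forall t : R, 0 <= t <= T -> u t = assemble (c t),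
        forall j, rintegrable mu `]0, T[ (fun s => D s 0 j),
        forall (t : R) j, 0 <= t <= T ->
          c t 0 j = IP u0h (e j) + primitive (fun s => D s 0 j) t
      & {ae mu, forall s : R, 0 < s < T -> D s = rhs c s}].
Proof.
move=> [uCR u_init [du dut scheme]].
pose D s : 'rV[R]_m := \row_j IP (du s) (e j).
pose c := primitive_state T (\row_j IP u0h (e j)) D.
pose a (k : 'I_(nel M)) (i : 'I_n.+2) j : R := IP (delta_mx k i : brokenP1 M) (e j).
have IPE (w : brokenP1 M) j : IP w (e j) = \sum_k \sum_i a k i j * w k i.
  rewrite {1}[w]matrix_sum_delta pair_bigA/= (linear_form_sum _ (fun p => w p.1 p.2)
    (fun p => delta_mx p.1 p.2) (IPLl (e j))) pair_bigA/=.
  by apply: eq_bigr => p _; rewrite mulrC.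
have Iw t k i : t <= T -> rintegrable mu `]0, t[ (fun s => du s k i).
  move=> tT; apply: integrableS (dut k i).1 => //.
  by apply: subset_itvl; rewrite bnd_simp.
have ID t j : t <= T -> rintegrable mu `]0, t[ (fun s => D s 0 j).
  move=> tT.
  have : rintegrable mu `]0, t[ (fun s => \sum_k \sum_i a k i j * du s k i).
    apply: rintegrable_sum => // k _; apply: rintegrable_sum => // i _.
    by apply: rintegrableZ => //; exact: Iw.
  by apply: eq_rintegrable => // s _; rewrite mxE IPE.
have coord (t : R) j : 0 <= t <= T ->
    IP (u t) (e j) = IP u0h (e j) + primitive (fun s => D s 0 j) t.
  move=> /[dup] tT /andP[t0 tT'].
  rewrite -u_init; last exact: eo.1.
  rewrite !IPE; have -> : primitive (fun s => D s 0 j) t =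
      \sum_k \sum_i a k i j * \int[mu]_(s in `]0, t[) du s k i.
    transitivity (\int[mu]_(s in `]0, t[) (\sum_k \sum_i a k i j * du s k i)).
      by apply: eq_Rintegral => s _; rewrite mxE IPE.
    rewrite Rintegral_sum//; last first.
      move=> k _; apply: rintegrable_sum => // i _.
      by apply: rintegrableZ => //; exact: Iw.
    apply: eq_bigr => k _; rewrite Rintegral_sum//; last first.
      by move=> i _; apply: rintegrableZ => //; exact: Iw.
    by apply: eq_bigr => i _; rewrite RintegralZl//; exact: Iw.
  rewrite -big_split/=; apply: eq_bigr => k _; rewrite -big_split/=.
  by apply: eq_bigr => i _; rewrite -mulrDr (dut k i).2.
have cE (t : R) j : 0 <= t <= T ->
    c t 0 j = IP u0h (e j) + primitive (fun s => D s 0 j) t.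
  by move=> tT; rewrite /c /primitive_state tT !mxE.
have bc : bounded_measurable c by apply: bounded_measurable_primitive => j; exact: ID.
have uE (t : R) : 0 <= t <= T -> u t = assemble (c t).
  move=> tT; rewrite -(assembleK (uCR t tT)); congr assemble.
  by apply/rowP => j; rewrite mxE coord// cE.
exists c, D; split=> //; first by move=> j; exact: ID.
have := forcing_integrable_ae hM oOm bOm hf.
apply: (@filterS2 _ _ aeF _ _ _ _ scheme) => s eq_s If sT.
apply/rowP => j; rewrite mxE; move: j.
apply/(scheme_atP _ bc sT (If sT)) => chi Cchi.
have sT' : 0 <= s <= T by case/andP: sT => /ltW -> /ltW ->.
have E i : (fun x => kernel_conv K (fun r => pwgrad ((assemble \o c) r) i x) s) =
    (fun x => kernel_conv K (fun r => pwgrad (u r) i x) s).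
  apply/funext => x; apply: eq_Rintegral => r; rewrite inE/= in_itv/= => /andP[r0 rs].
  by rewrite uE// (ltW r0) (le_trans (ltW rs))//; case/andP: sT'.
have ES := eq_bigr (op := +%R) (idx := 0 : R) (r := index_enum 'I_n.+1) (P := xpredT) _
  (fun i _ => congr1 (fun F => ip Om F (pwgrad chi i)) (E i)).
have uA : A ((assemble \o c) s) chi = A (u s) chi by rewrite (uE s sT').
by rewrite uA ES; exact: eq_s.
Qed.

(** Both coordinate curves are bounded, so a single local Lipschitz constant controls their
difference. *)
Lemma galerkin_unique u0h u v : solution u0h u -> solution u0h v ->
  forall t : R, 0 <= t <= T -> u t = v t.
Proof.
move=> /solution_coord [c [D [bc uE ID cE Dae]]] /solution_coord [c' [D' [bc' vE ID' cE' Dae']]].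
have [[_ [B cB]] [_ [B' cB']]] := (bc, bc').
have [L L0 HL] := galerkin_lipschitz (Num.max B B').
pose L1 := L + memory_lipschitz T K memory_weight slope.
have L10 : 0 <= L1 by rewrite addr_ge0// memory_lipschitz_ge0//; exact: memory_weight_ge0.
have c0 : forall t : R, 0 <= t <= T -> c t - c' t = 0.
  apply: (@volterra_zero _ _ _ L1 (fun t => c t - c' t) (fun t => D t - D' t)) => //.
  - by exists (B + B') => t _; rewrite (le_trans (ler_normB _ _))// lerD.
  - move=> j; apply: eq_rintegrable (rintegrableB _ (ID j) (ID' j)) => // s _.
    by rewrite !mxE.
  - move=> j t /[dup] tT /andP[t0 tT'].
    rewrite !mxE cE// cE'// opprD addrACA subrr add0r.
    have sub : `]0, t[%classic `<=` (`]0, T[%classic : set R).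
      by apply: subset_itvl; rewrite bnd_simp.
    have It : rintegrable mu `]0, t[ (fun s => D s 0 j) by exact: integrableS (ID j).
    have It' : rintegrable mu `]0, t[ (fun s => D' s 0 j) by exact: integrableS (ID' j).
    by rewrite /primitive -RintegralB//; apply: eq_Rintegral => s _; rewrite !mxE.
  - move=> l b l0 b0 cb.
    apply: (@filterS2 _ _ aeF _ _ _ _ Dae Dae') => s Ds Ds' sT.
    rewrite Ds// Ds'//.
    apply: (norm_memory_rhsB_le IK slope memory_weight_ge0 load bc bc' L0 l0 b0 _ cb sT) => r rT.
    by apply: HL; rewrite le_max ?cB ?cB' ?orbT.
move=> t tT; rewrite uE// vE//; congr assemble; apply/eqP.
by rewrite -subr_eq0 c0.
Qed.

End galerkin.

(* The space dimension is [n.+1]. *)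
Theorem theorem2p5 (R : realType) (n : nat) (hn : n.+1 = 2%N \/ n.+1 = 3%N)
    (Om : set 'rV[R]_n.+1) (hOm : domain Om)
    (T : R) (hT : 0 < T)
    (alpha delta beta gamma nu eta : R)
    (halpha : 0 < alpha) (hdelta : 1 <= delta) (hbeta : 0 < beta)
    (hgamma : 0 < gamma < 1) (hnu : 0 < nu) (heta : 0 <= eta)
    (pow : R -> R) (hpow : real_power delta pow)
    (K : R -> R) (hK : positive_kernel T K)
    (M : mesh R n) (hM : mesh_of M Om)
    (rho : R) (hrho : shape_regular M rho)
    (f : R -> 'rV[R]_n.+1 -> R)
    (hf : memLp (@lebesgue_measure R \x rV_lebesgue R n.+1)%E 2
            (`]0, T[ `*` Om) (fun z => f z.1 z.2))
    (u0 : 'rV[R]_n.+1 -> R) (hu0 : memLp (rV_lebesgue R n.+1) 2 Om u0)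
    (u0h : brokenP1 M) (hu0h : CR Om u0h) :
  (exists u : R -> brokenP1 M,
     semidiscrete_solution Om alpha delta beta gamma nu eta T pow K f u0h u) /\
  (memLp (rV_lebesgue R n.+1) (n.+1%:R * delta) Om (pw u0h) ->
   forall u v : R -> brokenP1 M,
     semidiscrete_solution Om alpha delta beta gamma nu eta T pow K f u0h u ->
     semidiscrete_solution Om alpha delta beta gamma nu eta T pow K f u0h v ->
     forall t : R, 0 <= t <= T -> u t = v t).
Proof.
have [[_ oOm bOm] _] := hOm.
have IPL a (u v w : brokenP1 M) : ip Om (pw (a *: u + v)) (pw w) =
    a * ip Om (pw u) (pw w) + ip Om (pw v) (pw w).
  by rewrite ![ip _ _ (pw w)]ipC; apply: (ip_pwL hM oOm bOm); exact: rintegrable_pw.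
have [m [e [eo ee]]] := @orthonormal_basis R 'M[R]_(nel M, n.+2) (CR Om)
  (fun u v : brokenP1 M => ip Om (pw u) (pw v)) (CR0 Om M) (@CRL R n Om M) IPL
  (fun u v => ipC Om (pw u) (pw v)) (fun v => ip_pw_gt0 hM oOm bOm hrho (v := v)).
split=> [|_ u v].
  exact: (galerkin_exists hM oOm bOm alpha gamma hT hdelta hbeta hnu heta hpow hK hf eo ee hu0h).
exact: (galerkin_unique hM oOm bOm hdelta heta hpow hK hf eo ee).
Qed.
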